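(* Let $a\in C^{\infty}_{0}(\mathbb{R}^{n})$, and for each $j=1,\dots,n$ let $\pm_{j}$ be a fixed sign ''$+$'' or ''$-$''. (i) If $p:=(p_{1},\dots,p_{n})\in(0,\infty)^{n}$, then for any $N\in\mathbb{N}$, $$\int_{(0,\infty)^{n}}e^{i\lambda\sum_{j=1}^{n}\pm_{j}x_{j}^{p_{j}}}a(x)\,dx=\sum_{\alpha\in\Omega_{p}^{N}}\prod_{j=1}^{n}\tilde{I}^{\pm_{j}}_{p_{j},\alpha_{j}+1}\frac{\partial_{x}^{\alpha}a(0)}{\alpha!}\lambda^{-\sum_{j=1}^{n}\frac{\alpha_{j}+1}{p_{j}}}+O\Big(\lambda^{-\frac{N+1-\max(p_{j}-[p_{j}])}{\max p_{j}}}\Big)$$ as $\lambda\to\infty$, where $$\Omega_{p}^{N}:=\bigg\{\alpha=(\alpha_{1},\dots,\alpha_{n})\in\mathbb{Z}_{\geq 0}^{n}\ \bigg|\ \sum_{j=1}^{n}\frac{\alpha_{j}+1}{p_{j}}<\frac{N+1-\max(p_{j}-[p_{j}])}{\max p_{j}}\bigg\}$$ and $$\tilde{I}^{\pm_{j}}_{p_{j},\alpha_{j}+1}:=Os\text{-}\int_{0}^{\infty}e^{\pm_{j}ix_{j}^{p_{j}}}x_{j}^{\alpha_{j}}\,dx_{j}=p_{j}^{-1}e^{\pm_{j}i\frac{\pi}{2}\frac{\alpha_{j}+1}{p_{j}}}\Gamma\left(\frac{\alpha_{j}+1}{p_{j}}\right).$$ (ii) If $m:=(m_{1},\dots,m_{n})\in\mathbb{N}^{n}$,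 then for any $N\in\mathbb{N}$, $$\int_{\mathbb{R}^{n}}e^{i\lambda\sum_{j=1}^{n}\pm_{j}x_{j}^{m_{j}}}a(x)\,dx=\sum_{\alpha\in\Omega_{m}^{N}}\prod_{j=1}^{n}c^{\pm_{j}}_{m_{j},\alpha_{j}}\frac{\partial_{x}^{\alpha}a(0)}{\alpha!}\lambda^{-\sum_{j=1}^{n}\frac{\alpha_{j}+1}{m_{j}}}+O\Big(\lambda^{-\frac{N+1}{\max m_{j}}}\Big)$$ as $\lambda\to\infty$, with $\Omega_{m}^{N}$ given by the definition in (i) with $p=m$, and $$c^{\pm_{j}}_{m_{j},\alpha_{j}}:=\tilde{I}_{m_{j},\alpha_{j}+1}^{\pm_{j}}+(-1)^{\alpha_{j}}\tilde{I}_{m_{j},\alpha_{j}+1}^{\pm_{j}\pm^{m_{j}}},$$ where $$\tilde{I}_{m_{j},\alpha_{j}+1}^{\pm_{j}\pm^{m_{j}}}:=Os\text{-}\int_{0}^{\infty}e^{\pm_{j}(-1)^{m_{j}}ix_{j}^{m_{j}}}x_{j}^{\alpha_{j}}\,dx_{j}=m_{j}^{-1}e^{\pm_{j}(-1)^{m_{j}}i\frac{\pi}{2}\frac{\alpha_{j}+1}{m_{j}}}\Gamma\left(\frac{\alpha_{j}+1}{m_{j}}\right).$$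
   Context: $\mathbb{N}=\{1,2,\dots\}$; $[x]$ is the greatest integer $\leq x$; maxima are over $j=1,\dots,n$; $\Gamma$ is the Gamma function; $C^\infty_0(\mathbb{R}^n)$ is the set of compactly supported smooth complex-valued functions. For a multi-index $\alpha$, $\alpha!=\alpha_{1}!\cdots\alpha_{n}!$ and $\partial_{x}^{\alpha}=\partial_{x_{1}}^{\alpha_{1}}\cdots\partial_{x_{n}}^{\alpha_{n}}$. For $p>0$, $q>0$, $Os\text{-}\int_{0}^{\infty}e^{\pm ix^{p}}x^{q-1}dx:=\lim_{\varepsilon\to+0}\int_{0}^{\infty}e^{\pm ix^{p}}x^{q-1}\chi(\varepsilon x)\,dx$, where the limit exists and is the same for every Schwartz function $\chi\in\mathcal{S}(\mathbb{R})$ with $\chi(0)=1$. *)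

(* Defs.v *)
From HB Require Import structures.
From mathcomp Require Import all_boot all_order all_algebra.
From mathcomp Require Export complex.
From mathcomp Require Import all_classical all_reals all_analysis.

Set Implicit Arguments.
Unset Strict Implicit.
Unset Printing Implicit Defensive.

Import Order.TTheory GRing.Theory Num.Theory.
Import numFieldNormedType.Exports.
Local Open Scope classical_set_scope.
Local Open Scope ring_scope.
Local Open Scope complex_scope.

(* The n-dimensional Lebesgue measure, on n.-tuple R with its product
   sigma-algebra: the image under (x, t) |-> x :: t of the product of the
   measures of dimensions 1 and n. *)
Section lebesgue_tuple_step.
Context (R : realType) (n : nat).
Local Notation T := (measurableTypeR R).
Variable mu : {sigma_finite_measure set (n.-tuple T) -> \bar R}.

Definition tcons (x : T * n.-tuple T) : n.+1.-tuple T := [tuple of x.1 :: x.2].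

Lemma measurable_tcons : measurable_fun [set: T * n.-tuple T] tcons.
Proof. exact: (measurable_cons measurable_fst measurable_snd). Qed.

Definition lebesgue_tupleS : set (n.+1.-tuple T) -> \bar R :=
  pushforward (lebesgue_measure \x mu)%E tcons.

Let lebesgue_tupleS0 : lebesgue_tupleS set0 = 0%E.
Proof. by rewrite /lebesgue_tupleS /pushforward preimage_set0 measure0. Qed.

Let lebesgue_tupleS_ge0 A : (0 <= lebesgue_tupleS A)%E.
Proof. by rewrite /lebesgue_tupleS /pushforward measure_ge0. Qed.

Let lebesgue_tupleS_sigma_additive : semi_sigma_additive lebesgue_tupleS.
Proof.
move=> F mF tF mUF; rewrite /lebesgue_tupleS /pushforward preimage_bigcup.
apply: measure_semi_sigma_additive.
- by move=> k; rewrite -[X in measurable X]setTI; exact: measurable_tcons.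
- apply/trivIsetP => /= i j _ _ ij; rewrite -preimage_setI.
  by move/trivIsetP : tF => /(_ _ _ _ _ ij) ->//; rewrite preimage_set0.
- by rewrite -preimage_bigcup -[X in measurable X]setTI; exact: measurable_tcons.
Qed.

HB.instance Definition _ := isMeasure.Build _ _ _ lebesgue_tupleS
  lebesgue_tupleS0 lebesgue_tupleS_ge0 lebesgue_tupleS_sigma_additive.

Let lebesgue_tupleS_sigma_finite : sigma_finite setT lebesgue_tupleS.
Proof.
have /sigma_finiteP[F [FT ndF Foo]] := sigma_finiteT (@lebesgue_measure R).
have /sigma_finiteP[G [GT ndG Goo]] := sigma_finiteT mu.
pose g (t : n.+1.-tuple T) : T * n.-tuple T := (thead t, [tuple of behead t]).
have mg : measurable_fun setT g.
  apply/measurable_fun_pairP; split; last exact: measurable_behead.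
  exact: (@measurable_tnth _ _ n.+1 ord0).
have gK x : g (tcons x) = x.
  case: x => x t; rewrite /g /tcons /= theadE; congr pair.
  by apply/val_inj.
exists (fun k => g @^-1` (F k `*` G k)).
  apply/esym; rewrite -subTset => t _.
  have [k _ Fk] : (\bigcup_i F i) (g t).1 by rewrite -FT.
  have [l _ Gl] : (\bigcup_i G i) (g t).2 by rewrite -GT.
  exists (maxn k l) => //; split.
    by move: Fk; exact/subsetPset/ndF/leq_maxl.
  by move: Gl; exact/subsetPset/ndG/leq_maxr.
move=> k; have [? ?] := Foo k; have [? ?] := Goo k; split.
  by rewrite -[X in measurable X]setTI; apply: mg => //; exact: measurableX.
rewrite /lebesgue_tupleS /pushforward (_ : tcons @^-1` _ = F k `*` G k).
  by rewrite product_measure1E// lte_mul_pinfty// ge0_fin_numE.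
by rewrite -comp_preimage (_ : g \o tcons = id) ?preimage_id//; exact/funext.
Qed.

HB.instance Definition _ := Measure_isSigmaFinite.Build _ _ _ lebesgue_tupleS
  lebesgue_tupleS_sigma_finite.

End lebesgue_tuple_step.

Fixpoint lebesgue_tuple (R : realType) (n : nat) :
    {sigma_finite_measure set (n.-tuple (measurableTypeR R)) -> \bar R} :=
  if n is k.+1 then lebesgue_tupleS (lebesgue_tuple R k)
  else \d_([tuple] : 0.-tuple (measurableTypeR R)).

Definition vec (R : realType) (n : nat) (t : n.-tuple (measurableTypeR R)) :
  'rV[R]_n := \row_j tnth t j.

Definition pos_orthant (R : realType) (n : nat) :
  set (n.-tuple (measurableTypeR R)) := [set t | forall j, 0 < tnth t j].

Definition Cintegral d (T : measurableType d) (R : realType)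
    (mu : {measure set T -> \bar R}) (D : set T) (f : T -> R[i]) : R[i] :=
  (\int[mu]_(x in D) complex.Re (f x)) +i* (\int[mu]_(x in D) complex.Im (f x)).

Definition expi (R : realType) (t : R) : R[i] := cos t +i* sin t.

Definition Gamma (R : realType) (z : R) : R :=
  \int[lebesgue_measure]_(t in `]0%R, +oo[) (t `^ (z - 1) * expR (- t)).

(* R[i] is not a normed module over R in the library, so derivatives
   and continuity of complex-valued functions are taken on the real and
   imaginary parts. *)
Section smooth.
Context (R : realType) (n : nat).
Implicit Types a : 'rV[R]_n -> R[i].

Definition partial (j : 'I_n) a : 'rV[R]_n -> R[i] := fun x =>
  ('D_(delta_mx 0 j) (fun y => complex.Re (a y)) x) +i*
  ('D_(delta_mx 0 j) (fun y => complex.Im (a y)) x).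

Definition C1 a := forall part : R[i] -> R,
  part = @complex.Re R \/ part = @complex.Im R ->
  continuous (fun x => part (a x)) /\
  forall j x, derivable (fun y => part (a y)) x (delta_mx 0 j).

Definition smooth a := forall s : seq 'I_n, C1 (foldr partial a s).

Definition compactly_supported a := compact (closure [set x | a x != 0]).

Definition multi_partial (alpha : {ffun 'I_n -> nat}) a : 'rV[R]_n -> R[i] :=
  foldr (fun j b => iter (alpha j) (partial j) b) a (enum 'I_n).

Definition multi_fact (alpha : {ffun 'I_n -> nat}) : nat :=
  (\prod_j (alpha j)`!)%N.

End smooth.

Section schwartz.
Context (R : realType).
Implicit Types chi : R -> R[i].

Definition Cderive (k : nat) chi : R -> R[i] := fun x =>
  (derive1n k (fun y => complex.Re (chi y)) x) +i*
  (derive1n k (fun y => complex.Im (chi y)) x).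

Definition schwartz chi :=
  (forall k x, derivable (derive1n k (fun y => complex.Re (chi y))) x 1 /\
               derivable (derive1n k (fun y => complex.Im (chi y))) x 1) /\
  (forall k l, exists C : R, forall x,
     `|x| ^+ l * Normc.normc (Cderive k chi x) <= C).

(* \int_0^oo e^(i sg x^p) x^(q-1) chi(eps x) dx *)
Definition cutoff_integral (sg p q : R) chi (eps : R) : R[i] :=
  Cintegral lebesgue_measure `]0%R, +oo[
    (fun x => expi (sg * x `^ p) * (x `^ (q - 1))%:C * chi (eps * x)).

Definition is_Os_integral (sg p q : R) (L : R[i]) :=
  forall chi, schwartz chi -> chi 0 = 1 ->
    Normc.normc (cutoff_integral sg p q chi eps - L) @[eps --> 0^'+] --> (0 : R).

(* Junk value 0 if the limit fails to exist or depends on chi. *)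
Definition Itilde (sg p q : R) : R[i] := xget 0 (is_Os_integral sg p q).

Definition Itilde_closed_form (sg p q : R) : R[i] :=
  (p^-1)%:C * expi (sg * (pi / 2) * (q / p)) * (Gamma (q / p))%:C.

End schwartz.

Section index_set.
Context (R : realType) (n : nat).
Implicit Types p : 'I_n -> R.

(* The maxima are of nonnegative reals (for p > 0), so starting at 0 is
   harmless. *)
Definition maxp p : R := \big[Num.max/0]_j p j.

Definition max_frac p : R := \big[Num.max/0]_j (p j - (Num.floor (p j))%:~R).

Definition order_exp p (N : nat) : R := (N.+1%:R - max_frac p) / maxp p.

Definition alpha_exp p (alpha : {ffun 'I_n -> nat}) : R :=
  \sum_j (alpha j).+1%:R / p j.

Definition Omega p (N : nat) : set {ffun 'I_n -> nat} :=
  [set alpha | alpha_exp p alpha < order_exp p N].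

(* A sum \sum_(alpha \in Omega p N) is 0 by convention when its support is
   infinite; this never happens for p > 0. *)
Lemma finite_Omega p N : (forall j, 0 < p j) -> finite_set (Omega p N).
Proof.
move=> p0; pose c := order_exp p N.
pose K := (\max_j (Num.truncn (c * p j)).+1)%N.
pose h (f : {ffun 'I_n -> 'I_K}) : {ffun 'I_n -> nat} := [ffun j => f j : nat].
apply: (@sub_finite_set _ _ (h @` setT)); last exact/finite_image/finite_finset.
move=> al; rewrite /Omega /= => alc.
have alK j : (al j < K)%N.
  apply: (@leq_trans (Num.truncn (c * p j)).+1); last first.
    exact: (leq_bigmax j).
  have t0 i : 0 <= (al i).+1%:R / p i by rewrite divr_ge0// ltW.
  have : (al j).+1%:R / p j < c.
    apply: le_lt_trans alc; rewrite /alpha_exp (bigD1 j)//= lerDl.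
    exact: sumr_ge0.
  rewrite ltr_pdivrMr// => /ltW h1.
  have c0 : 0 <= c * p j by apply: le_trans h1.
  by rewrite ltnS ltnW// truncn_ge_nat.
exists [ffun j => Ordinal (alK j)] => //.
by apply/ffunP => j; rewrite /h !ffunE.
Qed.

End index_set.

(* Main.v *)
Require Import Defs.
From HB Require Import structures.
From mathcomp Require Import all_boot all_order all_algebra.
From mathcomp Require Import complex.
From mathcomp Require Import all_classical all_reals all_analysis.
From mathcomp Require Import measurable_realfun.
From mathcomp Require Import ring lra.
Set Implicit Arguments.
Unset Strict Implicit.
Unset Printing Implicit Defensive.
Import Order.TTheory GRing.Theory Num.Theory.
Import numFieldNormedType.Exports.
Local Open Scope classical_set_scope.
Local Open Scope ring_scope.

(* In one variable, let h_0(x) = x^r e^(-cos(th) x^p) cos(b + sin(th) x^p) with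
   |th| < pi/2 and let h_(k+1)(u) be the integral of h_k over (u, oo).
   Repeated integration by parts gives, for smooth f,
     \int h_0(x) f(eps x) dx
       = \sum_(k < K) eps^k f^(k)(0) \int h_k + eps^K \int h_K(x) f^(K)(eps x) dx,
   where k! \int h_k = \int x^k h_0 is a value of Gamma: rotating th is a linear
   differential equation for the moments. Integrating by parts against the
   oscillating factor shows that h_K(u) = O(u^(r + K - K p)) uniformly in th, so
   the formula passes to the limit th --> +-pi/2. For eps --> 0 it evaluates the
   oscillatory integrals, and for eps = lam^(-1/p) it is the expansion on the
   half-line, with a remainder that is a positive power of lam^-1 to the K; the
   expansion on the line follows by splitting at 0. Being uniform in the phase b,
   these expansions can be iterated with Fubini's theorem. As K is arbitrary,
   the terms of order at least the announced remainder are absorbed in it. *)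

(** At [th = +-pi/2] and r >= 0 the kernel is not absolutely integrable, so its tails are not
    Lebesgue integrals. The angle th is a regularisation for which everything converges and for
    which no contour has to be deformed. Only bounds with constants independent of th survive the
    limit; this is why the tails are estimated through the oscillation ([itail_bound]) and not
    through the damping factor. For p < 1 the tails may grow at infinity, but each costs at most the
    power [growth p = max (1 - p) 0 < 1] of x, while each derivative of f(eps x) brings a full
    factor eps. The net gain per step is [min p 1] powers of eps; being positive, it lets a large K
    outweigh any fixed loss. The complex exponential is replaced by a real cosine with a free phase
    b: shifting b by -pi/2 multiplies by -i, and shifting it by -th is the effect of differentiating
    the kernel. Real integrals with phases 0 and -pi/2 then recover all complex ones. *)

Section integrable_real.
Context d (T : measurableType d) (R : realType) (nu : {measure set T -> \bar R}).
Implicit Types (D : set T) (f g : T -> R).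

Lemma integrable_RZ D c f : measurable D -> nu.-integrable D (EFin \o f) ->
  nu.-integrable D (EFin \o (fun t => c * f t)).
Proof. by move=> mD /(integrableZl mD c). Qed.

Lemma integrable_RD D f g : measurable D -> nu.-integrable D (EFin \o f) ->
  nu.-integrable D (EFin \o g) -> nu.-integrable D (EFin \o (fun t => f t + g t)).
Proof. by move=> mD fi gi; have := integrableD mD fi gi. Qed.

Lemma integrable_Rabs D f : measurable D -> nu.-integrable D (EFin \o f) ->
  nu.-integrable D (EFin \o (fun t => `|f t|)).
Proof. by move=> mD fi; have := integrable_abse fi. Qed.

Lemma integrable_Rle D f g : measurable D -> measurable_fun D f ->
  (forall t, D t -> `|f t| <= g t) -> nu.-integrable D (EFin \o g) ->
  nu.-integrable D (EFin \o f).
Proof.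
move=> mD mf fg gi; apply: (le_integrable mD _ _ gi); first exact/measurable_EFinP.
by move=> t Dt; rewrite lee_fin (le_trans (fg _ Dt))// ler_norm.
Qed.

End integrable_real.

(** * Calculus on half-lines: exhaustion, substitution and dilation *)

Section half_line.
Context {R : realType}.
Notation mu := (@lebesgue_measure R).
Implicit Types (a b c l p x y df dg : R) (f g F G : R -> R).

(** Dominated convergence with [|f|] as the majorant; the sets [E n] need not increase, they only
    have to capture each point eventually. *)
Lemma Rintegral_cvg_sets d (T : measurableType d) (nu : {measure set T -> \bar R})
    (D : set T) (E : (set T)^nat) (f : T -> R) :
  measurable D -> (forall n, measurable (E n)) -> (forall n, E n `<=` D) ->
  (forall t, D t -> \forall n \near \oo, E n t) ->
  nu.-integrable D (EFin \o f) ->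
  \int[nu]_(t in E n) f t @[n --> \oo] --> \int[nu]_(t in D) f t.
Proof.
move=> mD mE ED DE intf.
have /integrableP[mf _] := intf.
have h n : (\int[nu]_(x in E n) (f x)%:E = \int[nu]_(x in D) ((EFin \o f) \_ (E n)) x)%E.
  by rewrite -integral_mkcondr setIidr.
suff hc : (\int[nu]_(x in D) ((EFin \o f) \_ (E n)) x)%E @[n --> \oo] -->
    (\int[nu]_(x in D) (f x)%:E)%E.
  apply: fine_cvg; rewrite fineK; last exact: integrable_fin_num.
  by rewrite (_ : (fun n => _) = (fun n => \int[nu]_(x in D) ((EFin \o f) \_ (E n)) x)%E) //; exact/funext.
apply: (@dominated_cvg _ _ _ nu D mD (fun n => (EFin \o f) \_ (E n)) (EFin \o f)
  (fun t => `|f t|%:E)).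
- move=> n; apply: (iffLR (measurable_restrict (EFin \o f) (mE n) mD)).
  by apply: measurable_funS mf => //; exact: subIsetl.
- move=> x Dx; apply: cvg_near_cst.
  by near=> n; rewrite patchE mem_set//; near: n; exact: DE.
- by [].
- exact: (integrable_abse intf).
- move=> n x Dx; rewrite patchE; case: ifP => _ //=.
  by rewrite normr0 lee_fin.
Unshelve. all: by end_near. Qed.

Lemma continuous_at_measurable_fun (D : set (measurableTypeR R)) f : measurable D ->
  (forall x, D x -> {for x, continuous f}) -> measurable_fun D f.
Proof.
move=> mD cf; apply: subspace_continuous_measurable_fun => //.
by apply: continuous_in_subspaceT => x; rewrite inE; exact: cf.
Qed.

Lemma Rintegral_FTC a b f F : a < b ->
  (forall x, a <= x <= b -> is_derive x 1 F (f x)) ->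
  (forall x, a <= x <= b -> {for x, continuous f}) ->
  \int[mu]_(x in `[a, b]) f x = F b - F a.
Proof.
move=> ab dF cf; rewrite /Rintegral (@continuous_FTC2 _ f F)//.
- by apply: continuous_in_subspaceT => x; rewrite inE/= in_itv/= => /cf.
- have cF x : a <= x <= b -> {for x, continuous F}.
    move=> /dF dx; apply/differentiable_continuous/derivable1_diffP.
    exact: ex_derive.
  split.
  + by move=> x; rewrite in_itv/= => /andP[/ltW ax /ltW xb]; apply: ex_derive; apply: dF; rewrite ax.
  + by apply: cvg_at_right_filter; apply: cF; rewrite lexx ltW.
  + by apply: cvg_at_left_filter; apply: cF; rewrite lexx ltW.
- move=> x; rewrite in_itv/= => /andP[/ltW ax /ltW xb]; rewrite derive1E.
  by apply: derive_val; apply: dF; rewrite ax.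
Qed.

(** The half-line is exhausted by the intervals [[a + 1/(n+1), a + n + 2]], nondegenerate already
    for n = 0. Nothing is asked of F at a, and only its limits along two sequences matter. *)
Lemma Rintegral_FTC_oy a f F l0 l :
  (forall x, a < x -> is_derive x 1 F (f x)) ->
  (forall x, a < x -> {for x, continuous f}) ->
  mu.-integrable `]a, +oo[ (EFin \o f) ->
  F (a + n.+1%:R^-1) @[n --> \oo] --> l0 ->
  F (a + n.+2%:R) @[n --> \oo] --> l ->
  \int[mu]_(x in `]a, +oo[) f x = l - l0.
Proof.
move=> dF cf intf Fl0 Fl.
have := @Rintegral_cvg_sets _ _ mu `]a, +oo[%classic
  (fun n => `[a + n.+1%:R^-1, a + n.+2%:R]%classic) f.
move=> /(_ _ _ _ _ intf) h.
have {}h : \int[mu]_(x in `[a + n.+1%:R^-1, a + n.+2%:R]) f x @[n --> \oo] -->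
    \int[mu]_(x in `]a, +oo[) f x.
  apply: h => //.
  - move=> n x /=; rewrite !in_itv/= andbT => /andP[ax _].
    by apply: lt_le_trans ax; rewrite ltrDl.
  - move=> x /=; rewrite in_itv/= andbT => ax.
    near=> n; rewrite in_itv/=; apply/andP; split.
      rewrite -lerBrDl -[leRHS]invrK lef_pV2 ?posrE ?invr_gt0 ?subr_gt0//.
      rewrite (@le_trans _ _ n%:R) ?ler_nat//.
      by near: n; exact: nbhs_infty_ger.
    rewrite -lerBlDl (@le_trans _ _ n%:R) ?ler_nat ?leqW//.
    by near: n; exact: nbhs_infty_ger.
apply: cvg_unique h _ => //.
have -> : (fun n : nat => \int[mu]_(x in `[a + n.+1%:R^-1, a + n.+2%:R]) f x) =
          (fun n : nat => F (a + n.+2%:R) - F (a + n.+1%:R^-1)).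
  apply/funext => n; apply: Rintegral_FTC.
  - by rewrite ltrD2l (@le_lt_trans _ _ 1)// ?ltr1n// invf_le1 ?ler1n.
  - by move=> x /andP[ax _]; apply: dF; apply: lt_le_trans ax; rewrite ltrDl.
  - by move=> x /andP[ax _]; apply: cf; apply: lt_le_trans ax; rewrite ltrDl.
exact: cvgB.
Unshelve. all: by end_near. Qed.


Lemma is_derive_continuous f x df : is_derive x 1 f df -> {for x, continuous f}.
Proof.
by move=> dx; apply/differentiable_continuous/derivable1_diffP/ex_derive.
Qed.

Lemma is_derive1_mul f g x df dg : is_derive x 1 f df -> is_derive x 1 g dg ->
  is_derive x 1 (fun y => f y * g y) (df * g x + f x * dg).
Proof.
move=> dF dG; have := @is_deriveM _ _ f g x 1 df dg dF dG.
by rewrite (_ : f * g = (fun y => f y * g y))// addrC /GRing.scale/= (mulrC (g x)).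
Qed.

Lemma is_derive1_add f g x df dg : is_derive x 1 f df -> is_derive x 1 g dg ->
  is_derive x 1 (fun y => f y + g y) (df + dg).
Proof. by move=> dF dG; exact: is_deriveD. Qed.

Lemma is_derive1_opp f x df : is_derive x 1 f df ->
  is_derive x 1 (fun y => - f y) (- df).
Proof. by move=> dF; exact: is_deriveN. Qed.

Lemma is_derive1_scale c f x df : is_derive x 1 f df ->
  is_derive x 1 (fun y => c * f y) (c * df).
Proof. by move=> dF; exact: (@is_deriveZ _ _ _ f c x 1 df). Qed.

Lemma is_derive1_expR f x df : is_derive x 1 f df ->
  is_derive x 1 (fun y => expR (f y)) (expR (f x) * df).
Proof. by move=> dF; exact: (@is_derive1_comp _ expR f x _ _ _ dF). Qed.

Lemma is_derive1_cos f x df : is_derive x 1 f df ->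
  is_derive x 1 (fun y => cos (f y)) (- sin (f x) * df).
Proof. by move=> dF; exact: (@is_derive1_comp _ (@cos R) f x _ _ _ dF). Qed.

Lemma is_derive1_sin f x df : is_derive x 1 f df ->
  is_derive x 1 (fun y => sin (f y)) (cos (f x) * df).
Proof. by move=> dF; exact: (@is_derive1_comp _ (@sin R) f x _ _ _ dF). Qed.

Lemma powRK_gt0 p x : p != 0 -> 0 <= x -> (x `^ p^-1) `^ p = x.
Proof. by move=> p0 x0; rewrite -powRrM mulVf// powRr1. Qed.

(** Both sides are monotone limits over compact intervals, where the substitution rule applies; in
    extended reals no integrability is required. The case [p = 1] gives dilations, the case [c = 1]
    the Gamma integral. *)
Lemma ge0_integral_powR_subst c p G : 0 < c -> 0 < p ->
  (forall x, 0 < x -> 0 <= G x) -> (forall x, 0 < x -> {for x, continuous G}) ->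
  (\int[mu]_(x in `]0%R, +oo[) (G x)%:E =
   \int[mu]_(x in `]0%R, +oo[) (G (c * x `^ p) * (c * (p * x `^ (p - 1))))%:E)%E.
Proof.
move=> c0 p0 G0 cG.
pose phi x := c * x `^ p; pose dphi x := c * (p * x `^ (p - 1)).
have phid x : 0 < x -> is_derive x 1 phi (dphi x).
  by move=> x0; apply: is_derive1_scale; exact: is_derive1_powR.
have dphic x : 0 < x -> {for x, continuous dphi}.
  move=> x0; apply: is_derive_continuous.
  by do 2 apply: is_derive1_scale; exact: is_derive1_powR.
have phi0 x : 0 < x -> 0 < phi x by move=> x0; rewrite mulr_gt0 ?powR_gt0.
have phi_lt x y : 0 < x -> x < y -> phi x < phi y.
  move=> x0 xy; rewrite ltr_pM2l// gt0_ltr_powR ?nnegrE//ltW//.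
  exact: lt_trans xy.
pose a (n : nat) : R := n.+1%:R^-1; pose b (n : nat) : R := n.+2%:R.
have a0 n : 0 < a n by rewrite invr_gt0.
have ab n : a n < b n.
  by rewrite (@le_lt_trans _ _ 1)// ?ltr1n// invf_le1 ?ler1n.
have alea m n : (m <= n)%N -> a n <= a m by move=> mn; rewrite lef_pV2 ?posrE ?ler_nat.
have bleb m n : (m <= n)%N -> b m <= b n by move=> mn; rewrite ler_nat.
have phi_le x y : 0 < x -> x <= y -> phi x <= phi y.
  by move=> x0; rewrite le_eqVlt => /predU1P[->//|xy]; exact/ltW/phi_lt.
have phi_ex x : 0 < x -> exists y, 0 < y /\ phi y = x.
  move=> x0; exists ((x / c) `^ p^-1); split; first by rewrite powR_gt0 ?divr_gt0.
  by rewrite /phi powRK_gt0 ?gt_eqF ?divr_ge0 ?ltW// mulrC divfK ?gt_eqF.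
have aUb (x : R) : 0 < x -> exists n, a n <= x <= b n.
  move=> x0; exists (Num.truncn x + Num.truncn x^-1)%N; apply/andP; split.
    rewrite -[leRHS]invrK lef_pV2 ?posrE ?invr_gt0// ltW//.
    by rewrite (lt_le_trans (truncnS_gt _))// ler_nat ltnS leq_addl.
  rewrite ltW// (lt_le_trans (truncnS_gt _))// ler_nat ltnS.
  exact: leq_trans (leq_addr _ _) (leqnSn _).
have E1 : (\int[mu]_(x in `[phi (a n), phi (b n)]) (G x)%:E @[n --> \oo] -->
  \int[mu]_(x in `]0%R, +oo[) (G x)%:E)%E.
  rewrite (_ : `]0, +oo[%classic = \bigcup_n `[phi (a n), phi (b n)]%classic); last first.
    apply/seteqP; split => x /=; rewrite in_itv/= ?andbT.
      move=> x0; have [y [y0 <-]] := phi_ex _ x0.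
      have [n /andP[ay yb]] := aUb _ y0.
      by exists n => //=; rewrite in_itv/= !phi_le.
    by move=> [n _]/=; rewrite in_itv/= => /andP[+ _]; apply: lt_le_trans; exact: phi0.
  apply: ge0_nondecreasing_set_cvg_integral => //.
  - move=> m n mn; apply/subsetPset => x /=; rewrite !in_itv/= => /andP[ax xb].
    by rewrite (le_trans _ ax) ?phi_le ?alea//= (le_trans xb)// phi_le ?bleb.
  - move=> n; apply/measurable_EFinP; apply: continuous_at_measurable_fun => // x /=; rewrite in_itv/= => /andP[ax _].
    by apply: cG; rewrite (lt_le_trans _ ax)// phi0.
  - move=> n x /=; rewrite in_itv/= => /andP[ax _].
    by rewrite lee_fin G0// (lt_le_trans _ ax)// phi0.
have E2 : (\int[mu]_(x in `[a n, b n]) (G (phi x) * dphi x)%:E @[n --> \oo] -->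
  \int[mu]_(x in `]0%R, +oo[) (G (phi x) * dphi x)%:E)%E.
  rewrite (_ : `]0, +oo[%classic = \bigcup_n `[a n, b n]%classic); last first.
    apply/seteqP; split => x /=; rewrite in_itv/= ?andbT.
      move=> x0; have [n axb] := aUb _ x0.
      by exists n => //=; rewrite in_itv/=.
    by move=> [n _]/=; rewrite in_itv/= => /andP[+ _]; apply: lt_le_trans.
  apply: ge0_nondecreasing_set_cvg_integral => //.
  - move=> m n mn; apply/subsetPset => x /=; rewrite !in_itv/= => /andP[ax xb].
    by rewrite (le_trans _ ax) ?alea//= (le_trans xb)// bleb.
  - move=> n; apply/measurable_EFinP; apply: continuous_at_measurable_fun => // x /=; rewrite in_itv/= => /andP[ax _].
    have x0 : 0 < x by exact: lt_le_trans ax.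
    apply: (@continuousM _ _ (G \o phi) dphi); last exact: dphic.
    apply: continuous_comp; last exact/cG/phi0.
    exact: is_derive_continuous (phid _ x0).
  - move=> n x /=; rewrite in_itv/= => /andP[ax _].
    have x0 : 0 < x by exact: lt_le_trans ax.
    by rewrite lee_fin mulr_ge0 ?G0 ?phi0// !mulr_ge0 ?powR_ge0 ?ltW.
apply: cvg_unique E1 _ => //.
rewrite (_ : (fun n => _) = (fun n => \int[mu]_(x in `[a n, b n]) (G (phi x) * dphi x)%:E)%E) //.
apply/funext => n.
have dphiE x : 0 < x -> phi^`()%classic x = dphi x.
  by move=> x0; rewrite derive1E; apply: derive_val; exact: phid.
have dphicvg x : 0 < x -> {for x, continuous phi^`()%classic}.
  move=> x0; rewrite /prop_for /continuous_at dphiE//.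
  apply: cvg_trans (dphic _ x0); apply: near_eq_cvg; near=> y; rewrite dphiE//.
  by near: y; exact: lt_nbhsr.
rewrite integration_by_substitution_increasing.
- by apply: eq_integral => x; rewrite inE/= in_itv/= => /andP[ax _]; rewrite fctE /= dphiE// (lt_le_trans _ ax).
- exact/ltW.
- move=> x y; rewrite !in_itv/= => /andP[ax _] _; apply: phi_lt.
  exact: lt_le_trans ax.
- by move=> x; rewrite in_itv/= => /andP[ax _]; apply: dphicvg; exact: lt_trans ax.
- apply/cvg_ex; exists (phi^`()%classic (a n)).
  exact/cvg_at_right_filter/dphicvg.
- apply/cvg_ex; exists (phi^`()%classic (b n)).
  by apply/cvg_at_left_filter/dphicvg; rewrite (lt_trans _ (ab _)).
- split.
  + move=> x; rewrite in_itv/= => /andP[ax _].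
    by apply: ex_derive; apply: phid; exact: lt_trans ax.
  + by apply: cvg_at_right_filter; apply: is_derive_continuous; exact: phid.
  + apply: cvg_at_left_filter; apply: is_derive_continuous; apply: phid.
    by rewrite (lt_trans _ (ab _)).
- apply: continuous_in_subspaceT => x; rewrite inE/= in_itv/= => /andP[ax _].
  by apply: cG; rewrite (lt_le_trans _ ax)// phi0.
Unshelve. all: by end_near. Qed.

Lemma is_derive1_inv f x df : f x != 0 -> is_derive x 1 f df ->
  is_derive x 1 (fun y => (f y)^-1) (- (f x) ^- 2 * df).
Proof. by move=> fx0 dF; exact: is_deriveV. Qed.

(** The reference majorant on (0, oo): comparison with it asks for a bound near 0 and quadratic
    decay. A primitive is [- (1 + y)^-1]. *)
Lemma integrable_inv_sqr : mu.-integrable `]0, +oo[ (fun x => ((1 + x) ^- 2)%:E).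
Proof.
have dinv x : 0 < x -> is_derive x 1 (fun y => - (1 + y)^-1) ((1 + x) ^- 2).
  move=> x0; have h : is_derive x 1 (fun y : R => 1 + y) (0 + 1) by exact: is_derive1_add.
  have x1 : 1 + x != 0 by rewrite gt_eqF// addr_gt0.
  have := is_derive1_opp (is_derive1_inv x1 h).
  by rewrite add0r mulr1 opprK.
have cinv x : 0 <= x -> {for x, continuous (fun x : R => (1 + x) ^- 2)}.
  move=> x0; apply: continuousV; first by rewrite /= expf_neq0// gt_eqF// ltr_pwDl.
  apply: (@continuousM _ _ (fun x => 1 + x) (fun x => 1 + x));
    by apply: continuousD; [exact: cvg_cst|exact: cvg_id].
apply/integrableP; split.
  apply/measurable_EFinP; apply: continuous_at_measurable_fun => //= x.
  by rewrite in_itv/= andbT => /ltW; exact: cinv.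
under eq_integral => x _.
  rewrite /= ger0_norm ?invr_ge0 ?sqr_ge0//.
  over.
rewrite integral_itv_obnd_cbnd; last first.
  apply/measurable_EFinP; apply: continuous_at_measurable_fun => //= x.
  by rewrite in_itv/= andbT => /ltW; exact: cinv.
rewrite (@ge0_continuous_FTC2y _ _ (fun y => - (1 + y)^-1) 0 0) ?ltry//.
- by move=> x _; rewrite invr_ge0 sqr_ge0.
- by apply: continuous_in_subspaceT => x; rewrite inE/= in_itv/= andbT; exact: cinv.
- rewrite -oppr0; apply: cvgN; apply/gtr0_cvgV0.
    by near=> x; rewrite addr_gt0//; near: x; exact: nbhs_pinfty_gt.
  exact: cvg_addrl.
- by move=> x /dinv dx; exact: ex_derive.
- apply: cvg_at_right_filter; apply: cvgN; apply: cvgV; first by rewrite addr0 oner_eq0.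
  by apply: cvgD; [exact: cvg_cst|exact: cvg_id].
- by move=> x; rewrite in_itv/= andbT => /dinv dx; rewrite derive1E; exact: derive_val.
Unshelve. all: by end_near. Qed.

Lemma integrable_oy_bound (f : R -> R) C : (forall x, 0 < x -> {for x, continuous f}) ->
  (forall x, 0 < x -> `|f x| <= C * (1 + x) ^- 2) ->
  mu.-integrable `]0, +oo[ (EFin \o f).
Proof.
move=> cf fC.
apply: (@integrable_Rle _ _ _ mu _ _ (fun x : measurableTypeR R => C * (1 + x) ^- 2)) => //.
- by apply: continuous_at_measurable_fun => // x /=; rewrite in_itv/= andbT; exact: cf.
- by move=> x /=; rewrite in_itv/= andbT; exact: fC.
- by apply: integrable_RZ => //; exact: integrable_inv_sqr.
Qed.

(** The substitution is available for nonnegative functions, so g is written as [(g + |g|) - |g|],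
    both terms being nonnegative and continuous. *)
Lemma Rintegral_scale c (g : R -> R) : 0 < c -> (forall x, 0 < x -> {for x, continuous g}) ->
  mu.-integrable `]0, +oo[ (EFin \o g) ->
  mu.-integrable `]0, +oo[ (EFin \o (fun x => g (c * x))) ->
  \int[mu]_(x in `]0, +oo[) g x = c * \int[mu]_(x in `]0, +oo[) g (c * x).
Proof.
move=> c0 cg ig igc.
have H (G : R -> R) : (forall x, 0 < x -> 0 <= G x) -> (forall x, 0 < x -> {for x, continuous G}) ->
    mu.-integrable `]0, +oo[ (EFin \o (fun x => G (c * x))) ->
    \int[mu]_(x in `]0, +oo[) G x = c * \int[mu]_(x in `]0, +oo[) G (c * x).
  move=> G0 cG iG; rewrite /Rintegral (@ge0_integral_powR_subst c 1)//.
  rewrite -RintegralZl//; congr fine; apply: eq_integral => x.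
  by rewrite inE/= in_itv/= andbT => x0; rewrite powRr1 ?ltW// subrr powRr0 !mulr1 mulrC.
have ign : mu.-integrable `]0, +oo[ (EFin \o (fun x => `|g x|)) by exact: integrable_Rabs.
have ignc : mu.-integrable `]0, +oo[ (EFin \o (fun x => `|g (c * x)|)) by exact: integrable_Rabs.
have igp : mu.-integrable `]0, +oo[ (EFin \o (fun x => g x + `|g x|)) by exact: integrable_RD.
have igpc : mu.-integrable `]0, +oo[ (EFin \o (fun x => g (c * x) + `|g (c * x)|)) by exact: integrable_RD.
have cn x : 0 < x -> {for x, continuous (fun x => `|g x|)}.
  by move=> /cg h; apply: continuous_comp => //; exact: norm_continuous.
have gn x : 0 <= g x + `|g x| by rewrite -lerBlDl sub0r -normrN ler_norm.
have E (k : R -> R) : mu.-integrable `]0, +oo[ (EFin \o k) ->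
    mu.-integrable `]0, +oo[ (EFin \o (fun x => `|k x|)) ->
    mu.-integrable `]0, +oo[ (EFin \o (fun x => k x + `|k x|)) ->
    \int[mu]_(x in `]0, +oo[) k x =
    \int[mu]_(x in `]0, +oo[) (k x + `|k x|) - \int[mu]_(x in `]0, +oo[) `|k x|.
  by move=> ? ? ?; rewrite -RintegralB//; apply: eq_Rintegral => x _; rewrite addrK.
rewrite E// (E (fun x => g (c * x)))// mulrBr -(H (fun x => g x + `|g x|))//.
  by rewrite -(H (fun x => `|g x|)).
by move=> x x0; apply: continuousD; [exact: cg|exact: cn].
Qed.

End half_line.

(** * Rapidly decaying functions on (0, oo) and their tails *)

Section rapid_decay.
Context {R : realType}.
Notation mu := (@lebesgue_measure R).
Implicit Types (a c p x y : R) (f g h H : R -> R).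

(** Nothing is required near 0: lowering the exponent of the weight in [itail_rec] can produce
    functions that blow up there. *)
Definition rdecay h := (forall x, 0 < x -> {for x, continuous h}) /\
  forall N : nat, exists C, forall x, 1 <= x -> `|h x| <= C * x ^- N.

Definition tail h x := \int[mu]_(t in `]x, +oo[) h t.

Lemma MVT_ex f df x y : x < y -> (forall t, x <= t <= y -> is_derive t 1 f (df t)) ->
  exists2 t, x <= t <= y & f y - f x = df t * (y - x).
Proof.
move=> xy dF; have [||t txy fE] := @MVT _ f df x y xy.
- by move=> t /[!in_itv]/= /andP[/ltW xt /ltW ty]; apply: dF; rewrite xt.
- apply: continuous_in_subspaceT => t; rewrite inE/= in_itv/= => /dF.
  exact: is_derive_continuous.
by exists t => //; move: txy; rewrite in_itv/= => /andP[/ltW -> /ltW ->].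
Qed.

Lemma le_sqr_inv x : 1 <= x -> x ^- 2 <= 4 * (1 + x) ^- 2.
Proof.
move=> x1; have x0 : 0 < x by exact: lt_le_trans x1.
have x10 : 0 < 1 + x by rewrite addr_gt0.
rewrite ler_pdivlMr ?exprn_gt0// mulrC ler_pdivrMr ?exprn_gt0//.
rewrite !expr2; nra.
Qed.

Lemma itv_bounded h a b : (forall x, a <= x <= b -> {for x, continuous h}) ->
  exists2 C, 0 <= C & forall x, a <= x <= b -> `|h x| <= C.
Proof.
move=> ch; have [ab|ba] := leP a b; last first.
  exists 0 => // x /andP[ax xb]; have := le_lt_trans (le_trans ax xb) ba.
  by rewrite ltxx.
have [|c _ hc] := @EVT_max R (fun x => `|h x|) a b ab.
  apply: continuous_in_subspaceT => x; rewrite inE/= in_itv/= => /ch cx.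
  by apply: continuous_comp => //; exact: norm_continuous.
by exists `|h c| => // x xab; apply: hc; rewrite in_itv.
Qed.

(** On [[x, x + 1]] continuity gives a bound; beyond it t is at least 1 and the decay of order 2
    applies. *)
Lemma rdecay_bound h x : rdecay h -> 0 < x ->
  exists C, forall t, x <= t -> `|h t| <= C * (1 + t) ^- 2.
Proof.
move=> [ch dh] x0; have [C1 hC1] := dh 2%N.
have [C2 C20 hC2] := @itv_bounded h x (x + 1) (fun t xt => ch _ (lt_le_trans x0 (proj1 (andP xt)))).
have C10 : 0 <= C1.
  by have := hC1 1 (lexx _); rewrite expr1n invr1 mulr1; apply: le_trans.
exists (4 * C1 + C2 * (2 + x) ^+ 2) => t xt.
have t0 : 0 < t by exact: lt_le_trans xt.
have t10 : 0 < 1 + t by rewrite addr_gt0.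
have i0 : 0 <= (1 + t) ^- 2 by rewrite invr_ge0 sqr_ge0.
rewrite mulrDl; have [tx|xt1] := leP t (x + 1).
  apply: (@le_trans _ _ C2); first by apply: hC2; rewrite xt.
  rewrite -[leLHS]add0r lerD ?mulr_ge0// -mulrA ler_peMr//.
  rewrite ler_pdivlMr ?exprn_gt0// mul1r lerXn2r ?nnegrE//; lra.
have t1 : 1 <= t by lra.
rewrite -[leLHS]addr0 lerD//; last first.
  by apply: mulr_ge0 => //; apply: mulr_ge0 => //; exact: sqr_ge0.
by rewrite (le_trans (hC1 _ t1))// (mulrC 4) -mulrA ler_wpM2l// le_sqr_inv.
Qed.

Lemma integrable_oy_boundS x f C : 0 <= x -> (forall t, x < t -> {for t, continuous f}) ->
  (forall t, x < t -> `|f t| <= C * (1 + t) ^- 2) ->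
  mu.-integrable `]x, +oo[ (EFin \o f).
Proof.
move=> x0 cf fC.
apply: (@integrable_Rle _ _ _ mu _ _ (fun t : measurableTypeR R => C * (1 + t) ^- 2)) => //.
- by apply: continuous_at_measurable_fun => // t /=; rewrite in_itv/= andbT; exact: cf.
- by move=> t /=; rewrite in_itv/= andbT; exact: fC.
- apply: integrable_RZ => //; apply: integrableS integrable_inv_sqr => //.
  by apply: subset_itvr; rewrite bnd_simp.
Qed.

Lemma rdecay_integrable h x : rdecay h -> 0 < x -> mu.-integrable `]x, +oo[ (EFin \o h).
Proof.
move=> dh x0; have [C hC] := rdecay_bound dh x0.
apply: (@integrable_oy_boundS x h C); first exact: ltW.
- by move=> t xt; apply: dh.1; exact: lt_trans xt.
- by move=> t /ltW; exact: hC.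
Qed.

Lemma tail_derive h x : rdecay h -> 0 < x -> is_derive x 1 (tail h) (- h x).
Proof.
move=> dh x0; pose a := x / 2; have a0 : 0 < a by rewrite divr_gt0.
have ax : a < x by rewrite /a; lra.
pose b := x + 1; have xb : x < b by rewrite ltrDl.
have ih := rdecay_integrable dh a0.
have ihb : mu.-integrable `]a, b] (EFin \o h).
  by apply: integrableS ih => //; apply: subset_itvl; rewrite bnd_simp.
pose G t := \int[mu]_(s in `]a, t]) h s.
have tE t : a < t -> tail h t = tail h a - G t.
  move=> at_; rewrite /tail /G -(@Rintegral_itvB _ h (BRight a) +oo%O t)//.
  by rewrite bnd_simp ltW.
have [dG Gx] : derivable G x 1 /\ G^`()%classic x = h x.
  by apply: (@continuous_FTC1 _ h (BRight a) x b) => //; apply: dh.1.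
have := is_derive1_add (is_derive_cst (tail h a) x 1) (is_derive1_opp (DeriveDef dG (esym (derive1E G x)))).
rewrite Gx add0r; apply: near_eq_is_derive => //.
near=> t; have at_ : a < t by near: t; exact: lt_nbhsr.
exact/esym/tE.
Unshelve. all: by end_near. Qed.

Lemma le_Rintegral_subset d (T : measurableType d) (nu : {measure set T -> \bar R})
    (A B : set T) (f : T -> R) : measurable A -> measurable B ->
  nu.-integrable B (EFin \o f) -> A `<=` B -> (forall t, B t -> 0 <= f t) ->
  \int[nu]_(t in A) f t <= \int[nu]_(t in B) f t.
Proof.
move=> mA mB fi AB f0; have fiA := integrableS mB mA AB fi.
rewrite /Rintegral fine_le ?integrable_fin_num//.
apply: ge0_subset_integral => //; first by case/integrableP : fi.
Qed.

(** For t >= x >= 1 one has [t^-(N+2) <= x^-N t^-2]: two orders of decay pay for the integration. *)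
Lemma tail_rdecay h : rdecay h -> rdecay (tail h).
Proof.
move=> dh; split=> [x x0|N]; first exact: is_derive_continuous (tail_derive dh x0).
have [C hC] := dh.2 (N + 2)%N.
have C0 : 0 <= C.
  by have := hC 1 (lexx _); rewrite expr1n invr1 mulr1; apply: le_trans.
exists (4 * C * \int[mu]_(t in `]0, +oo[) (1 + t) ^- 2) => x x1.
have x0 : 0 < x by exact: lt_le_trans x1.
have ih := rdecay_integrable dh x0.
have ii : mu.-integrable `]x, +oo[ (fun t => ((1 + t) ^- 2)%:E).
  apply: integrableS integrable_inv_sqr => //.
  by apply: subset_itvr; rewrite bnd_simp ltW.
apply: le_trans (le_normr_Rintegral _ ih) _ => //.
apply: (@le_trans _ _ (\int[mu]_(t in `]x, +oo[) (4 * C * x ^- N * (1 + t) ^- 2))).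
  apply: le_Rintegral => //.
  - exact: integrable_Rabs.
  - exact: integrable_RZ.
  - move=> t /=; rewrite in_itv/= andbT => xt.
    have t1 : 1 <= t by rewrite (le_trans x1)// ltW.
    have t0 : 0 < t by exact: lt_le_trans t1.
    rewrite (le_trans (hC _ t1))// (_ : 4 * C * _ * _ = C * (x ^- N * (4 * (1 + t) ^- 2))); last by ring.
    rewrite ler_wpM2l// exprD invfM; apply: ler_pM; rewrite ?invr_ge0 ?exprn_ge0 ?(ltW t0)//.
      by rewrite lef_pV2 ?posrE ?exprn_gt0// lerXn2r ?nnegrE ?(ltW x0) ?(ltW t0)// ltW.
    exact: le_sqr_inv.
rewrite RintegralZl// [leRHS]mulrAC ler_wpM2l ?mulr_ge0 ?invr_ge0 ?exprn_ge0 ?(ltW x0)//.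
apply: le_Rintegral_subset => //; first exact: integrable_inv_sqr.
- by apply: subset_itvr; rewrite bnd_simp ltW.
- by move=> t _; rewrite invr_ge0 sqr_ge0.
Qed.

(** The difference has zero derivative and tends to 0 at infinity. This turns integration by parts
    for tails into a comparison of derivatives. *)
Lemma rdecay_uniq f g df : rdecay f -> rdecay g ->
  (forall x, 0 < x -> is_derive x 1 f (df x)) ->
  (forall x, 0 < x -> is_derive x 1 g (df x)) ->
  forall x, 0 < x -> f x = g x.
Proof.
move=> rf rg df1 dg1 x x0; apply/eqP; rewrite -subr_eq0; apply/eqP.
pose F t := f t - g t.
have cF (t : R) : x < t -> F t = F x.
  move=> xt; have [|s _] := @MVT_ex F (fun=> 0) x t xt.
    move=> s /andP[xs _]; have s0 := lt_le_trans x0 xs.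
    have := is_derive1_add (df1 _ s0) (is_derive1_opp (dg1 _ s0)).
    by rewrite subrr.
  by rewrite mul0r => /eqP; rewrite subr_eq0 => /eqP.
have [C1 hC1] := rf.2 1%N; have [C2 hC2] := rg.2 1%N.
apply/eqP; rewrite -normr_eq0 -[X in `|X|]/(F x); apply/eqP/le_anti.
rewrite normr_ge0 andbT; apply/ler_addgt0Pl => e e0; rewrite addr0.
pose t := Num.max (x + 1) (Num.max 1 ((C1 + C2) / e)).
have xt : x < t by rewrite lt_max ltrDl ltr01.
have t1 : 1 <= t by rewrite !le_max lexx !orbT.
rewrite -(cF _ xt) /F (le_trans (ler_normB _ _))//.
rewrite (le_trans (lerD (hC1 _ t1) (hC2 _ t1)))// -mulrDl expr1 ler_pdivrMr ?(lt_le_trans _ t1)//.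
by rewrite mulrC -ler_pdivrMr// !le_max lexx !orbT.
Qed.

(** With [K = C / -(a+1)], the function [K t^(a+1) - H t] is nonincreasing, and by the decay of H it
    exceeds any [-e] far away, hence it is nonnegative. The decay constants of H do not enter the
    bound; this keeps it uniform in the angle later on. *)
Lemma rdecay_primitive_bound H h a C : rdecay H ->
  (forall x, 0 < x -> is_derive x 1 H (- h x)) -> a + 1 < 0 ->
  (forall x, 1 <= x -> `|h x| <= C * x `^ a) ->
  forall x, 1 <= x -> `|H x| <= C / - (a + 1) * x `^ (a + 1).
Proof.
have side H' h' : rdecay H' -> (forall x, 0 < x -> is_derive x 1 H' (- h' x)) -> a + 1 < 0 ->
    (forall x, 1 <= x -> `|h' x| <= C * x `^ a) ->
    forall x, 1 <= x -> H' x <= C / - (a + 1) * x `^ (a + 1).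
  move=> rH dH a1 hC x x1.
  have C0 : 0 <= C.
    by have := hC 1 (lexx _); rewrite powR1 mulr1; apply: le_trans.
  set K := C / _; have K0 : 0 <= K by rewrite divr_ge0// oppr_ge0 ltW.
  pose D t := K * t `^ (a + 1) - H' t.
  have dD (t : R) : 0 < t -> is_derive t 1 D (- (C * t `^ a) + h' t).
    move=> t0; rewrite -[h' t]opprK.
    rewrite (_ : - (C * t `^ a) = K * ((a + 1) * t `^ (a + 1 - 1))); last first.
      by rewrite addrK /K invrN mulrN !mulNr mulrA divfK// lt_eqF.
    apply: is_derive1_add; last by apply: is_derive1_opp; exact: dH.
    by apply: is_derive1_scale; exact: is_derive1_powR.
  have Dn (t : R) : x < t -> D t <= D x.
    move=> xt; have [s /andP[xs _]|s /andP[xs _]] := @MVT_ex D (fun t => - (C * t `^ a) + h' t) x t xt.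
      by apply: dD; rewrite (lt_le_trans _ xs)// (lt_le_trans _ x1).
    move=> /eqP; rewrite subr_eq => /eqP ->; rewrite gerDr.
    rewrite mulr_le0_ge0 ?subr_ge0 ?(ltW xt)// addrC subr_le0.
    by rewrite (le_trans (ler_norm _))// hC// (le_trans x1).
  rewrite -subr_ge0 -/(D x).
  have [C2 hC2] := rH.2 1%N.
  apply/ler_addgt0Pl => e e0; rewrite -lerBlDl sub0r.
  pose t := Num.max (x + 1) (C2 / e).
  have xt : x < t by rewrite lt_max ltrDl ltr01.
  have t1 : 1 <= t by rewrite (le_trans x1)// ltW.
  have t0 : 0 < t by exact: lt_le_trans t1.
  apply: le_trans (Dn _ xt); rewrite /D lerBrDl.
  apply: (@le_trans _ _ 0); last by rewrite mulr_ge0 ?powR_ge0.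
  rewrite subr_le0 (le_trans (ler_norm _))// (le_trans (hC2 _ t1))//.
  rewrite expr1 ler_pdivrMr// mulrC -ler_pdivrMr//.
  by rewrite le_max lexx orbT.
move=> rH dH a1 hC x x1; rewrite ler_norml; apply/andP; split; last exact: side hC _ x1.
rewrite lerNl; apply: (side (fun t => - H t) (fun t => - h t)) => //.
- split=> [t /rH.1|N]; first exact: continuousN.
  by have [C' hC'] := rH.2 N; exists C' => t; rewrite normrN; exact: hC'.
- by move=> t /dH; exact: is_derive1_opp.
- by move=> t; rewrite normrN; exact: hC.
Qed.

End rapid_decay.

(** * Iterated tails of the oscillating kernel *)

Section oscillating_kernel.
Context {R : realType}.
Variable p : R.
Hypothesis p0 : 0 < p.
Implicit Types (a c r th b x y : R) (f g h H : R -> R).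

(** The real part of [e^(ib) exp(- e^(-i th) x^p)]. At [th = +-pi/2] it is [cos (b +- x^p)]; a
    derivative in x brings out [- p x^(p-1) e^(-i th)], whose last factor is the shift of b by
    [- th]. *)
Definition osc th b x := expR (- (cos th * x `^ p)) * cos (b + sin th * x `^ p).

Definition wosc r th b x := x `^ r * osc th b x.

Lemma osc_derive th b x : 0 < x ->
  is_derive x 1 (osc th b) (- (p * x `^ (p - 1)) * osc th (b - th) x).
Proof.
move=> x0; have dp := is_derive1_powR p x0.
have d1 := is_derive1_expR (is_derive1_opp (is_derive1_scale (cos th) dp)).
have d2 := is_derive1_cos (is_derive1_add (is_derive_cst b x 1) (is_derive1_scale (sin th) dp)).
have := is_derive1_mul d1 d2.
rewrite /osc addrAC cosB /cst /=.
by congr is_derive; ring.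
Qed.

Lemma wosc_derive r th b x : 0 < x ->
  is_derive x 1 (wosc r th b) (r * wosc (r - 1) th b x - p * wosc (r + p - 1) th (b - th) x).
Proof.
move=> x0; have := is_derive1_mul (is_derive1_powR r x0) (osc_derive th b x0).
rewrite /wosc -[r + p - 1]addrA.
rewrite (@powRD _ x r (p - 1)); last by rewrite (gt_eqF x0) implybT.
by congr is_derive; ring.
Qed.

Lemma osc_le1 th b x : 0 <= cos th -> `|osc th b x| <= 1.
Proof.
move=> c0; rewrite normrM -[leRHS]mulr1 ler_pM ?cos_max//.
by rewrite ger0_norm ?expR_ge0// expR_le1 oppr_le0 mulr_ge0 ?powR_ge0.
Qed.

Lemma wosc_le r th b x : 0 <= cos th -> `|wosc r th b x| <= x `^ r.
Proof.
move=> c0; rewrite normrM ger0_norm ?powR_ge0// ler_piMr ?powR_ge0//.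
exact: osc_le1.
Qed.

Lemma expRN_powR_bound c s : 0 < c -> exists C, forall x, 1 <= x ->
  expR (- (c * x `^ p)) <= C * x `^ (- s).
Proof.
(* [(M + 1) p >= |s|]: the term of this order in the exponential series beats the power. *)
move=> c0; pose M := Num.truncn (`|s| / p).
exists ((M.+1)`!%:R / c ^+ M.+1) => x x1.
have x0 : 0 < x by exact: lt_le_trans x1.
have y0 : 0 <= c * x `^ p by rewrite mulr_ge0 ?powR_ge0// ltW.
have yp : 0 < (c * x `^ p) ^+ M.+1 by rewrite exprn_gt0// mulr_gt0 ?powR_gt0.
rewrite expRN (@le_trans _ _ ((M.+1)`!%:R / (c * x `^ p) ^+ M.+1))//.
  rewrite -[leRHS]invrK lef_pV2 ?posrE ?expR_gt0 ?invr_gt0 ?divr_gt0 ?ltr0n ?fact_gt0//.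
  rewrite invf_div (le_trans _ (expR_ge1Dxn M y0))// lerDr.
  exact: ler01.
rewrite exprMn invfM mulrA ler_wpM2l ?divr_ge0 ?exprn_ge0 ?(ltW c0)//.
rewrite -powR_mulrn ?powR_ge0// -powRrM -powRN ler_powR// lerN2.
rewrite (le_trans (ler_norm s))// -ler_pdivrMl// mulrC ltW//.
exact: truncnS_gt.
Qed.

Lemma wosc_rdecay r th b : 0 < cos th -> rdecay (wosc r th b).
Proof.
move=> c0; split=> [x x0|N]; first exact: is_derive_continuous (wosc_derive r th b x0).
have [C hC] := expRN_powR_bound (r + N%:R) c0.
exists C => x x1; have x0 : 0 < x by exact: lt_le_trans x1.
have C0 : 0 <= C.
  by have := hC 1 (lexx _); rewrite !powR1 !mulr1; exact: le_trans (expR_ge0 _).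
rewrite /wosc /osc 2!normrM (ger0_norm (powR_ge0 _ _)) (ger0_norm (expR_ge0 _)).
rewrite mulrA (@le_trans _ _ (x `^ r * (C * x `^ (- (r + N%:R))) * 1))//.
  rewrite ler_pM ?mulr_ge0 ?powR_ge0 ?expR_ge0 ?cos_max// ler_wpM2l ?powR_ge0//.
  exact: hC.
rewrite mulr1 mulrCA -powRD; last by rewrite (gt_eqF x0) implybT.
by rewrite opprD addrA subrr add0r powRN powR_mulrn// ltW.
Qed.

Definition itail m r th b := iter m tail (wosc r th b).

Lemma itail_rdecay m r th b : 0 < cos th -> rdecay (itail m r th b).
Proof.
by move=> c0; elim: m => [|m ih]; [exact: wosc_rdecay|exact: tail_rdecay].
Qed.

Lemma itail_derive m r th b x : 0 < cos th -> 0 < x ->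
  is_derive x 1 (itail m.+1 r th b) (- itail m r th b x).
Proof. by move=> c0 x0; apply: tail_derive => //; exact: itail_rdecay. Qed.

Lemma rdecay_add f g : rdecay f -> rdecay g -> rdecay (fun x => f x + g x).
Proof.
move=> [cf df] [cg dg]; split=> [x x0|N]; first by apply: continuousD; [exact: cf|exact: cg].
have [C hC] := df N; have [C' hC'] := dg N; exists (C + C') => x x1.
by rewrite mulrDl (le_trans (ler_normD _ _))// lerD ?hC ?hC'.
Qed.

Lemma rdecay_scale c f : rdecay f -> rdecay (fun x => c * f x).
Proof.
move=> [cf df]; split=> [x x0|N].
  by apply: (@continuousM _ _ (cst c) f); [exact: cvg_cst|exact: cf].
have [C hC] := df N; exists (`|c| * C) => x x1.
by rewrite normrM -mulrA ler_wpM2l// hC.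
Qed.

(* Integration by parts against [osc]: each step trades [r] for [r - p] or one
   of the [m] tails for the exponent [r + 1 - p]. *)
Lemma itail_rec m r th b x : 0 < cos th -> 0 < x ->
  itail m.+1 r th b x =
  p^-1 * (itail m (r + 1 - p) th (b + th) x +
          (r + 1 - p) * itail m.+1 (r - p) th (b + th) x).
Proof.
move=> c0; elim: m x => [|m ih] x x0.
  (* In the derivative of the right-hand side the two terms of weight [r - p] cancel, and the phase
     [b + th] is brought back to b. *)
  apply: (@rdecay_uniq _ (itail 1 r th b) (fun y => p^-1 * (wosc (r + 1 - p) th (b + th) y +
      (r + 1 - p) * itail 1 (r - p) th (b + th) y)) (fun y => - wosc r th b y)) x0.
  - exact: (itail_rdecay 1).
  - apply: rdecay_scale; apply: rdecay_add; first exact: wosc_rdecay.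
    by apply: rdecay_scale; exact: (itail_rdecay 1).
  - by move=> t t0; exact: (itail_derive 0).
  - move=> t t0; have := is_derive1_scale p^-1 (is_derive1_add
      (wosc_derive (r + 1 - p) th (b + th) t0)
      (is_derive1_scale (r + 1 - p) (itail_derive 0 (r - p) (b + th) c0 t0))).
    congr is_derive; rewrite addrK (_ : r + 1 - p - 1 = r - p); last by ring.
    rewrite (_ : r + 1 - p + p - 1 = r); last by ring.
    by rewrite /itail /=; field; rewrite gt_eqF.
apply: (@rdecay_uniq _ (itail m.+2 r th b) (fun y => p^-1 * (itail m.+1 (r + 1 - p) th (b + th) y +
    (r + 1 - p) * itail m.+2 (r - p) th (b + th) y)) (fun y => - itail m.+1 r th b y)) x0.
- exact: itail_rdecay.
- apply: rdecay_scale; apply: rdecay_add; first exact: itail_rdecay.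
  by apply: rdecay_scale; exact: itail_rdecay.
- by move=> t t0; exact: itail_derive.
- move=> t t0; have := is_derive1_scale p^-1 (is_derive1_add
      (itail_derive m (r + 1 - p) (b + th) c0 t0)
      (is_derive1_scale (r + 1 - p) (itail_derive m.+1 (r - p) (b + th) c0 t0))).
  by congr is_derive; rewrite ih//; ring.
Qed.

(** When [r + m < 0], the bound [|wosc| <= x^r] can be integrated m times at infinity whatever th
    is, without any use of the oscillation. *)
Lemma itail_bound_neg m r : r + m%:R < 0 -> exists2 C, 0 <= C &
  forall th b x, 0 < cos th -> 1 <= x -> `|itail m r th b x| <= C * x `^ (r + m%:R).
Proof.
elim: m => [|m ih] rm.
  exists 1 => // th b x c0 x1; rewrite addr0 mul1r; exact/wosc_le/ltW.
have rm' : r + m%:R < 0 by rewrite (lt_trans _ rm)// ltrD2l ltr_nat.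
have [C C0 hC] := ih rm'.
have rm1 : r + m%:R + 1 < 0 by rewrite -addrA natr1.
exists (C / - (r + m%:R + 1)); first by rewrite divr_ge0// oppr_ge0 ltW.
move=> th b x c0 x1; rewrite -natr1 addrA.
apply: (@rdecay_primitive_bound _ (itail m.+1 r th b) (itail m r th b)) => //.
- exact: itail_rdecay.
- by move=> t t0; exact: itail_derive.
- by move=> t t1; exact: hC.
Qed.

(** The oscillation improves the naive exponent [r + m] to [r + m (1 - p)], uniformly in th and b.
    In [itail_rec] the first term has one tail fewer and the right exponent by induction; the second
    has its weight lowered by p. After enough steps the weight is small enough for
    [itail_bound_neg]. *)
Lemma itail_bound m r : exists2 C, 0 <= C &
  forall th b x, 0 < cos th -> 1 <= x ->
    `|itail m r th b x| <= C * x `^ (r + m%:R * (1 - p)).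
Proof.
elim: m r => [|m ih] r.
  exists 1 => // th b x c0 x1; rewrite mul0r addr0 mul1r; exact/wosc_le/ltW.
(* The target exponent e is kept fixed, so that the induction on n can lower r and still prove the
   same bound. *)
suff: forall n r e, r + m.+1%:R * (1 - p) <= e -> r - n%:R * p + m.+1%:R < 0 ->
    r - n%:R * p + m.+1%:R <= e -> exists2 C, 0 <= C &
    forall th b x, 0 < cos th -> 1 <= x -> `|itail m.+1 r th b x| <= C * x `^ e.
  (* The truncation makes [r - n p + m + 1] negative; the summand [m.+1] makes it at most
     [r + (m+1)(1 - p)]. *)
  pose n := (m.+1 + Num.truncn ((`|r| + m.+1%:R) / p))%N.
  have n1 : (`|r| + m.+1%:R) / p < n%:R.
    by rewrite (lt_le_trans (truncnS_gt _))// ler_nat /n addSn ltnS leq_addl.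
  have n2 : r - n%:R * p + m.+1%:R < 0.
    rewrite addrAC subr_lt0 -ltr_pdivrMr// (le_lt_trans _ n1)//.
    by rewrite ler_pM2r ?invr_gt0// lerD2r ler_norm.
  move/(_ n r (r + m.+1%:R * (1 - p)) (lexx _) n2); apply.
  rewrite -addrA lerD2l mulrBr mulr1 addrC lerD2l lerN2 ler_wpM2r ?(ltW p0)//.
  by rewrite ler_nat leq_addr.
elim=> [|n ihn] {}r e re1 re2 re3.
  rewrite mul0r subr0 in re2 re3; have [C C0 hC] := itail_bound_neg re2.
  exists C => // th b x c0 x1; rewrite (le_trans (hC _ _ _ c0 x1))//.
  by rewrite ler_wpM2l// ler_powR.
have [C1 C10 hC1] := ih (r + 1 - p).
have nE : r - p - n%:R * p + m.+1%:R = r - n.+1%:R * p + m.+1%:R.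
  by rewrite -(natr1 n); ring.
have [||| C2 C20 hC2] := ihn (r - p) e.
- by rewrite (le_trans _ re1)// lerD2r gerBl ltW.
- by rewrite nE.
- by rewrite nE.
exists (p^-1 * (C1 + `|r + 1 - p| * C2)).
  by rewrite mulr_ge0 ?invr_ge0 ?addr_ge0 ?mulr_ge0// ltW.
move=> th b x c0 x1; have x0 : 0 < x by exact: lt_le_trans x1.
rewrite itail_rec// normrM ger0_norm ?invr_ge0 ?(ltW p0)// -mulrA.
rewrite ler_wpM2l ?invr_ge0 ?(ltW p0)// (le_trans (ler_normD _ _))// [leRHS]mulrDl lerD//.
  rewrite (le_trans (hC1 _ _ _ c0 x1))// ler_wpM2l// ler_powR//.
  rewrite (le_trans _ re1)// -(natr1 m) le_eqVlt; apply/orP; left; apply/eqP; ring.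
by rewrite normrM -mulrA ler_wpM2l// hC2.
Qed.

(** The value at 1 is controlled by [itail_bound], and the mean value theorem on [[x, 1]] adds at
    most the bound of the preceding tail. *)
Lemma itail_bound01 m r : 0 <= r -> exists2 C, 0 <= C &
  forall th b x, 0 < cos th -> 0 < x <= 1 -> `|itail m r th b x| <= C.
Proof.
move=> r0; elim: m => [|m [C C0 hC]].
  exists 1 => // th b x c0 /andP[x0 x1]; rewrite (le_trans (wosc_le _ _ _ (ltW c0)))//.
  by apply: (@le_trans _ _ (1 `^ r)); [rewrite ge0_ler_powR ?nnegrE ?(ltW x0)|rewrite powR1].
have [C1 C10 hC1] := itail_bound m.+1 r.
exists (C + C1); first exact: addr_ge0.
move=> th b x c0 /andP[x0 x1].
have h1 := hC1 th b 1 c0 (lexx _); rewrite powR1 mulr1 in h1.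
move: x1; rewrite le_eqVlt => /predU1P[->|x1]; first by rewrite (le_trans h1)// lerDr.
have [|t /andP[xt t1] tE] := @MVT_ex _ (itail m.+1 r th b) (fun t => - itail m r th b t) x 1 x1.
  by move=> t /andP[xt _]; apply: itail_derive => //; exact: lt_le_trans xt.
rewrite -[itail _ _ _ _ x](subKr (itail m.+1 r th b 1)) tE (le_trans (ler_normB _ _))//.
rewrite [leRHS]addrC lerD// normrM normrN -[leRHS]mulr1 ler_pM// ?hC//.
  by rewrite t1 andbT (lt_le_trans x0).
by rewrite ger0_norm ?subr_ge0 ?(ltW x1)// gerBl ltW.
Qed.

(** Cut off at 0 so that, for r >= 0, the power of [1 + x] with exponent [r + m * growth] dominates
    on all of (0, oo), near 0 included. One has [1 - growth = min p 1], the net gain of one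
    integration by parts. *)
Definition growth := Num.max (1 - p) 0.

Lemma itail_growth m r : 0 <= r -> exists2 C, 0 <= C &
  forall th b x, 0 < cos th -> 0 < x ->
    `|itail m r th b x| <= C * (1 + x) `^ (r + m%:R * growth).
Proof.
move=> r0; have [C1 C10 hC1] := itail_bound m r.
have [C2 C20 hC2] := itail_bound01 m r0.
have g0 : 0 <= growth by rewrite le_max lexx orbT.
have s0 : 0 <= r + m%:R * growth by rewrite addr_ge0// mulr_ge0.
exists (C1 + C2); first exact: addr_ge0.
move=> th b x c0 x0; have x1' : 1 <= 1 + x by rewrite lerDl ltW.
rewrite mulrDl; have [x1|x1] := leP x 1.
  rewrite (le_trans (hC2 _ _ _ c0 _)) ?x0//.
  rewrite -[leLHS]add0r lerD ?mulr_ge0 ?powR_ge0// ler_peMr//.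
  by rewrite -[leLHS](powRr0 (1 + x)) ler_powR.
rewrite (le_trans (hC1 _ _ _ c0 (ltW x1)))//.
rewrite -[leLHS]addr0 lerD ?mulr_ge0 ?powR_ge0// ler_wpM2l//.
apply: (@le_trans _ _ (x `^ (r + m%:R * growth))).
  by rewrite ler_powR ?(ltW x1)// lerD2l ler_wpM2l// le_max lexx.
by rewrite ge0_ler_powR ?nnegrE ?(ltW x0) ?(le_trans ler01 x1') ?lerDr.
Qed.

End oscillating_kernel.

(** * Integrals over (0, oo) of rapidly decaying functions *)

Section half_line_decay.
Context {R : realType}.
Notation mu := (@lebesgue_measure R).
Implicit Types (a c r x y B : R) (f g h H F : R -> R).

Lemma rdecay_bound0 h B : rdecay h -> (forall x, 0 < x <= 1 -> `|h x| <= B) ->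
  exists C, forall x, 0 < x -> `|h x| <= C * (1 + x) ^- 2.
Proof.
move=> dh hB; have [C hC] := rdecay_bound dh ltr01.
have B0 : 0 <= B by apply: le_trans (hB 1 _); rewrite ?ltr01 ?lexx.
have C0 : 0 <= C.
  have := le_trans (normr_ge0 _) (hC 1 (lexx _)).
  by rewrite pmulr_lge0// invr_gt0 exprn_gt0// addr_gt0.
exists (C + 4 * B) => x x0; rewrite mulrDl.
have i0 : 0 < (1 + x) ^- 2 by rewrite invr_gt0 exprn_gt0// addr_gt0.
have [x1|/ltW x1] := leP x 1; last first.
  by rewrite (le_trans (hC _ x1))// lerDl mulr_ge0 ?(ltW i0)// mulr_ge0.
rewrite (@le_trans _ _ B) ?hB ?x0//.
rewrite -[leLHS]add0r lerD ?mulr_ge0 ?(ltW i0)// (mulrC 4) -mulrA ler_peMr//.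
rewrite ler_pdivlMr ?exprn_gt0 ?addr_gt0// mul1r; nra.
Qed.

Lemma rdecay_integrable0 h B : rdecay h -> (forall x, 0 < x <= 1 -> `|h x| <= B) ->
  mu.-integrable `]0, +oo[ (EFin \o h).
Proof.
move=> dh hB; have [C hC] := rdecay_bound0 dh hB.
by apply: integrable_oy_bound hC; exact: dh.1.
Qed.

Lemma rdecay_mul f h B : (forall x, 0 < x -> {for x, continuous f}) ->
  (forall x, 1 <= x -> `|f x| <= B) -> rdecay h -> rdecay (fun x => f x * h x).
Proof.
move=> cf fB [ch dh]; split=> [x x0|N]; first by apply: continuousM; [exact: cf|exact: ch].
have [C hC] := dh N; exists (B * C) => x x1.
by rewrite normrM -mulrA ler_pM ?fB ?hC.
Qed.

Lemma rdecay_mulX j h : rdecay h -> rdecay (fun x => x ^+ j * h x).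
Proof.
move=> [ch dh]; split=> [x x0|N].
  by apply: continuousM; [exact: exprn_continuous|exact: ch].
have [C hC] := dh (j + N)%N; exists C => x x1.
have x0 : 0 < x by exact: lt_le_trans x1.
rewrite normrM ger0_norm ?exprn_ge0 ?(ltW x0)//.
rewrite (le_trans (ler_wpM2l _ (hC _ x1))) ?exprn_ge0 ?(ltW x0)//.
by rewrite exprD invfM mulrCA mulVKf// expf_neq0// gt_eqF.
Qed.

Lemma rdecay_cvg0 h : rdecay h -> h (0 + n.+2%:R) @[n --> \oo] --> 0.
Proof.
move=> [_ /(_ 1%N)[C hC]]; apply: norm_cvg0.
apply: (@squeeze_cvgr _ _ _ _ (cst 0) (fun n => C * n.+1%:R^-1)).
- near=> n; rewrite /= normr_ge0/= add0r (le_trans (hC _ _)) ?ler1n//.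
  have C0 : 0 <= C by have := le_trans (normr_ge0 _) (hC 1 (lexx _)); rewrite expr1 invr1 mulr1.
  by rewrite ler_wpM2l// expr1 lef_pV2 ?posrE// ler_nat.
- exact: cvg_cst.
- by rewrite -[X in _ --> X](mulr0 C); apply: cvgM; [exact: cvg_cst|exact: cvg_harmonic].
Unshelve. all: by end_near. Qed.

Lemma Rintegral_FTC_rdecay F f l0 :
  (forall x, 0 < x -> is_derive x 1 F (f x)) ->
  (forall x, 0 < x -> {for x, continuous f}) ->
  mu.-integrable `]0, +oo[ (EFin \o f) -> rdecay F ->
  F n.+1%:R^-1 @[n --> \oo] --> l0 ->
  \int[mu]_(x in `]0, +oo[) f x = - l0.
Proof.
move=> dF cf fi rF Fl; rewrite -[RHS]add0r.
apply: (Rintegral_FTC_oy dF cf fi); last exact: rdecay_cvg0.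
by under eq_fun do rewrite add0r.
Qed.

Lemma cvg0_at0 F B : (forall x, 0 < x <= 1 -> `|F x| <= B * x) ->
  F n.+1%:R^-1 @[n --> \oo] --> 0.
Proof.
move=> FB; apply: norm_cvg0.
apply: (@squeeze_cvgr _ _ _ _ (cst 0) (fun n => B * n.+1%:R^-1)).
- by near=> n; rewrite /= normr_ge0/= FB// invr_gt0 ltr0n/= invf_le1 ?ler1n.
- exact: cvg_cst.
- by rewrite -[X in _ --> X](mulr0 B); apply: cvgM; [exact: cvg_cst|exact: cvg_harmonic].
Unshelve. all: by end_near. Qed.

Lemma tail_cvg0 h B : rdecay h -> (forall x, 0 < x <= 1 -> `|h x| <= B) ->
  tail h n.+1%:R^-1 @[n --> \oo] --> \int[mu]_(x in `]0, +oo[) h x.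
Proof.
move=> dh hB; apply: Rintegral_cvg_sets => //.
- by move=> n; apply: subset_itvr; rewrite bnd_simp invr_ge0.
- move=> x /=; rewrite in_itv/= andbT => x0; near=> n; rewrite in_itv/= andbT.
  rewrite -[ltRHS]invrK ltf_pV2 ?posrE ?invr_gt0//.
  rewrite (@lt_le_trans _ _ (Num.truncn x^-1).+1%:R) ?truncnS_gt// ler_nat ltnS.
  by near: n; exact: nbhs_infty_ge.
- exact: rdecay_integrable0 hB.
Unshelve. all: by end_near. Qed.

End half_line_decay.

(** * Moments of the damped kernel as values of Gamma *)

Section kernel_moments.
Context {R : realType}.
Notation mu := (@lebesgue_measure R).
Variable p : R.
Hypothesis p0 : 0 < p.
Implicit Types (a c r s th b x y : R) (f g h H : R -> R).
Local Notation wosc := (wosc p).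
Local Notation itail := (itail p).

Lemma powR_le1 r x : 0 <= r -> 0 < x <= 1 -> x `^ r <= 1.
Proof.
move=> r0 /andP[x0 x1]; apply: (@le_trans _ _ (1 `^ r)); last by rewrite powR1.
by rewrite ge0_ler_powR ?nnegrE ?(ltW x0).
Qed.

Lemma wosc_integrable r th b : 0 <= r -> 0 < cos th ->
  mu.-integrable `]0, +oo[ (EFin \o wosc r th b).
Proof.
move=> r0 c0; apply: (@rdecay_integrable0 _ _ 1); first exact: wosc_rdecay.
by move=> x x01; rewrite (le_trans (wosc_le _ _ _ _ (ltW c0)))// powR_le1.
Qed.

Lemma powR_expR_integrable r c : 0 <= r -> 0 < c ->
  mu.-integrable `]0, +oo[ (fun x => (x `^ r * expR (- (c * x `^ p)))%:E).
Proof.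
move=> r0 c0; have e1 x : expR (- (c * x `^ p)) <= 1.
  by rewrite expR_le1 oppr_le0 mulr_ge0 ?powR_ge0 ?(ltW c0).
apply: (@rdecay_integrable0 _ (fun x => x `^ r * expR (- (c * x `^ p))) 1); last first.
  move=> x x01; rewrite ger0_norm ?mulr_ge0 ?powR_ge0 ?expR_ge0//.
  by rewrite -[leRHS]mulr1 ler_pM ?powR_ge0 ?expR_ge0 ?powR_le1.
split=> [x x0|N].
  apply: (@is_derive_continuous _ _ _ (r * x `^ (r - 1) * expR (- (c * x `^ p)) +
     x `^ r * (expR (- (c * x `^ p)) * - (c * (p * x `^ (p - 1)))))).
  apply: is_derive1_mul; first exact: is_derive1_powR.
  by apply: is_derive1_expR; apply: is_derive1_opp; apply: is_derive1_scale; exact: is_derive1_powR.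
have [C hC] := expRN_powR_bound p0 (r + N%:R) c0.
exists C => x x1; have x0 : 0 < x by exact: lt_le_trans x1.
rewrite ger0_norm ?mulr_ge0 ?powR_ge0 ?expR_ge0//.
rewrite (le_trans (ler_wpM2l _ (hC _ x1))) ?powR_ge0//.
rewrite mulrCA -powRD; last by rewrite (gt_eqF x0) implybT.
by rewrite opprD addrA subrr add0r powRN powR_mulrn// ltW.
Qed.

(** The substitution [t = x^p] in the Gamma integral, where [p (s - 1) + (p - 1) = r]. *)
Lemma integral_powR_expR r : 0 <= r ->
  \int[mu]_(x in `]0, +oo[) (x `^ r * expR (- x `^ p)) = p^-1 * Gamma ((r + 1) / p).
Proof.
move=> r0; set s := (r + 1) / p; have ps : p * s = r + 1 by rewrite mulrC divfK// gt_eqF.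
have -> : Gamma s = p * \int[mu]_(x in `]0, +oo[) (x `^ r * expR (- x `^ p)).
  rewrite -RintegralZl//; last first.
    have := powR_expR_integrable r0 ltr01.
    by congr (integrable _ _ _); apply/funext => x /=; rewrite mul1r.
  rewrite /Gamma /Rintegral (@ge0_integral_powR_subst _ 1 p)//; last 2 first.
  - by move=> x x0; rewrite mulr_ge0 ?powR_ge0 ?expR_ge0.
  - move=> x x0; apply: (@is_derive_continuous _ _ _ ((s - 1) * x `^ (s - 1 - 1) * expR (- x) +
      x `^ (s - 1) * (expR (- x) * -1))).
    exact: is_derive1_mul (is_derive1_powR _ x0)
      (is_derive1_expR (is_derive1_opp (is_derive_id x 1))).
  congr fine; apply: eq_integral => x; rewrite inE/= in_itv/= andbT => x0; congr EFin.
  have xE : (x `^ p) `^ (s - 1) * x `^ (p - 1) = x `^ r.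
    rewrite -powRrM -powRD; last by rewrite (gt_eqF x0) implybT.
    by congr (_ `^ _); rewrite mulrBr ps; ring.
  by rewrite !mul1r -xE; ring.
by rewrite mulKf// gt_eqF.
Qed.


(** With [s = (r + 1) / p], the moving phase [b - s t] is the integrating factor of the differential
    equation in the angle t. The derivative is the real part of [-i (s x^r - e^(-it) x^(r+p))] times
    the exponential, where -i is the shift by [- pi / 2]; by [wosc_integral0] its integral is 0. *)
Lemma wosc_phase_derive r b th x : 0 < x ->
  is_derive th 1 (fun t => wosc r t (b - (r + 1) / p * t) x)
    ((r + 1) / p * wosc r th (b - (r + 1) / p * th - pi / 2) x -
     wosc (r + p) th (b - (r + 1) / p * th - pi / 2 - th) x).
Proof.
move=> x0; set s := (r + 1) / p; set u := x `^ p.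
have did : is_derive th 1 (fun t : R => t) 1 by exact: is_derive_id.
have dcos : is_derive th 1 (fun t => - (cos t * u)) (- (- sin th * 1 * u + cos th * 0)).
  exact: is_derive1_opp (is_derive1_mul (is_derive1_cos did) (is_derive_cst u th 1)).
have dpsi : is_derive th 1 (fun t => b - s * t + sin t * u)
    ((0 - s * 1) + (cos th * 1 * u + sin th * 0)).
  exact: is_derive1_add (is_derive1_add (is_derive_cst b th 1) (is_derive1_opp (is_derive1_scale s did)))
    (is_derive1_mul (is_derive1_sin did) (is_derive_cst u th 1)).
have := is_derive1_scale (x `^ r) (is_derive1_mul (is_derive1_expR dcos) (is_derive1_cos dpsi)).
rewrite /wosc /osc -/u powRD; last by rewrite (gt_eqF x0) implybT.
rewrite -/u.
have -> : b - s * th - pi / 2 - th + sin th * u = b - s * th + sin th * u - th - pi / 2 by ring.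
have -> : b - s * th - pi / 2 + sin th * u = b - s * th + sin th * u - pi / 2 by ring.
by rewrite !cosBpihalf sinB; congr is_derive; ring.
Qed.

(** A majorant for differentiation under the integral sign, uniform over the angles with
    [cos th >= c]. *)
Lemma wosc_phase_derive_le r b th c x : 0 <= r -> 0 <= c -> c <= cos th -> 0 < x ->
  `|(r + 1) / p * wosc r th (b - (r + 1) / p * th - pi / 2) x -
     wosc (r + p) th (b - (r + 1) / p * th - pi / 2 - th) x| <=
  (r + 1) / p * (x `^ r * expR (- (c * x `^ p))) + x `^ (r + p) * expR (- (c * x `^ p)).
Proof.
move=> r0 c0 cth x0; have s0 : 0 <= (r + 1) / p by rewrite divr_ge0 ?addr_ge0 ?(ltW p0).
have H q be : `|wosc q th be x| <= x `^ q * expR (- (c * x `^ p)).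
  rewrite 2!normrM (ger0_norm (powR_ge0 _ _)) ler_wpM2l ?powR_ge0//.
  rewrite -[leRHS]mulr1 ler_pM ?cos_max// ger0_norm ?expR_ge0// ler_expR lerN2.
  by rewrite ler_wpM2r ?powR_ge0.
by rewrite (le_trans (ler_normB _ _))// lerD// normrM ger0_norm// ler_wpM2l.
Qed.

(** The integrand is the x-derivative of [p^-1 * wosc (r + 1) th b], which vanishes at 0 and at
    infinity. *)
Lemma wosc_integral0 r th b : 0 <= r -> 0 < cos th ->
  \int[mu]_(x in `]0, +oo[) ((r + 1) / p * wosc r th b x - wosc (r + p) th (b - th) x) = 0.
Proof.
move=> r0 c0.
have rp : 0 <= r + p by rewrite addr_ge0 ?(ltW p0).
have i1 := wosc_integrable b r0 c0; have i2 := wosc_integrable (b - th) rp c0.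
pose f x := p^-1 * ((r + 1) * wosc (r + 1 - 1) th b x + (- p) * wosc (r + 1 + p - 1) th (b - th) x).
have fE : (fun x => (r + 1) / p * wosc r th b x - wosc (r + p) th (b - th) x) = f.
  apply/funext => x; rewrite /f addrK (_ : r + 1 + p - 1 = r + p); last by ring.
  by field; rewrite gt_eqF.
have rf : rdecay f.
  by apply: rdecay_scale; apply: rdecay_add; apply: rdecay_scale; exact: wosc_rdecay.
have fi : mu.-integrable `]0, +oo[ (EFin \o f).
  rewrite -fE; apply: integrable_RD => //; first exact: integrable_RZ.
  have -> : (fun x => - wosc (r + p) th (b - th) x) = (fun x => (- 1) * wosc (r + p) th (b - th) x).
    by apply/funext => x; rewrite mulN1r.
  exact: integrable_RZ.
rewrite fE -[RHS]oppr0; apply: (@Rintegral_FTC_rdecay _ (fun x => p^-1 * wosc (r + 1) th b x)).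
- by move=> x x0; rewrite /f mulNr; exact: is_derive1_scale (wosc_derive _ _ _ _ x0).
- exact: rf.1.
- exact: fi.
- by apply: rdecay_scale; exact: wosc_rdecay.
- apply: (@cvg0_at0 _ (fun x => p^-1 * wosc (r + 1) th b x) p^-1) => x x01; have /andP[x0 x1] := x01.
  rewrite normrM ger0_norm ?invr_ge0 ?(ltW p0)// ler_wpM2l ?invr_ge0 ?(ltW p0)//.
  rewrite (le_trans (wosc_le _ _ _ _ (ltW c0)))// powRD; last by rewrite (gt_eqF x0) implybT.
  by rewrite powRr1 ?(ltW x0)// ler_piMl ?(ltW x0)// powR_le1.
Qed.

Lemma cos_ge_itv e th : 0 < e -> e < pi / 2 -> - e < th < e -> cos e <= cos th.
Proof.
move=> e0 epi /andP[eth the]; rewrite -(cos_norm th) ltW// ltr_cos ?in_itv/= ?normr_ge0/=.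
- by rewrite ltr_norml eth.
- rewrite (@le_trans _ _ e) ?ler_norml ?(ltW eth) ?(ltW the)//.
  by rewrite (le_trans (ltW epi))// ler_pdivrMr// ler_peMr ?ler1n// pi_ge0.
- by rewrite (ltW e0) (le_trans (ltW epi))// ler_pdivrMr// ler_peMr ?ler1n// pi_ge0.
Qed.

Lemma wosc_phase_integral r th b : 0 <= r -> - (pi / 2) < th < pi / 2 ->
  \int[mu]_(x in `]0, +oo[) wosc r th (b - (r + 1) / p * th) x =
  \int[mu]_(x in `]0, +oo[) wosc r 0 b x.
Proof.
move=> r0 /andP[th1 th2]; set s := (r + 1) / p.
have s0 : 0 <= s by rewrite divr_ge0 ?addr_ge0 ?(ltW p0).
(* Halfway between |th| and pi/2: on []-e, e[] the cosine stays above [cos e > 0], which makes the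
   majorant [G] integrable. *)
pose e := (`|th| + pi / 2) / 2.
have thpi : `|th| < pi / 2 by rewrite ltr_norml th1.
have the : `|th| < e by rewrite ltr_pdivlMr// mulr_natr mulr2n ltrD2l.
have epi : e < pi / 2 by rewrite ltr_pdivrMr// mulr_natr mulr2n ltrD2r.
have e0 : 0 < e by rewrite (le_lt_trans _ the).
have ce : 0 < cos e by apply: cos_gt0_pihalf; rewrite epi (lt_trans _ e0)// oppr_lt0 (lt_trans e0).
pose f t x := wosc r t (b - s * t) x.
pose df t x := s * wosc r t (b - s * t - pi / 2) x - wosc (r + p) t (b - s * t - pi / 2 - t) x.
pose G x := s * (x `^ r * expR (- (cos e * x `^ p))) + x `^ (r + p) * expR (- (cos e * x `^ p)).
have dU t : - e < t < e -> is_derive t 1 (fun t => \int[mu]_(x in `]0, +oo[) f t x) 0.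
  move=> tI; have It : `]- e, e[%classic t by rewrite /= in_itv.
  have cI u : `]- e, e[%classic u -> cos e <= cos u.
    by rewrite /= in_itv/= => /cos_ge_itv; apply.
  have ci u : `]- e, e[%classic u -> 0 < cos u by move=> /cI; exact: lt_le_trans.
  have intf u : `]- e, e[%classic u -> mu.-integrable `]0, +oo[ (EFin \o f u).
    by move=> /ci; exact: wosc_integrable.
  have derf u x : `]- e, e[%classic u -> `]0, +oo[%classic x -> derivable (f ^~ x) u 1.
    move=> _; rewrite /= in_itv/= andbT => x0; have dd := wosc_phase_derive r b u x0.
    exact: ex_derive.
  have dfE u x : 0 < x -> partial1of2 f u x = df u x.
    move=> x0; rewrite /partial1of2 derive1E; have dd := wosc_phase_derive r b u x0.
    exact: derive_val.
  have G0 x : 0 <= G x.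
    by apply: addr_ge0; [apply: mulr_ge0 => //; apply: mulr_ge0|apply: mulr_ge0]; rewrite ?powR_ge0 ?expR_ge0.
  have Gi : mu.-integrable `]0, +oo[ (EFin \o G).
    apply: integrable_RD => //.
      by apply: integrable_RZ => //; exact: powR_expR_integrable.
    by apply: powR_expR_integrable => //; rewrite addr_ge0 ?(ltW p0).
  have Gub u x : `]- e, e[%classic u -> `]0, +oo[%classic x -> `|partial1of2 f u x| <= G x.
    move=> Iu; rewrite /= in_itv/= andbT => x0; rewrite dfE//.
    by apply: wosc_phase_derive_le => //; [exact/ltW|exact: cI].
  have m0 : measurable (`]0, +oo[ : set (measurableTypeR R)) by [].
  apply: DeriveDef.
    exact: (derivable_under_integral m0 It intf derf G0 Gi Gub).
  rewrite -derive1E (differentiation_under_integral m0 It intf derf G0 Gi Gub).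
  rewrite -[RHS](@wosc_integral0 r t (b - s * t - pi / 2) r0 (ci _ It)).
  by apply: eq_Rintegral => x; rewrite inE/= in_itv/= andbT => x0; exact: dfE.
have -> : \int[mu]_(x in `]0, +oo[) wosc r 0 b x = \int[mu]_(x in `]0, +oo[) f 0 x.
  by rewrite /f mulr0 subr0.
have itv t : `|t| <= `|th| -> - e < t < e by move=> h; rewrite -ltr_norml (le_lt_trans h).
have [h|h|h] := ltgtP th 0; last by rewrite h.
- have [t|t _] := @MVT_ex _ (fun t => \int[mu]_(x in `]0, +oo[) f t x) (fun=> 0) th 0 h.
    move=> /andP[t1 t2]; apply: dU; apply: itv.
    by rewrite !ler0_norm ?lerN2// ltW.
  by rewrite mul0r => /eqP; rewrite subr_eq0 => /eqP <-.
- have [t|t _] := @MVT_ex _ (fun t => \int[mu]_(x in `]0, +oo[) f t x) (fun=> 0) 0 th h.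
    move=> /andP[t1 t2]; apply: dU; apply: itv.
    by rewrite !ger0_norm// ltW.
  by rewrite mul0r => /eqP; rewrite subr_eq0 => /eqP <-.
Qed.

(** The Gamma factor comes from the angle 0, where the kernel is [cos b * e^(-x^p)]; the phase
    [th (r + 1) / p] is what the rotation accumulates. *)
Lemma wosc_integral r th b : 0 <= r -> - (pi / 2) < th < pi / 2 ->
  \int[mu]_(x in `]0, +oo[) wosc r th b x =
  p^-1 * Gamma ((r + 1) / p) * cos (b + th * ((r + 1) / p)).
Proof.
move=> r0 thI; have := @wosc_phase_integral r th (b + th * ((r + 1) / p)) r0 thI.
rewrite (_ : b + _ - _ = b); last by ring.
move=> ->; rewrite -integral_powR_expR// -RintegralZr//; last first.
  have := powR_expR_integrable r0 ltr01.
  by congr (integrable _ _ _); apply/funext => x /=; rewrite mul1r.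
apply: eq_Rintegral => x _.
by rewrite /wosc /osc cos0 sin0 mul1r mul0r addr0 mulrA.
Qed.

(** An integrated form of Cauchy's formula for repeated integration: each integration by parts
    trades one tail for one more power of x. The exponent j is free so that the induction on m can
    raise it. *)
Lemma itail_moment m j r th b : 0 <= r -> 0 < cos th ->
  \int[mu]_(x in `]0, +oo[) (x ^+ j / j`!%:R * itail m r th b x) =
  \int[mu]_(x in `]0, +oo[) (x ^+ (j + m) / (j + m)`!%:R * wosc r th b x).
Proof.
move=> r0 c0; elim: m j => [|m ih] j; first by rewrite addn0.
rewrite addnS -addSn -ih; apply/eqP; rewrite -subr_eq0; apply/eqP.
have bnd i k : forall x, 0 < x <= 1 -> `|x ^+ i / i`!%:R * itail k r th b x| <=
    (sval (cid2 (itail_bound01 p0 k r0))) * x ^+ i.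
  move=> x /[dup] x01 /andP[x0 x1]; case: cid2 => C C0 hC /=.
  rewrite normrM mulrC ler_pM ?hC// ger0_norm ?divr_ge0 ?exprn_ge0 ?(ltW x0)//.
  by rewrite ler_pdivrMr ?ltr0n ?fact_gt0// ler_peMr ?exprn_ge0 ?(ltW x0)// ler1n fact_gt0.
have rd i k : rdecay (fun x => x ^+ i / i`!%:R * itail k r th b x).
  under eq_fun do rewrite -mulrA mulrCA; apply: rdecay_scale; apply: rdecay_mulX.
  exact: itail_rdecay.
have ig i k : mu.-integrable `]0, +oo[ (EFin \o (fun x => x ^+ i / i`!%:R * itail k r th b x)).
  apply: (@rdecay_integrable0 _ _ (sval (cid2 (itail_bound01 p0 k r0))) (rd i k)).
  move=> x x01; apply: le_trans (bnd i k x x01) _; rewrite ler_piMr//; first by case: cid2.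
  by case/andP : x01 => x0 x1; rewrite exprn_ile1 ?(ltW x0).
rewrite -RintegralB//.
rewrite -[RHS]oppr0; apply: (@Rintegral_FTC_rdecay _ (fun x => x ^+ j.+1 / j.+1`!%:R * itail m.+1 r th b x)).
- move=> x x0.
  have dX : is_derive x 1 (fun y : R => y ^+ j.+1 / j.+1`!%:R) (x ^+ j / j`!%:R).
    have h : is_derive x 1 (fun y : R => y ^+ j.+1) (j.+1%:R * x ^+ j).
      by apply: DeriveDef; [exact: exprn_derivable|rewrite exp_derive /GRing.scale/= mulr1].
    have := is_derive1_mul h (is_derive_cst (j.+1`!%:R^-1 : R) x 1).
    rewrite mulr0 addr0 (_ : _ * cst _ x = x ^+ j / j`!%:R)//.
    by rewrite /cst factS natrM invfM mulrACA mulfV ?mul1r// pnatr_eq0.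
  have := is_derive1_mul dX (itail_derive p0 m r b c0 x0).
  by rewrite mulrN.
- move=> x x0; apply: continuousB; first exact: (rd _ _).1.
  exact: (rd _ _).1.
- have -> : (fun x => x ^+ j / j`!%:R * itail m.+1 r th b x - x ^+ j.+1 / j.+1`!%:R * itail m r th b x)
    = (fun x => x ^+ j / j`!%:R * itail m.+1 r th b x + (-1) * (x ^+ j.+1 / j.+1`!%:R * itail m r th b x)).
    by apply/funext => x; rewrite mulN1r.
  by apply: integrable_RD => //; exact: integrable_RZ.
- exact: rd.
- apply: (@cvg0_at0 _ (fun x => x ^+ j.+1 / j.+1`!%:R * itail m.+1 r th b x)
    (sval (cid2 (itail_bound01 p0 m.+1 r0)))) => x /[dup] x01 /andP[x0 x1].
  apply: le_trans (bnd _ _ _ x01) _; apply: ler_wpM2l; first by case: cid2.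
  by rewrite exprS ler_piMr ?exprn_ile1 ?(ltW x0).
Qed.

Lemma itail_integral k r th b : 0 <= r -> - (pi / 2) < th < pi / 2 ->
  \int[mu]_(x in `]0, +oo[) itail k r th b x =
  p^-1 * Gamma ((r + k%:R + 1) / p) * cos (b + th * ((r + k%:R + 1) / p)) / k`!%:R.
Proof.
move=> r0 thI; have c0 : 0 < cos th by exact: cos_gt0_pihalf.
have := itail_moment k 0 b r0 c0; rewrite add0n.
under eq_Rintegral do rewrite expr0 fact0 invr1 !mul1r.
move=> ->; have rk : 0 <= r + k%:R by rewrite addr_ge0.
rewrite -wosc_integral// -RintegralZr//; last exact: wosc_integrable.
apply: eq_Rintegral => x; rewrite inE/= in_itv/= andbT => x0.
rewrite /wosc powRD; last by rewrite (gt_eqF x0) implybT.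
by rewrite powR_mulrn ?(ltW x0)//; ring.
Qed.

End kernel_moments.

(** * Expansion in one variable *)

Section scaled_expansion.
Context {R : realType}.
Notation mu := (@lebesgue_measure R).
Variable p : R.
Hypothesis p0 : 0 < p.
Implicit Types (r s th b x y eps B M sg : R) (f df : R -> R) (fs : nat -> R -> R).
Local Notation wosc := (wosc p).
Local Notation itail := (itail p).

Lemma itail_product_integrable k r th b f B : 0 <= r -> 0 < cos th ->
  continuous f -> (forall x, 0 <= x -> `|f x| <= B) ->
  mu.-integrable `]0, +oo[ (EFin \o (fun x => f x * itail k r th b x)).
Proof.
move=> r0 c0 cf fB; have [C C0 hC] := itail_bound01 p0 k r0.
apply: (@rdecay_integrable0 _ (fun x => f x * itail k r th b x) (B * C)).
  apply: (rdecay_mul (B := B)); [by move=> x _; exact: cf| |exact: itail_rdecay].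
  by move=> x x1; apply: fB; exact: le_trans x1.
move=> x /[dup] x01 /andP[x0 _]; rewrite normrM ler_pM ?hC// fB// ltW//.
Qed.

(** Minus [itail k.+1] is a primitive of [itail k], and [itail k.+1] tends at 0 to the full integral
    of [itail k]: this is the boundary term. *)
Lemma itail_expand1 k r th b f df B : 0 <= r -> 0 < cos th ->
  (forall x, is_derive x 1 f (df x)) -> continuous df ->
  (forall x, 0 <= x -> `|f x| <= B) -> (forall x, 0 <= x -> `|df x| <= B) ->
  \int[mu]_(x in `]0, +oo[) (f x * itail k r th b x) =
  f 0 * \int[mu]_(x in `]0, +oo[) itail k r th b x +
  \int[mu]_(x in `]0, +oo[) (df x * itail k.+1 r th b x).
Proof.
move=> r0 c0 dF cdf fB dfB.
have cf : continuous f by move=> x; exact: is_derive_continuous (dF x).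
have i1 := itail_product_integrable k b r0 c0 cf fB.
have i2 := itail_product_integrable k.+1 b r0 c0 cdf dfB.
apply/eqP; rewrite -subr_eq -RintegralB//; apply/eqP.
have rt j := itail_rdecay p0 j r b c0.
have [C C0 hC] := itail_bound01 p0 k r0.
rewrite -[RHS]opprK -mulNr; apply: (@Rintegral_FTC_rdecay _ (fun x => - f x * itail k.+1 r th b x)).
- move=> x x0; have := is_derive1_mul (is_derive1_opp (dF x)) (itail_derive p0 k r b c0 x0).
  by rewrite mulrNN mulNr addrC.
- by move=> x x0; apply: continuousB; apply: continuousM;
    [exact: cf|exact: (rt k).1|exact: cdf|exact: (rt k.+1).1].
- have -> : (fun x => f x * itail k r th b x - df x * itail k.+1 r th b x) =
     (fun x => f x * itail k r th b x + (-1) * (df x * itail k.+1 r th b x)).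
    by apply/funext => x; rewrite mulN1r.
  by apply: integrable_RD => //; exact: integrable_RZ.
- apply: (rdecay_mul (B := B)) => //; first by move=> x _; apply: continuousN; exact: cf.
  by move=> x x1; rewrite normrN fB// (le_trans _ x1).
- apply: cvgM.
    apply: cvgN; apply: (@cvg_comp _ _ _ (fun n => n.+1%:R^-1) f _ (nbhs (0 : R))).
      exact: cvg_harmonic.
    exact: cf.
  by apply: (@tail_cvg0 _ (itail k r th b) C) => // x; exact: hC.
Qed.

Lemma itail_expand K r th b fs eps B : 0 <= r -> 0 < cos th -> 0 <= eps ->
  (forall k x, (k < K)%N -> is_derive x 1 (fs k) (fs k.+1 x)) -> continuous (fs K) ->
  (forall k x, (k <= K)%N -> 0 <= x -> `|fs k x| <= B) ->
  \int[mu]_(x in `]0, +oo[) (fs 0%N (eps * x) * wosc r th b x) =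
  \sum_(k < K) eps ^+ k * fs k 0 * \int[mu]_(x in `]0, +oo[) itail k r th b x +
  eps ^+ K * \int[mu]_(x in `]0, +oo[) (fs K (eps * x) * itail K r th b x).
Proof.
move=> r0 c0 e0 df cf fB.
have cfk k : (k <= K)%N -> continuous (fs k).
  rewrite leq_eqVlt => /predU1P[->//|kK] x; exact: is_derive_continuous (df _ x kK).
have cfe k : (k <= K)%N -> continuous (fun x => fs k (eps * x)).
  move=> kK x; apply: (@continuous_comp _ _ _ (fun x => eps * x) (fs k)); last exact: cfk.
  by apply: cvgM; [exact: cvg_cst|exact: cvg_id].
have fBe k x : (k <= K)%N -> 0 <= x -> `|fs k (eps * x)| <= B.
  by move=> kK x0; apply: fB => //; exact: mulr_ge0.
suff H : forall n, (n <= K)%N -> \int[mu]_(x in `]0, +oo[) (fs 0%N (eps * x) * wosc r th b x) =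
    \sum_(k < n) eps ^+ k * fs k 0 * \int[mu]_(x in `]0, +oo[) itail k r th b x +
    eps ^+ n * \int[mu]_(x in `]0, +oo[) (fs n (eps * x) * itail n r th b x) by exact: H.
elim=> [|n ih] nK; first by rewrite big_ord0 add0r mul1r.
have nK' := ltnW nK; rewrite (ih nK') big_ord_recr/= -addrA; congr (_ + _).
have B0 : 0 <= B by apply: le_trans (fB n 0 nK' (lexx _)).
have de x : is_derive x 1 (fun x => fs n (eps * x)) (eps * fs n.+1 (eps * x)).
  have de : is_derive x 1 (fun x => eps * x) (eps * 1).
    exact: is_derive1_scale (is_derive_id x 1).
  have := @is_derive1_comp _ (fs n) (fun x => eps * x) x _ _ (df n (eps * x) nK) de.
  by rewrite mulr1 mulrC.
have cde : continuous (fun x => eps * fs n.+1 (eps * x)).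
  move=> x; apply: (@continuousM _ _ (cst eps) (fun x => fs n.+1 (eps * x))); first exact: cvg_cst.
  exact: cfe.
(* [itail_expand1] takes a single bound for the function and its derivative; [B + eps * B] serves
   for both. *)
have B1 x : 0 <= x -> `|fs n (eps * x)| <= B + eps * B.
  by move=> x0; rewrite (le_trans (fBe _ _ nK' x0))// lerDl mulr_ge0.
have B2 x : 0 <= x -> `|eps * fs n.+1 (eps * x)| <= B + eps * B.
  move=> x0; rewrite normrM ger0_norm// (@le_trans _ _ (eps * B)) ?lerDr//.
  by rewrite ler_wpM2l// fBe.
rewrite (itail_expand1 n b r0 c0 de cde B1 B2).
rewrite mulr0 mulrDr mulrA; congr (_ + _).
rewrite exprSr -mulrA; congr (_ * _); rewrite -RintegralZl//.
  by apply: eq_Rintegral => x _; rewrite mulrA.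
exact: (itail_product_integrable n.+1 b r0 c0 (cfe _ nK) (fun x => fBe _ x nK)).
Qed.

(** For eps <= 1 one has [eps (1 + x) <= 1 + eps x]. *)
Lemma scale_powR_le eps x s : 0 < eps -> eps <= 1 -> 0 < x -> 0 <= s ->
  (1 + x) `^ s <= eps `^ (- s) * (1 + eps * x) `^ s.
Proof.
move=> e0 e1 x0 s0; have ex0 : 0 < 1 + eps * x by rewrite addr_gt0// mulr_gt0.
rewrite (_ : eps `^ (- s) = eps^-1 `^ s); last first.
  by rewrite powRN -[eps^-1]powR_inv1 ?(ltW e0)// -powRrM mulN1r powRN.
rewrite -powRM ?invr_ge0 ?(ltW e0) ?(ltW ex0)// ge0_ler_powR//.
- by rewrite nnegrE addr_ge0 ?(ltW x0).
- by rewrite nnegrE mulr_ge0 ?invr_ge0 ?(ltW e0) ?(ltW ex0).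
by rewrite mulrDr mulr1 mulKf ?gt_eqF// lerD2r invf_ge1.
Qed.

Lemma decay_powR_le (L : nat) y s : 0 < y -> s + 2 <= L%:R ->
  (1 + y) `^ s * (1 + y) ^- L <= (1 + y) ^- 2.
Proof.
move=> y0 sL; have y1 : 0 <= 1 + y by rewrite addr_ge0 ?(ltW y0).
have y2 : 1 + y != 0 by rewrite gt_eqF// addr_gt0.
rewrite -!powR_invn// -powRD; last by rewrite y2 implybT.
by apply: ler_powR; [rewrite lerDl ltW|lra].
Qed.

Lemma integral_scaled_inv_sqr eps : 0 < eps ->
  mu.-integrable `]0, +oo[ (fun x => ((1 + eps * x) ^- 2)%:E) /\
  \int[mu]_(x in `]0, +oo[) (1 + eps * x) ^- 2 =
  eps^-1 * \int[mu]_(x in `]0, +oo[) (1 + x) ^- 2.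
Proof.
move=> e0.
have cinv c x : 0 <= c -> 0 < x -> {for x, continuous (fun x : R => (1 + c * x) ^- 2)}.
  move=> c0 x0; have x1 : 1 + c * x != 0 by rewrite gt_eqF// ltr_pwDl// mulr_ge0// ltW.
  have c1 : {for x, continuous (fun x : R => 1 + c * x)}.
    by apply: cvgD; [exact: cvg_cst|apply: cvgM; [exact: cvg_cst|exact: cvg_id]].
  apply: continuousV; first by rewrite expf_neq0.
  exact: (@continuousM _ _ (fun x => 1 + c * x) (fun x => 1 + c * x)).
have ii : mu.-integrable `]0, +oo[ (EFin \o (fun x => (1 + eps * x) ^- 2)).
  apply: (@integrable_oy_bound _ _ (1 + eps ^- 2)) => x x0; first exact: cinv (ltW e0) x0.
  have x1 : 0 < 1 + x by rewrite addr_gt0.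
  have ex1 : 0 < 1 + eps * x by rewrite addr_gt0// mulr_gt0.
  rewrite ger0_norm ?invr_ge0 ?sqr_ge0// ler_pdivlMr ?exprn_gt0// mulrC ler_pdivrMr ?exprn_gt0//.
  have e2 : eps ^- 2 * eps ^+ 2 = 1 by rewrite mulVf// expf_neq0// gt_eqF.
  have ei : 0 <= eps ^- 2 by rewrite invr_ge0 sqr_ge0.
  have -> : (1 + eps ^- 2) * (1 + eps * x) ^+ 2 = (1 + eps * x) ^+ 2 +
    eps ^- 2 * (1 + 2 * (eps * x)) + eps ^- 2 * eps ^+ 2 * x ^+ 2 by ring.
  rewrite e2 mul1r; have -> : (1 + x) ^+ 2 = 1 + 2 * x + x ^+ 2 by ring.
  rewrite lerD2r.
  have -> : (1 + eps * x) ^+ 2 + eps ^- 2 * (1 + 2 * (eps * x)) =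
    1 + 2 * x * (eps + eps ^- 2 * eps) + (eps * x) ^+ 2 + eps ^- 2 by ring.
  rewrite -!addrA lerD2l -[leLHS]addr0 lerD ?addr_ge0 ?sqr_ge0//.
  rewrite ler_peMr ?mulr_ge0 ?(ltW x0)//.
  have [e1|e1] := leP 1 eps; first by rewrite (le_trans e1)// lerDl mulr_ge0// ltW.
  rewrite -[leLHS]add0r lerD ?(ltW e0)// expr2 invfM -mulrA mulVf ?gt_eqF// mulr1.
  by rewrite invf_ge1// ltW.
split=> //.
rewrite (@Rintegral_scale _ eps (fun x => (1 + x) ^- 2))//.
- by rewrite mulKf ?gt_eqF.
- have -> : (fun x : R => (1 + x) ^- 2) = (fun x => (1 + 1 * x) ^- 2) by apply/funext => z; rewrite mul1r.
  by move=> x; exact: cinv.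
- exact: integrable_inv_sqr.
Qed.

(** The factor [f (eps x)] confines x to the scale 1/eps, where the tail has size [eps^(-s)], and
    the integration costs one more [1 / eps]. The hypothesis on L leaves a factor [(1 + eps x)^-2]
    to integrate. C depends on p, K and r alone. *)
Lemma itail_remainder K r : 0 <= r -> exists2 C, 0 <= C &
  forall (L : nat) th b f eps M, 0 < cos th -> 0 < eps -> eps <= 1 -> continuous f ->
  r + K%:R * growth p + 2 <= L%:R -> (forall x, 0 <= x -> `|f x| <= M * (1 + x) ^- L) ->
  `|\int[mu]_(x in `]0, +oo[) (f (eps * x) * itail K r th b x)| <=
  C * M * (eps `^ (- (r + K%:R * growth p)) / eps).
Proof.
move=> r0; have [C C0 hC] := itail_growth p0 K r0; set s := r + _.
have s0 : 0 <= s by rewrite addr_ge0// mulr_ge0// le_max lexx orbT.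
set I := \int[mu]_(x in `]0, +oo[) (1 + x) ^- 2.
have I0 : 0 <= I by apply: Rintegral_ge0 => x _; rewrite invr_ge0 sqr_ge0.
exists (C * I); first exact: mulr_ge0.
move=> L th b f eps M c0 e0 e1 cf sL fM.
have M0 : 0 <= M by have := le_trans (normr_ge0 _) (fM 0 (lexx _)); rewrite addr0 expr1n invr1 mulr1.
have cfe : continuous (fun x => f (eps * x)).
  move=> x; apply: (@continuous_comp _ _ _ (fun x => eps * x) f); last exact: cf.
  by apply: cvgM; [exact: cvg_cst|exact: cvg_id].
have fB x : 0 <= x -> `|f (eps * x)| <= M.
  move=> x0; have ex0 : 0 <= eps * x by rewrite mulr_ge0 ?(ltW e0).
  rewrite (le_trans (fM _ ex0))// ler_piMr// invf_le1 ?exprn_gt0 ?ltr_pwDl//.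
  by rewrite exprn_ege1// lerDl.
have fi := itail_product_integrable K b r0 c0 cfe fB.
have [gi gE] := integral_scaled_inv_sqr e0.
apply: le_trans (le_normr_Rintegral _ fi) _ => //.
apply: (@le_trans _ _ (\int[mu]_(x in `]0, +oo[) (C * M * eps `^ (- s) * (1 + eps * x) ^- 2))).
  apply: le_Rintegral => //.
  - exact: integrable_Rabs.
  - exact: integrable_RZ.
  - move=> x /=; rewrite in_itv/= andbT => x0.
    have ex0 : 0 < eps * x by rewrite mulr_gt0.
    rewrite normrM (le_trans (ler_pM _ _ (fM _ (ltW ex0)) (hC th b x c0 x0)))//.
    rewrite (_ : M * _ * _ = C * M * ((1 + x) `^ s * (1 + eps * x) ^- L)); last by rewrite -/s; ring.
    rewrite -[leRHS]mulrA ler_wpM2l ?mulr_ge0//.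
    apply: (@le_trans _ _ (eps `^ (- s) * (1 + eps * x) `^ s * (1 + eps * x) ^- L)).
      by rewrite ler_wpM2r ?scale_powR_le// invr_ge0 exprn_ge0// addr_ge0 ?(ltW ex0).
    by rewrite -mulrA ler_wpM2l ?powR_ge0// decay_powR_le.
rewrite RintegralZl// gE -/I le_eqVlt; apply/orP; left; apply/eqP.
by rewrite -/s; ring.
Qed.

(** For r >= 1 and |th| < pi/2 this is the integral of [x^(r-1) * osc th b], the exponent being
    shifted by one as in a Mellin transform. The formula still makes sense at [+-pi/2], where it is
    reached as a limit. *)
Definition moment r b th := p^-1 * Gamma (r / p) * cos (b + th * (r / p)).

Lemma wosc_pihalf r sg b x : sg = 1 \/ sg = -1 ->
  wosc r (sg * (pi / 2)) b x = x `^ r * cos (b + sg * x `^ p).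
Proof.
case=> ->; rewrite /wosc /osc ?mul1r ?mulN1r ?cosN ?sinN cos_pihalf sin_pihalf.
  by rewrite mul0r oppr0 expR0 !mul1r.
by rewrite mul0r oppr0 expR0 !mul1r mulN1r.
Qed.

(** Dominated convergence works along sequences, so the limit in the angle is taken along one. *)
Lemma pihalf_seq sg : sg = 1 \/ sg = -1 -> exists th_ : nat -> R,
  (forall n, - (pi / 2) < th_ n < pi / 2) /\ th_ n @[n --> \oo] --> sg * (pi / 2).
Proof.
move=> sg1; exists (fun n => sg * (pi / 2) * (1 - n.+1%:R^-1)); split=> [n|].
  have pi2 : 0 < pi / 2 :> R by rewrite divr_gt0 ?pi_gt0.
  rewrite -ltr_norml normrM (_ : `|sg * (pi / 2)| = pi / 2); last first.
    by rewrite normrM; case: sg1 => ->; rewrite ?normrN normr1 mul1r ger0_norm// ltW.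
  rewrite gtr_pMr// ger0_norm; first by rewrite gtrBl invr_gt0.
  by rewrite subr_ge0 invf_le1 ?ler1n.
have h : (fun n => sg * (pi / 2) * (1 - n.+1%:R^-1)) @ \oo --> sg * (pi / 2) * (1 - 0).
  apply: cvgM; first exact: cvg_cst.
  by apply: cvgB; [exact: cvg_cst|exact: cvg_harmonic].
by rewrite subr0 mulr1 in h.
Qed.

(** The bound does not depend on th and allows [cos th = 0]: it gives integrability at [+-pi/2] and
    is the majorant in the limit. The decay of f replaces the damping of the kernel. *)
Lemma wosc_product_bound (L : nat) r th b f eps M x : 0 <= r -> 0 <= cos th ->
  0 < eps -> eps <= 1 -> r + 2 <= L%:R -> (forall x, 0 <= x -> `|f x| <= M * (1 + x) ^- L) ->
  0 < x -> `|f (eps * x) * wosc r th b x| <= eps `^ (- r) * M * (1 + eps * x) ^- 2.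
Proof.
move=> r0 c0 e0 e1 rL fM x0; have ex0 : 0 < eps * x by rewrite mulr_gt0.
have M0 : 0 <= M by have := le_trans (normr_ge0 _) (fM 0 (lexx _)); rewrite addr0 expr1n invr1 mulr1.
rewrite normrM (le_trans (ler_pM _ _ (fM _ (ltW ex0)) (wosc_le p r b x c0)))//.
rewrite (_ : eps `^ (- r) * M * _ = M * (eps `^ (- r) * (1 + eps * x) ^- 2)); last by ring.
rewrite -mulrA ler_wpM2l// (@le_trans _ _ ((eps `^ (- r) * (1 + eps * x) `^ r) * (1 + eps * x) ^- L))//.
  rewrite mulrC ler_wpM2r ?invr_ge0 ?exprn_ge0 ?addr_ge0 ?(ltW ex0)//.
  apply: le_trans (scale_powR_le e0 e1 x0 r0).
  by rewrite ge0_ler_powR ?nnegrE ?lerDr ?addr_ge0 ?(ltW x0).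
by rewrite -mulrA ler_wpM2l ?powR_ge0// decay_powR_le.
Qed.

Lemma wosc_product_integrable (L : nat) r th b f eps M : 0 <= r -> 0 <= cos th ->
  0 < eps -> eps <= 1 -> continuous f -> r + 2 <= L%:R ->
  (forall x, 0 <= x -> `|f x| <= M * (1 + x) ^- L) ->
  mu.-integrable `]0, +oo[ (EFin \o (fun x => f (eps * x) * wosc r th b x)).
Proof.
move=> r0 c0 e0 e1 cf rL fM; have [gi _] := integral_scaled_inv_sqr e0.
apply: (@integrable_Rle _ _ _ mu _ _ (fun x : measurableTypeR R =>
    eps `^ (- r) * M * (1 + eps * x) ^- 2)) => //.
- apply: continuous_at_measurable_fun => // x /=; rewrite in_itv/= andbT => x0.
  apply: continuousM; last exact: is_derive_continuous (wosc_derive p r th b x0).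
  apply: (@continuous_comp _ _ _ (fun x => eps * x) f); last exact: cf.
  by apply: cvgM; [exact: cvg_cst|exact: cvg_id].
- by move=> x /=; rewrite in_itv/= andbT => x0; exact: (wosc_product_bound b r0 c0 e0 e1 rL fM x0).
- exact: integrable_RZ.
Qed.

(** [itail_expand] is used for |th| < pi/2 only, and it is the resulting inequality that passes to
    the limit: the main integral by dominated convergence, the sum by continuity of the cosine.
    Tails at [+-pi/2] are never formed. *)
Lemma oscillatory_scaled_expansion K r : 0 <= r -> exists2 C, 0 <= C &
  forall (L : nat) sg b fs eps M, sg = 1 \/ sg = -1 -> 0 < eps -> eps <= 1 ->
  r + K%:R * growth p + 2 <= L%:R ->
  (forall k x, (k < K)%N -> is_derive x 1 (fs k) (fs k.+1 x)) -> continuous (fs K) ->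
  (forall k x, (k <= K)%N -> 0 <= x -> `|fs k x| <= M * (1 + x) ^- L) ->
  `|\int[mu]_(x in `]0, +oo[) (fs 0%N (eps * x) * (x `^ r * cos (b + sg * x `^ p))) -
    \sum_(k < K) eps ^+ k * (fs k 0 / k`!%:R) * moment (r + k%:R + 1) b (sg * (pi / 2))| <=
  C * M * (eps ^+ K * (eps `^ (- (r + K%:R * growth p)) / eps)).
Proof.
move=> r0; have [C C0 hC] := itail_remainder K r0; set s := r + _.
exists C => // L sg b fs eps M sg1 e0 e1 sL df cf fM.
have s0 : r <= s by rewrite lerDl mulr_ge0// le_max lexx orbT.
have M0 : 0 <= M.
  by have := le_trans (normr_ge0 _) (fM 0%N 0 (leq0n _) (lexx _)); rewrite addr0 expr1n invr1 mulr1.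
have fB k x : (k <= K)%N -> 0 <= x -> `|fs k x| <= M.
  move=> kK x0; rewrite (le_trans (fM _ _ kK x0))// ler_piMr// invf_le1 ?exprn_gt0 ?ltr_pwDl//.
  by rewrite exprn_ege1// lerDl.
pose S th := \sum_(k < K) eps ^+ k * (fs k 0 / k`!%:R) * moment (r + k%:R + 1) b th.
pose I th := \int[mu]_(x in `]0, +oo[) (fs 0%N (eps * x) * wosc r th b x).
have H th : - (pi / 2) < th < pi / 2 ->
    `|I th - S th| <= C * M * (eps ^+ K * (eps `^ (- s) / eps)).
  move=> thI; have c0 : 0 < cos th by exact: cos_gt0_pihalf.
  rewrite /I (itail_expand b r0 c0 (ltW e0) df cf fB) [X in `|X|](_ : _ =
     eps ^+ K * \int[mu]_(x in `]0, +oo[) (fs K (eps * x) * itail K r th b x)).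
    rewrite normrM ger0_norm ?exprn_ge0 ?(ltW e0)// mulrCA ler_wpM2l ?exprn_ge0 ?(ltW e0)//.
    by apply: hC sL _ => // x; exact: fM.
  rewrite addrAC (_ : \sum_(k < K) _ = S th) ?subrr ?add0r//; apply: eq_bigr => k _.
  by rewrite itail_integral// /moment; ring.
have [th_ [thI thl]] := pihalf_seq sg1.
have cfk0 : continuous (fs 0%N).
  case: (posnP K) => [K0|K0]; first by move: cf; rewrite K0.
  by move=> x; exact: is_derive_continuous (df 0%N x K0).
have Sl : S (th_ n) @[n --> \oo] --> S (sg * (pi / 2)).
  apply: cvg_big => [|k _]; first exact: add_continuous.
  apply: cvgM; first exact: cvg_cst.
  apply: cvgM; first exact: cvg_cst.
  apply: (@cvg_comp _ _ _ _ (@cos R) _ (nbhs (b + sg * (pi / 2) * ((r + k%:R + 1) / p)))).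
    by apply: cvgD; [exact: cvg_cst|apply: cvgM => //; exact: cvg_cst].
  exact: continuous_cos.
have [gi gE] := integral_scaled_inv_sqr e0.
have Il : I (th_ n) @[n --> \oo] --> I (sg * (pi / 2)).
  have cth : 0 <= cos (sg * (pi / 2)) by case: sg1 => ->; rewrite ?mul1r ?mulN1r ?cosN cos_pihalf.
  have ci n : 0 <= cos (th_ n) by apply/ltW/cos_gt0_pihalf/thI.
  have rL : r + 2 <= L%:R by rewrite (le_trans _ sL)// lerD2r.
  have fi th : 0 <= cos th -> mu.-integrable `]0, +oo[ (EFin \o (fun x => fs 0%N (eps * x) * wosc r th b x)).
    move=> c0; exact: (wosc_product_integrable b r0 c0 e0 e1 cfk0 rL (fun x => @fM 0%N x (leq0n _))).
  apply: fine_cvg; rewrite fineK; last exact: (integrable_fin_num _ (fi _ cth)).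
  apply: (@dominated_cvg _ _ _ mu (`]0, +oo[ : set (measurableTypeR R)) _
    (fun n x => (fs 0%N (eps * x) * wosc r (th_ n) b x)%:E)
    (fun x => (fs 0%N (eps * x) * wosc r (sg * (pi / 2)) b x)%:E)
    (fun x => (eps `^ (- r) * M * (1 + eps * x) ^- 2)%:E)) => //.
  - by move=> n; have /integrableP[] := fi _ (ci n).
  - move=> x _; apply: cvg_EFin; first exact: nearW.
    apply: cvgM; first exact: cvg_cst.
    apply: cvgM; first exact: cvg_cst.
    apply: cvgM.
      apply: (@cvg_comp _ _ _ _ (@expR R) _ (nbhs (- (cos (sg * (pi / 2)) * x `^ p)))); last exact: continuous_expR.
      apply: cvgN; apply: cvgM; last exact: cvg_cst.
      by apply: (@cvg_comp _ _ _ _ (@cos R) _ (nbhs (sg * (pi / 2)))) => //; exact: continuous_cos.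
    apply: (@cvg_comp _ _ _ _ (@cos R) _ (nbhs (b + sin (sg * (pi / 2)) * x `^ p))); last exact: continuous_cos.
    apply: cvgD; first exact: cvg_cst.
    apply: cvgM; last exact: cvg_cst.
    by apply: (@cvg_comp _ _ _ _ (@sin R) _ (nbhs (sg * (pi / 2)))) => //; exact: continuous_sin.
  - exact: integrable_RZ.
  - move=> n x /=; rewrite in_itv/= andbT lee_fin => x0.
    exact: (wosc_product_bound b r0 (ci n) e0 e1 rL (fun x => @fM 0%N x (leq0n _)) x0).
under eq_Rintegral do rewrite -wosc_pihalf//.
have l : `|I (th_ n) - S (th_ n)| @[n --> \oo] --> `|I (sg * (pi / 2)) - S (sg * (pi / 2))|.
  by apply: cvg_norm; exact: cvgB.
rewrite -[leLHS](cvg_lim _ l)//; apply: limr_le; first by apply/cvg_ex; eexists; exact: l.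
by apply: nearW => n; exact: H.
Qed.

End scaled_expansion.

Local Open Scope complex_scope.

(** * The limit as the cutoff is removed *)

Section oscillatory_limit.
Context {R : realType}.
Notation mu := (@lebesgue_measure R).
Variable p : R.
Hypothesis p0 : 0 < p.
Implicit Types (r s th b x y eps B M sg : R) (f df : R -> R) (fs : nat -> R -> R).

Lemma growth_lt1 : growth p < 1.
Proof. by rewrite /growth gt_max ltr01 andbT gtrBl. Qed.

Lemma scaled_sum_cvg K (a : nat -> R) :
  \sum_(k < K.+1) eps ^+ k * a k @[eps --> 0^'+] --> a 0%N.
Proof.
have -> : a 0%N = \sum_(k < K.+1) (0 : R) ^+ k * a k.
  rewrite big_ord_recl/= mul1r big1 ?addr0// => i _.
  by rewrite exprS mul0r mul0r.
apply: cvg_big => [|k _]; first exact: add_continuous.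
apply: cvgM; last exact: cvg_cst.
by apply: cvg_at_right_filter; exact: exprn_continuous.
Qed.

Lemma oscillatory_limit r sg b fs : 0 <= r -> sg = 1 \/ sg = -1 ->
  (forall k x, is_derive x 1 (fs k) (fs k.+1 x)) ->
  (forall k L : nat, exists M, forall x, 0 <= x -> `|fs k x| <= M * (1 + x) ^- L) ->
  \int[mu]_(x in `]0, +oo[) (fs 0%N (eps * x) * (x `^ r * cos (b + sg * x `^ p)))
    @[eps --> 0^'+] --> fs 0%N 0 * moment p (r + 1) b (sg * (pi / 2)).
Proof.
move=> r0 sg1 df fL; have g1 := growth_lt1.
pose d := 1 - growth p; have d0 : 0 < d by rewrite subr_gt0.
(* K makes [K (1 - growth p) > r + 1], so that the remainder has the positive exponent [K - s - 1]
   in eps. *)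
pose K := (Num.truncn ((r + 1) / d)).+1.
have Kd : r + 1 < K%:R * d by rewrite -ltr_pdivrMr// truncnS_gt.
pose s := r + K%:R * growth p.
pose L := (Num.truncn (s + 2)).+1.
have sL : s + 2 <= L%:R by apply/ltW/truncnS_gt.
have [C C0 hC] := oscillatory_scaled_expansion p0 K r0.
have /choice[M_ hM] : forall k, exists M, forall x, 0 <= x -> `|fs k x| <= M * (1 + x) ^- L by move=> k; exact: fL.
pose M := \sum_(k < K.+1) `|M_ k|.
have fM k x : (k <= K)%N -> 0 <= x -> `|fs k x| <= M * (1 + x) ^- L.
  move=> kK x0; rewrite (le_trans (hM k x x0))// ler_wpM2r ?invr_ge0 ?exprn_ge0 ?addr_ge0//.
  rewrite (le_trans (ler_norm _))// /M (bigD1 (Ordinal (kK : (k < K.+1)%N)))//= lerDl.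
  by apply: sumr_ge0.
have H : \forall eps \near 0^'+,
    `|\int[mu]_(x in `]0, +oo[) (fs 0%N (eps * x) * (x `^ r * cos (b + sg * x `^ p))) -
    \sum_(k < K) eps ^+ k * ((fs k 0 / k`!%:R) * moment p (r + k%:R + 1) b (sg * (pi / 2)))|
    <= C * M * eps `^ (K%:R - s - 1).
  near=> eps.
  have e0 : 0 < eps by near: eps; exact: nbhs_right_gt.
  have e1 : eps <= 1 by near: eps; exact: nbhs_right_le.
  have := hC L sg b fs eps M sg1 e0 e1 sL (fun k x _ => df k x) _ fM.
  under eq_bigr do rewrite -mulrA.
  move=> h; apply: le_trans (h _) _.
    by move=> x; exact: is_derive_continuous (df K x).
  rewrite le_eqVlt; apply/orP; left; apply/eqP; congr (_ * _).
  rewrite -powR_mulrn ?(ltW e0)// mulrA -powRD; last by rewrite (gt_eqF e0) implybT.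
  by rewrite -[X in _ / X]powRr1 ?(ltW e0)// -powRB//; rewrite (gt_eqF e0) implybT.
(* K is a successor, so [K.-1] gives back a sum over ['I_K], of which only the term k = 0
   survives. *)
have S0 := @scaled_sum_cvg K.-1 (fun k => (fs k 0 / k`!%:R) * moment p (r + k%:R + 1) b (sg * (pi / 2))).
rewrite addr0 fact0 divr1 in S0.
pose I eps := \int[mu]_(x in `]0, +oo[) (fs 0%N (eps * x) * (x `^ r * cos (b + sg * x `^ p))).
pose S eps := \sum_(k < K) eps ^+ k * ((fs k 0 / k`!%:R) * moment p (r + k%:R + 1) b (sg * (pi / 2))).
have IS : I eps - S eps @[eps --> 0^'+] --> (0 : R).
  apply: norm_cvg0; apply: (@squeeze_cvgr _ _ _ _ (cst 0) (fun eps => C * M * eps `^ (K%:R - s - 1))).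
  - near=> eps; rewrite /= normr_ge0/=.
    by near: eps; exact: H.
  - exact: cvg_cst.
  - rewrite -[X in _ --> X](mulr0 (C * M)); apply: cvgM; first exact: cvg_cst.
    apply: powR_cvg0; rewrite (_ : K%:R - s - 1 = K%:R * d - (r + 1)); last by rewrite /s /d; ring.
    by rewrite subr_gt0.
rewrite -/I (_ : I = (fun eps => (I eps - S eps) + S eps)); last by apply/funext => eps; rewrite subrK.
by rewrite -[X in _ --> X]add0r; apply: cvgD.
Unshelve. all: by end_near. Qed.

End oscillatory_limit.

(** * Real and imaginary parts of complex numbers *)

Section complex_parts.
Context {R : realType}.

Lemma normc_le (z : R[i]) : Normc.normc z <= `|complex.Re z| + `|complex.Im z|.
Proof.
case: z => a b /=; rewrite -[leRHS]ger0_norm ?addr_ge0// -sqrtr_sqr ler_sqrt ?sqr_ge0//.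
by rewrite sqrrD !real_normK ?num_real// -addrA lerD2l lerDr mulrn_wge0// mulr_ge0.
Qed.

Lemma normc_ge0 (z : R[i]) : 0 <= Normc.normc z.
Proof. by case: z => a b; exact: sqrtr_ge0. Qed.

Lemma normRe_le (z : R[i]) : `|complex.Re z| <= Normc.normc z.
Proof.
case: z => a b /=; rewrite -sqrtr_sqr ler_sqrt ?addr_ge0 ?sqr_ge0//.
by rewrite lerDl sqr_ge0.
Qed.

Lemma normIm_le (z : R[i]) : `|complex.Im z| <= Normc.normc z.
Proof.
case: z => a b /=; rewrite -sqrtr_sqr ler_sqrt ?addr_ge0 ?sqr_ge0//.
by rewrite lerDr sqr_ge0.
Qed.

Lemma Re_mul (z w : R[i]) : complex.Re (z * w) =
  complex.Re z * complex.Re w - complex.Im z * complex.Im w.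
Proof. by case: z => a b; case: w. Qed.

Lemma Im_mul (z w : R[i]) : complex.Im (z * w) =
  complex.Re z * complex.Im w + complex.Im z * complex.Re w.
Proof. by case: z => a b; case: w. Qed.

Lemma Re_add (z w : R[i]) : complex.Re (z + w) = complex.Re z + complex.Re w.
Proof. by case: z => a b; case: w. Qed.

Lemma Im_add (z w : R[i]) : complex.Im (z + w) = complex.Im z + complex.Im w.
Proof. by case: z => a b; case: w. Qed.

Lemma Re_sub (z w : R[i]) : complex.Re (z - w) = complex.Re z - complex.Re w.
Proof. by case: z => a b; case: w. Qed.

Lemma Im_sub (z w : R[i]) : complex.Im (z - w) = complex.Im z - complex.Im w.
Proof. by case: z => a b; case: w. Qed.

End complex_parts.

(** * The Gaussian as a Schwartz function *)

Section gaussian.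
Context {R : realType}.

(** From [e^(x^2) >= 1 + x^(2i+2) / (i+1)!]: after multiplication by [(i+1)!], the first term
    dominates |x|^i when |x| <= 1 and the second when |x| > 1. *)
Lemma powX_expRN_sqr_bound i (x : R) : `|x| ^+ i * expR (- x ^+ 2) <= i.+1`!%:R.
Proof.
rewrite expRN ler_pdivrMr ?expR_gt0//.
have f1 : 1 <= i.+1`!%:R :> R by rewrite ler1n fact_gt0.
apply: (@le_trans _ _ (i.+1`!%:R * (1 + (x ^+ 2) ^+ i.+1 / i.+1`!%:R))); last first.
  by rewrite ler_wpM2l// expR_ge1Dxn// sqr_ge0.
rewrite mulrDr mulr1 mulrC divfK ?gt_eqF ?(lt_le_trans _ f1)//.
rewrite -[x ^+ 2]real_normK ?num_real// -exprM.
have [x1|/ltW x1] := leP `|x| 1.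
  by rewrite (@le_trans _ _ 1) ?exprn_ile1// (le_trans f1)// lerDl exprn_ge0.
rewrite (@le_trans _ _ (`|x| ^+ (2 * i.+1)))//; last by rewrite lerDr.
by rewrite ler_weXn2l// mul2n -addnn addnS addSn ltnW// ltnS leqW// leq_addr.
Qed.

Lemma horner_expRN_sqr_bound (P : {poly R}) :
  exists C, forall x, `|P.[x] * expR (- x ^+ 2)| <= C.
Proof.
exists (\sum_(i < size P) `|P`_i| * i.+1`!%:R) => x.
rewrite horner_coef mulr_suml (le_trans (ler_norm_sum _ _ _))// ler_sum// => i _.
rewrite -mulrA normrM ler_wpM2l// normrM normrX (ger0_norm (expR_ge0 _)).
exact: powX_expRN_sqr_bound.
Qed.

(** The polynomials are the Hermite polynomials up to sign, produced by the recursion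
    [P' - 2 X P]. *)
Lemma derive1n_gaussian k : exists P : {poly R},
  derive1n k (fun x : R => expR (- x ^+ 2)) = (fun x => P.[x] * expR (- x ^+ 2)).
Proof.
elim: k => [|k [P ih]]; first by exists 1; apply/funext => x; rewrite hornerC mul1r.
exists (P^`() - 2%:R *: ('X * P)); apply/funext => x; rewrite derive1nS ih derive1E.
apply: derive_val.
have dsqr : is_derive x 1 (fun y : R => y ^+ 2) (2 * x).
  by apply: DeriveDef; [exact: exprn_derivable|rewrite exp_derive expr1 /GRing.scale/= mulr1].
have dP : is_derive x 1 (horner P) (P^`()).[x].
  by apply: DeriveDef; [exact: derivable_horner|rewrite -derive1E -derivE].
have := is_derive1_mul dP (is_derive1_expR (is_derive1_opp dsqr)).
by congr is_derive; rewrite hornerD hornerN hornerZ hornerM hornerX; ring.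
Qed.

Lemma derive1n_cst0 k : derive1n k (fun _ : R => 0 : R) = (fun _ => 0).
Proof.
by elim: k => // k ih; rewrite derive1nS ih; apply/funext => y; rewrite derive1_cst.
Qed.

(** An admissible cutoff has to exist for an oscillatory integral to have at most one value. *)
Lemma schwartz_gaussian : schwartz (fun x : R => (expR (- x ^+ 2))%:C).
Proof.
split=> [k x|k l].
  split => /=; last first.
    by rewrite derive1n_cst0; exact: derivable_cst.
  have [P ->] := derive1n_gaussian k.
  have dP : is_derive x 1 (horner P) (P^`()).[x].
    by apply: DeriveDef; [exact: derivable_horner|rewrite -derive1E -derivE].
  have dsqr : is_derive x 1 (fun y : R => y ^+ 2) (2 * x).
    by apply: DeriveDef; [exact: exprn_derivable|rewrite exp_derive expr1 /GRing.scale/= mulr1].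
  by case: (is_derive1_mul dP (is_derive1_expR (is_derive1_opp dsqr))).
have [P hP] := derive1n_gaussian k.
have [C hC] := horner_expRN_sqr_bound ('X^l * P).
exists C => x; rewrite /Cderive/= hP.
rewrite derive1n_cst0 expr0n/= addr0 sqrtr_sqr -normrX -normrM (le_trans _ (hC x))//.
by rewrite hornerM hornerXn mulrA.
Qed.

End gaussian.

(** * Oscillatory integrals *)

Section Os_integral.
Context {R : realType}.
Notation mu := (@lebesgue_measure R).
Variable p : R.
Hypothesis p0 : 0 < p.

Lemma pow1D_bound (L : nat) (x : R) : 0 <= x -> (1 + x) ^+ L <= 2 ^+ L * (1 + x ^+ L).
Proof.
move=> x0; have [x1|/ltW x1] := leP x 1.
  rewrite -[leLHS]mulr1 ler_pM ?exprn_ge0 ?addr_ge0//; last by rewrite lerDl exprn_ge0.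
  by rewrite lerXn2r ?nnegrE ?addr_ge0// lerD2l.
rewrite (@le_trans _ _ (2 ^+ L * x ^+ L))//; last by rewrite ler_wpM2l ?exprn_ge0// lerDr.
rewrite -exprMn lerXn2r ?nnegrE ?addr_ge0 ?mulr_ge0//; lra.
Qed.

(** On x >= 0 the Schwartz bounds with weights 1 and |x|^L combine into decay of order L in [1 + x],
    the form that the expansions take. *)
Lemma schwartz_part_decay (chi : R -> R[i]) (part : R[i] -> R) : schwartz chi ->
  (part = @complex.Re R \/ part = @complex.Im R) ->
  (forall k (x : R), is_derive x 1 (derive1n k (fun y => part (chi y)))
     (derive1n k.+1 (fun y => part (chi y)) x)) /\
  (forall k L : nat, exists M, forall x, 0 <= x ->
     `|derive1n k (fun y => part (chi y)) x| <= M * (1 + x) ^- L).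
Proof.
move=> [dchi bchi] partE; split=> [k x|k L].
  apply: DeriveDef; last by rewrite derive1nS derive1E.
  by case: partE => ->; case: (dchi k x).
have [C0 hC0] := bchi k 0%N; have [CL hCL] := bchi k L.
exists (2 ^+ L * (C0 + CL)) => x x0; rewrite ler_pdivlMr ?exprn_gt0 ?ltr_pwDl//.
have h : `|derive1n k (fun y => part (chi y)) x| <= Normc.normc (Cderive k chi x).
  by case: partE => ->; [exact: (normRe_le (Cderive k chi x))|exact: (normIm_le (Cderive k chi x))].
rewrite (le_trans (ler_wpM2l _ (pow1D_bound L x0)))// mulrCA ler_wpM2l ?exprn_ge0//.
rewrite mulrDr mulr1 lerD//; first by rewrite (le_trans h)// (le_trans _ (hC0 x))// expr0 mul1r.
rewrite (le_trans (ler_wpM2r _ h)) ?exprn_ge0// mulrC.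
by rewrite -{1}(ger0_norm x0).
Qed.

(** A sine is a cosine with phase [- pi / 2], so the complex cutoff integral consists of four real
    ones. Since chi 0 = 1, the two that carry the imaginary part of chi tend to 0. *)
Lemma is_Os_integral_closed_form sg k : sg = 1 \/ sg = -1 ->
  is_Os_integral sg p k.+1%:R (Itilde_closed_form sg p k.+1%:R).
Proof.
move=> sg1 chi schi chi0.
have [dre bre] := schwartz_part_decay schi (or_introl erefl).
have [dim bim] := schwartz_part_decay schi (or_intror erefl).
set re := fun k => derive1n k (fun y => complex.Re (chi y)) in dre bre.
set im := fun k => derive1n k (fun y => complex.Im (chi y)) in dim bim.
pose r : R := k%:R; have r0 : 0 <= r by [].
have kr : k.+1%:R - 1 = r by rewrite -natr1 addrK.
pose I (f : R -> R) b eps := \int[mu]_(x in `]0, +oo[) (f (eps * x) * (x `^ r * cos (b + sg * x `^ p))).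
have re0 : re 0%N 0 = 1 by rewrite /re derive1n0 chi0.
have im0 : im 0%N 0 = 0 by rewrite /im derive1n0 chi0.
have lim (fs : nat -> R -> R) b := @oscillatory_limit R p p0 r sg b fs r0 sg1.
have l1 := lim re 0 dre bre; have l2 := lim im (- (pi / 2)) dim bim.
have l3 := lim im 0 dim bim; have l4 := lim re (- (pi / 2)) dre bre.
rewrite re0 im0 ?mul1r ?mul0r in l1 l2 l3 l4.
pose q := k.+1%:R / p.
have rq : r + 1 = k.+1%:R by rewrite natr1.
have clE : Itilde_closed_form sg p k.+1%:R =
    (moment p (r + 1) 0 (sg * (pi / 2)) - 0) +i* (0 + moment p (r + 1) (- (pi / 2)) (sg * (pi / 2))).
  rewrite /Itilde_closed_form /moment rq subr0 !add0r (addrC (- (pi / 2))) cosBpihalf.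
  by apply/eqP; rewrite eq_complex Re_mul Im_mul Re_mul Im_mul /expi /=; apply/andP; split; apply/eqP; ring.
have cut eps : 0 < eps -> eps <= 1 -> cutoff_integral sg p k.+1%:R chi eps =
   (I (re 0%N) 0 eps - I (im 0%N) (- (pi / 2)) eps) +i* (I (im 0%N) 0 eps + I (re 0%N) (- (pi / 2)) eps).
  (* Here [k + 2 = r + 2], the decay that [wosc_product_integrable] asks for. *)
  move=> e0 e1; pose L := k.+2; have rL : r + 2 <= L%:R by rewrite /L -(natr1 k.+1) -(natr1 k) -/r; lra.
  have int (f : nat -> R -> R) b : (forall k (x : R), is_derive x 1 (f k) (f k.+1 x)) ->
      (forall k L : nat, exists M, forall x, 0 <= x -> `|f k x| <= M * (1 + x) ^- L) ->
      mu.-integrable `]0, +oo[ (EFin \o (fun x => f 0%N (eps * x) * (x `^ r * cos (b + sg * x `^ p)))).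
    move=> df bf; have [M hM] := bf 0%N L.
    have cf : continuous (f 0%N) by move=> x; exact: is_derive_continuous (df 0%N x).
    have cth : 0 <= cos (sg * (pi / 2)) by case: sg1 => ->; rewrite ?mul1r ?mulN1r ?cosN cos_pihalf.
    have := wosc_product_integrable p b r0 cth e0 e1 cf rL hM.
    by congr (integrable _ _ _); apply/funext => x /=; rewrite wosc_pihalf.
  have sinE u : sin u = cos (- (pi / 2) + u) by rewrite addrC cosBpihalf.
  rewrite /cutoff_integral /Cintegral /I -RintegralB ?int// -RintegralD ?int//.
  congr (_ +i* _); apply: eq_Rintegral => x _; rewrite ?(Re_mul, Im_mul) /= kr.
    by rewrite -sinE add0r; ring.
  by rewrite -sinE add0r; ring.
apply: (@squeeze_cvgr _ _ _ _ (cst 0) (fun eps =>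
  `|I (re 0%N) 0 eps - I (im 0%N) (- (pi / 2)) eps - (moment p (r + 1) 0 (sg * (pi / 2)) - 0)| +
  `|I (im 0%N) 0 eps + I (re 0%N) (- (pi / 2)) eps - (0 + moment p (r + 1) (- (pi / 2)) (sg * (pi / 2)))|)).
- near=> eps; apply/andP; split; first exact: normc_ge0.
  rewrite cut ?clE; [|by near: eps; exact: nbhs_right_gt|by near: eps; exact: nbhs_right_le].
  by apply: le_trans (normc_le _) _; rewrite Re_sub Im_sub.
- exact: cvg_cst.
- have norm_lim (f : R -> R) l : f eps @[eps --> 0^'+] --> l -> `|f eps - l| @[eps --> 0^'+] --> (0 : R).
    by move=> /subr_cvg0 /cvg_norm; rewrite normr0.
  rewrite -[X in _ --> X]addr0; apply: cvgD; apply: norm_lim.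
    by apply: cvgB.
  by apply: cvgD.
Unshelve. all: by end_near. Qed.

Lemma is_Os_integral_uniq sg q (z w : R[i]) : is_Os_integral sg p q z ->
  is_Os_integral sg p q w -> z = w.
Proof.
move=> hz hw.
have g1 : (expR (- (0 : R) ^+ 2))%:C = 1 :> R[i] by rewrite expr0n/= oppr0 expR0.
have lz := hz _ schwartz_gaussian g1; have lw := hw _ schwartz_gaussian g1.
set f := cutoff_integral _ _ _ _ in lz lw.
have part_lim (part : R[i] -> R) v : (forall z w, part (z - w) = part z - part w) ->
    (forall z, `|part z| <= Normc.normc z) ->
    Normc.normc (f eps - v) @[eps --> 0^'+] --> (0 : R) ->
    part (f eps) @[eps --> 0^'+] --> part v.
  move=> partB part_le lv; apply/subr_cvg0; apply: norm_cvg0.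
  apply: (@squeeze_cvgr _ _ _ _ (cst 0) _ _ _ _ _ lv); last exact: cvg_cst.
  by near=> eps; rewrite /= normr_ge0/= -partB.
apply/eqP; rewrite eq_complex; apply/andP; split; apply/eqP.
  by apply: (cvg_unique _ (part_lim _ _ Re_sub normRe_le lz) (part_lim _ _ Re_sub normRe_le lw)).
by apply: (cvg_unique _ (part_lim _ _ Im_sub normIm_le lz) (part_lim _ _ Im_sub normIm_le lw)).
Unshelve. all: by end_near. Qed.

Lemma ItildeE sg k : sg = 1 \/ sg = -1 ->
  Itilde sg p k.+1%:R = Itilde_closed_form sg p k.+1%:R.
Proof.
move=> sg1; have h := is_Os_integral_closed_form k sg1.
by apply: xget_unique => // z hz; exact: is_Os_integral_uniq hz h.
Qed.

End Os_integral.

(** * Expansions in powers of lam on the half-line and on the line *)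

Section one_dimensional_expansion.
Context {R : realType}.
Notation mu := (@lebesgue_measure R).
Implicit Types (r s b x y eps B M sg lam e p : R) (f : R -> R) (fs : nat -> R -> R).

(* The constant is uniform in the phase b: this lets b absorb the contribution of
   the other variables when the expansions are iterated. *)
Definition osc_expansion (D : set R) (phi : R -> R) p e (c : nat -> R[i]) :=
  forall (K : nat) B, 0 <= B -> exists2 C, 0 <= C & forall fs M b lam,
  (forall k x, is_derive x 1 (fs k) (fs k.+1 x)) ->
  (forall k x, B < `|x| -> fs k x = 0) ->
  (forall k x, (k <= K)%N -> `|fs k x| <= M) -> 1 <= lam ->
  `|\int[mu]_(x in D) (cos (b + lam * phi x) * fs 0%N x) -
    \sum_(k < K) complex.Re (c k * expi b) * (fs k 0 / k`!%:R) * lam `^ (- (k.+1%:R / p))|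
  <= C * M * lam `^ (- (e * K%:R)).

Lemma compact_support_integrable f M B : 0 <= B ->
  (forall x, 0 < x -> {for x, continuous f}) ->
  (forall x, 0 < x -> `|f x| <= M) -> (forall x, B < x -> f x = 0) ->
  mu.-integrable `]0, +oo[ (EFin \o f).
Proof.
move=> B0 cf fM f0; apply: (@integrable_oy_bound _ f (M * (1 + B) ^+ 2)) => // x x0.
have M0 : 0 <= M by apply: le_trans (fM 1 ltr01).
have x1 : 0 < (1 + x) ^+ 2 by rewrite exprn_gt0// addr_gt0.
have [xB|Bx] := leP x B; last first.
  by rewrite f0// normr0 divr_ge0 ?(ltW x1)// mulr_ge0// sqr_ge0.
rewrite ler_pdivlMr// ler_pM ?fM ?(ltW x1)//.
by rewrite lerXn2r ?nnegrE ?addr_ge0 ?(ltW x0)// lerD2l.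
Qed.

(** The dilation [x = eps y] with [eps = lam^(-1/p)] turns [lam x^p] into [y^p]; the weight has r =
    0. The remainder has exponent [K (1 - growth p)] in eps, that is [K (1 - growth p) / p] in
    [lam^-1], whence the condition on e. *)
Lemma half_line_expansion p sg e : 0 < p -> sg = 1 \/ sg = -1 ->
  e <= (1 - growth p) / p ->
  osc_expansion `]0, +oo[%classic (fun x => sg * x `^ p) p e
    (fun k => Itilde_closed_form sg p k.+1%:R).
Proof.
move=> p0 sg1 ep K B B0; have [C C0 hC] := oscillatory_scaled_expansion p0 K (lexx 0).
pose L := (Num.truncn (0 + K%:R * growth p + 2)).+1.
have KL : 0 + K%:R * growth p + 2 <= L%:R by apply/ltW/truncnS_gt.
exists (C * (1 + B) ^+ L); first by rewrite mulr_ge0 ?exprn_ge0 ?addr_ge0.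
move=> fs M b lam df fB fM lam1; have lam0 : 0 < lam by exact: lt_le_trans lam1.
have M0 : 0 <= M by apply: le_trans (fM 0%N 0 _).
pose eps := lam `^ (- p^-1).
have e0 : 0 < eps by rewrite powR_gt0.
have e1 : eps <= 1 by rewrite -(powRr0 lam) ler_powR// oppr_le0 invr_ge0 ltW.
have epsp : lam * eps `^ p = 1.
  rewrite -powRrM mulNr mulVf ?gt_eqF// powR_inv1 ?(ltW lam0)//.
  by rewrite mulfV ?gt_eqF.
have epsX t : eps `^ t = lam `^ (- (t / p)) by rewrite -powRrM mulNr mulrC.
have cf k : continuous (fs k) by move=> x; exact: is_derive_continuous (df k x).
pose g x := cos (b + lam * (sg * x `^ p)) * fs 0%N x.
have cg x : 0 < x -> {for x, continuous g}.
  move=> x0; apply: continuousM; last exact: cf.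
  exact: is_derive_continuous (is_derive1_cos (is_derive1_add (is_derive_cst b x 1)
    (is_derive1_scale lam (is_derive1_scale sg (is_derive1_powR p x0))))).
have gM x : `|g x| <= M by rewrite normrM -[leRHS]mul1r ler_pM ?cos_max ?fM.
have gB x : B < x -> g x = 0.
  by move=> Bx; rewrite /g fB ?mulr0// (lt_le_trans Bx)// ler_norm.
rewrite (@Rintegral_scale _ eps g)//; last 2 first.
- exact: (compact_support_integrable B0 cg (fun x _ => gM x) gB).
- apply: (@compact_support_integrable _ M (B / eps)).
  + by rewrite divr_ge0 ?(ltW e0).
  + move=> x x0; apply: (@continuous_comp _ _ _ (fun x => eps * x) g).
      by apply: cvgM; [exact: cvg_cst|exact: cvg_id].
    by apply: cg; exact: mulr_gt0.
  + by move=> x _.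
  + by move=> x Bx; apply: gB; rewrite mulrC -ltr_pdivrMr.
(* Compact support becomes decay of order L at the price of a factor [(1 + B)^L]. *)
have fL k x : (k <= K)%N -> 0 <= x -> `|fs k x| <= M * (1 + B) ^+ L * (1 + x) ^- L.
  move=> kK x0; have x1 : 0 < (1 + x) ^+ L by rewrite exprn_gt0// ltr_pwDl.
  have [xB|Bx] := leP x B; last first.
    rewrite fB ?normr0 ?divr_ge0 ?mulr_ge0 ?exprn_ge0 ?addr_ge0//.
    by rewrite (lt_le_trans Bx)// ler_norm.
  rewrite ler_pdivlMr// ler_pM ?fM ?(ltW x1)//.
  by rewrite lerXn2r ?nnegrE ?addr_ge0// lerD2l.
have H := hC L sg b fs eps _ sg1 e0 e1 KL (fun k x _ => df k x) (cf K) fL.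
have -> : \int[mu]_(x in `]0, +oo[) g (eps * x) =
    \int[mu]_(x in `]0, +oo[) (fs 0%N (eps * x) * (x `^ 0 * cos (b + sg * x `^ p))).
  apply: eq_Rintegral => x; rewrite inE/= in_itv/= andbT => x0.
  rewrite /g powRM ?(ltW e0) ?(ltW x0)// powRr0 mul1r mulrC; congr (_ * cos (b + _)).
  by rewrite mulrCA (mulrA lam) epsp mul1r.
have -> : \sum_(k < K) complex.Re (Itilde_closed_form sg p k.+1%:R * expi b) *
     (fs k 0 / k`!%:R) * lam `^ (- (k.+1%:R / p)) =
   eps * \sum_(k < K) eps ^+ k * (fs k 0 / k`!%:R) * moment p (0 + k%:R + 1) b (sg * (pi / 2)).
  rewrite mulr_sumr; apply: eq_bigr => k _.
  rewrite add0r natr1 -epsX powR_mulrn ?(ltW e0)// exprS.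
  rewrite /Itilde_closed_form /moment /expi !Re_mul !Im_mul /= cosD; ring.
rewrite -mulrBr normrM ger0_norm ?(ltW e0)//.
apply: le_trans (ler_wpM2l (ltW e0) H) _.
(* The Jacobian eps of the dilation cancels the [1 / eps] of the remainder. *)
rewrite add0r (_ : eps * _ = C * (1 + B) ^+ L * M * (eps ^+ K * eps `^ (- (K%:R * growth p)))); last first.
  by field; rewrite gt_eqF.
rewrite ler_wpM2l ?mulr_ge0 ?exprn_ge0 ?addr_ge0//.
rewrite -powR_mulrn ?(ltW e0)// -powRD; last by rewrite (gt_eqF e0) implybT.
rewrite epsX ler_powR// lerN2 -[X in X - _]mulr1 -mulrBr mulrC -mulrA.
by rewrite ler_wpM2l.
Qed.

Lemma Rintegral_opp (D : set (measurableTypeR R)) (g : R -> R) : measurable D ->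
  measurable_fun setT g ->
  mu.-integrable (-%R @^-1` D) (EFin \o (fun x => g (- x))) ->
  \int[mu]_(x in D) g x = \int[mu]_(x in -%R @^-1` D) g (- x).
Proof.
move=> mD mg gi; rewrite /Rintegral.
have mopp : measurable_fun setT (-%R : measurableTypeR R -> measurableTypeR R) by [].
have := @integral_pushforward _ _ _ _ R _ mopp mu D (EFin \o g) _ gi mD.
move=> <-; last exact/measurable_EFinP.
by congr fine; apply: eq_measure_integral => A mA _; exact/esym/lebesgue_measureN.
Qed.

(** The negative half-line is reflected; the point 0, which belongs to that closed half, is
    negligible. *)
Lemma Rintegral_line (g : R -> R) : measurable_fun setT g ->
  mu.-integrable `]0, +oo[ (EFin \o g) ->
  mu.-integrable `]0, +oo[ (EFin \o (fun x => g (- x))) ->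
  mu.-integrable setT (EFin \o g) /\
  \int[mu]_x g x = \int[mu]_(x in `]0, +oo[) g x + \int[mu]_(x in `]0, +oo[) g (- x).
Proof.
move=> mg gi gni.
have preE : -%R @^-1` `]-oo, 0]%classic = `[0, +oo[%classic :> set (measurableTypeR R).
  by apply/seteqP; split => x; rewrite /= !in_itv/= ?andbT oppr_le0.
have mopp : measurable_fun setT (-%R : measurableTypeR R -> measurableTypeR R) by [].
have mgN : measurable_fun setT (fun x => g (- x)) by apply: measurableT_comp mg mopp.
have mN : measurable (`]-oo, 0] : set (measurableTypeR R)) by [].
have gni' : mu.-integrable `[0, +oo[ (EFin \o (fun x => g (- x))).
  have /integrableP[_ i1] := gni; apply/integrableP; split.
    by apply/measurable_EFinP; exact: measurable_funTS.
  rewrite -integral_itv_obnd_cbnd//.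
  by apply/measurable_EFinP; apply: measurableT_comp => //; exact: measurable_funTS.
have gNi : mu.-integrable (`]-oo, 0] : set (measurableTypeR R)) (EFin \o g).
  have gni'' : mu.-integrable (-%R @^-1` (`]-oo, 0]%classic : set (measurableTypeR R)))
      ((EFin \o g) \o (-%R : measurableTypeR R -> measurableTypeR R)) by rewrite preE.
  have /measurable_EFinP mg' := mg.
  have /integrableP[m1 i1] := integrable_pushforward mopp mg' gni'' mN.
  apply/integrableP; split => //.
  suff -> : (\int[mu]_(x in `]-oo, 0%R]) `|(EFin \o g) x| =
     \int[pushforward mu (-%R : measurableTypeR R -> measurableTypeR R)]_(x in `]-oo, 0%R]) `|(EFin \o g) x|)%E by [].
  by apply: eq_measure_integral => A mA _; exact/esym/lebesgue_measureN.
have T0 : [set: measurableTypeR R] = `]-oo, 0] `|` `]0, +oo[.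
  apply/seteqP; split => // x _ /=; rewrite !in_itv/= andbT.
  by case: (leP x 0) => h; [left|right].
have d1 : [disjoint `]-oo, (0 : R)]%classic & `]0, +oo[%classic].
  by apply/disj_setPS => x [/=]; rewrite !in_itv/= andbT leNgt => /negP.
have gT : mu.-integrable setT (EFin \o g).
  apply/integrableP; split; first exact/measurable_EFinP.
  have mag : measurable_fun setT (fun x => (`|(EFin \o g) x|)%E).
    by apply: measurableT_comp => //; exact/measurable_EFinP.
  rewrite T0 ge0_integral_setU//=; last by rewrite -T0.
  by apply: lte_add_pinfty; [have /integrableP[] := gNi|have /integrableP[] := gi].
split=> //; rewrite [in LHS]T0 Rintegral_setU//; last by rewrite -T0.
rewrite addrC; congr (_ + _).
rewrite Rintegral_opp//; last by rewrite preE.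
by rewrite preE -Rintegral_itv_obnd_cbnd.
Qed.

(** The reflection [x -> -x] changes sg into [sg * (-1)^m] and multiplies the k-th derivative by
    [(-1)^k]; both halves then fall under [half_line_expansion]. *)
Lemma line_expansion (m : nat) sg e : (0 < m)%N -> sg = 1 \/ sg = -1 ->
  e <= (1 - growth m%:R) / m%:R ->
  osc_expansion setT (fun x => sg * x ^+ m) m%:R e
    (fun k => Itilde_closed_form sg m%:R k.+1%:R +
       (-1) ^+ k * Itilde_closed_form (sg * (-1) ^+ m) m%:R k.+1%:R).
Proof.
move=> m0 sg1 ep K B B0; have p0 : 0 < m%:R :> R by rewrite ltr0n.
have sgm : sg * (-1) ^+ m = 1 \/ sg * (-1) ^+ m = -1.
  by rewrite -signr_odd; case: (odd m); case: sg1 => ->; rewrite ?expr1 ?expr0 ?mulr1 ?mul1r ?mulrNN ?mulr1; [right|left|left|right].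
have [C1 C10 hC1] := half_line_expansion p0 sg1 ep K B0.
have [C2 C20 hC2] := half_line_expansion p0 sgm ep K B0.
exists (C1 + C2); first exact: addr_ge0.
move=> fs M b lam df fB fM lam1.
pose gs k x := (-1) ^+ k * fs k (- x).
have dg k x : is_derive x 1 (gs k) (gs k.+1 x).
  have dopp : is_derive x 1 (fun y : R => - y) (-1) by exact: is_derive1_opp (is_derive_id x 1).
  have := is_derive1_scale ((-1) ^+ k) (@is_derive1_comp _ (fs k) (fun y => - y) x _ _ (df k (- x)) dopp).
  by rewrite /gs exprS; congr is_derive; ring.
have gB k x : B < `|x| -> gs k x = 0 by move=> Bx; rewrite /gs fB ?mulr0// normrN.
have gM k x : (k <= K)%N -> `|gs k x| <= M.
  by move=> kK; rewrite /gs normrM normrX normrN1 expr1n mul1r fM.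
have H1 := hC1 fs M b lam df fB fM lam1; have H2 := hC2 gs M b lam dg gB gM lam1.
pose g x := cos (b + lam * (sg * x ^+ m)) * fs 0%N x.
have cg : continuous g.
  move=> x; apply: continuousM; last exact: is_derive_continuous (df 0%N x).
  have dX : is_derive x 1 (fun y : R => y ^+ m) (m%:R * x ^+ m.-1).
    by apply: DeriveDef; [exact: exprn_derivable|rewrite exp_derive /GRing.scale/= mulr1].
  exact: is_derive_continuous (is_derive1_cos (is_derive1_add (is_derive_cst b x 1)
    (is_derive1_scale lam (is_derive1_scale sg dX)))).
have cgN : continuous (fun x => g (- x)).
  by move=> x; apply: (@continuous_comp _ _ _ (fun x : R => - x) g); [exact: opp_continuous|exact: cg].
have gMM x : `|g x| <= M by rewrite normrM -[leRHS]mul1r ler_pM ?cos_max ?fM.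
have gBB x : B < `|x| -> g x = 0 by move=> Bx; rewrite /g fB ?mulr0.
have [||| _ ->] := @Rintegral_line g.
- exact: continuous_measurable_fun.
- apply: (compact_support_integrable B0) => // x; first by move=> _; exact: cg.
  by move=> Bx; apply: gBB; rewrite (lt_le_trans Bx)// ler_norm.
- apply: (@compact_support_integrable _ M B) => // x; first by move=> _; exact: cgN.
  by move=> Bx; apply: gBB; rewrite normrN (lt_le_trans Bx)// ler_norm.
have -> : \int[mu]_(x in `]0, +oo[) g x = \int[mu]_(x in `]0, +oo[) (cos (b + lam * (sg * x `^ m%:R)) * fs 0%N x).
  by apply: eq_Rintegral => x; rewrite inE/= in_itv/= andbT => x0; rewrite powR_mulrn ?(ltW x0).
have gN x : g (- x) = cos (b + lam * (sg * (-1) ^+ m * x ^+ m)) * gs 0%N x.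
  by rewrite /g /gs expr0 mul1r (exprNn x) -(mulrA sg).
have -> : \int[mu]_(x in `]0, +oo[) g (- x) =
    \int[mu]_(x in `]0, +oo[) (cos (b + lam * (sg * (-1) ^+ m * x `^ m%:R)) * gs 0%N x).
  apply: eq_Rintegral => x; rewrite inE/= in_itv/= andbT => x0; rewrite powR_mulrn ?(ltW x0)//.
under eq_bigr do rewrite mulrDl Re_add 2!mulrDl.
rewrite big_split/= opprD addrACA [X in _ <= X](_ : _ =
   C1 * M * lam `^ (- (e * K%:R)) + C2 * M * lam `^ (- (e * K%:R))); last by ring.
rewrite (le_trans (ler_normD _ _))// lerD//.
apply: le_trans H2; rewrite le_eqVlt; apply/orP; left; apply/eqP.
congr (`|_ - _|); apply: eq_bigr => k _; rewrite /gs oppr0; congr (_ * _).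
have -> : (-1) ^+ k = ((-1) ^+ k)%:C :> R[i] by rewrite rmorphXn rmorphN1.
by rewrite !Re_mul !Im_mul /=; ring.
Qed.

End one_dimensional_expansion.

(** * Integration over tuples *)

Section bounded_support.
Context d (T : measurableType d) (R : realType) (nu : {measure set T -> \bar R}).
Variables (A : set T) (f : T -> R) (M : R).
Hypotheses (mA : measurable A) (Aoo : (nu A < +oo)%E).
Hypotheses (mf : measurable_fun setT f) (fM : forall t, `|f t| <= M).
Hypothesis fA : forall t, ~ A t -> f t = 0.

Let f_restrict : f = f \_ A.
Proof.
apply/funext => t; rewrite patchE; case: ifPn => //.
by rewrite notin_setE => /fA.
Qed.

Lemma integrable_bounded_support : nu.-integrable setT (EFin \o f).
Proof.
have fiA : nu.-integrable A (EFin \o f).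
  apply: measurable_bounded_integrable => //; first exact: measurable_funTS.
  exists M; split; first exact: num_real.
  by move=> x Mx t _ /=; rewrite (le_trans (fM t))// ltW.
by rewrite f_restrict -restrict_EFin; apply/(integrable_mkcond _ mA).1.
Qed.

Lemma norm_Rintegral_support D : measurable D ->
  `|\int[nu]_(t in D) f t| <= M * fine (nu A).
Proof.
move=> mD; have fi := integrable_bounded_support.
have afi := integrable_Rabs measurableT fi.
have afiA := integrableS measurableT mA (@subsetT _ A) afi.
apply: le_trans (le_normr_Rintegral mD (integrableS measurableT mD (@subsetT _ D) fi)) _.
apply: le_trans (@le_Rintegral_subset _ _ _ nu D setT _ mD measurableT afi (@subsetT _ D) _) _.
  by move=> t _; exact: normr_ge0.
have -> : \int[nu]_t `|f t| = \int[nu]_(t in A) `|f t|.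
  rewrite [RHS]Rintegral_mkcond; apply: eq_Rintegral => t _.
  by rewrite patchE; case: ifPn => //; rewrite notin_setE => /fA ->; rewrite normr0.
rewrite -Rintegral_cst//; apply: le_Rintegral => //.
  by apply: measurable_bounded_integrable => //; exact: bounded_cst.
Qed.

End bounded_support.

Section tuples.
Context {R : realType}.
Notation mu := (@lebesgue_measure R).
Notation T := (measurableTypeR R).

Definition box n (D : 'I_n -> set R) : set (n.-tuple T) :=
  [set t | forall j, D j (tnth t j)].

Lemma box_tcons n (D : 'I_n.+1 -> set R) :
  @tcons R n @^-1` box D = (D ord0 : set T) `*` box (fun j => D (lift ord0 j)).
Proof.
apply/seteqP; split => -[x t] /=.
  by move=> Dt; split => [|j]; [exact: (Dt ord0)|have := Dt (lift ord0 j); rewrite tnthS].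
move=> [Dx Dt] j; case: (unliftP ord0 j) => [i ->|->] //.
by rewrite tnthS.
Qed.

Lemma measurable_box n (D : 'I_n -> set R) :
  (forall j, measurable (D j : set T)) -> measurable (box D).
Proof.
move=> mD; rewrite (_ : box D = \bigcap_(j in [set: 'I_n]) (fun t => tnth t j) @^-1` D j); last first.
  by apply/seteqP; split => t h j; [move=> _; exact: h|exact: (h j I)].
apply: fin_bigcap_measurable => // j _.
by rewrite -[X in measurable X]setTI; exact: measurable_tnth.
Qed.

Lemma lebesgue_measure_itvcc_lty (a b : R) : (mu `[a, b] < +oo)%E.
Proof. by rewrite lebesgue_measure_itv/=; case: ifPn => // _; rewrite -EFinD ltry. Qed.

Lemma lebesgue_tuple_box n (B : R) :
  (lebesgue_tuple R n (box (fun=> `[(- B)%R, B]%classic)) < +oo)%E.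
Proof.
elim: n => [|n IHn]; first by rewrite /= diracE; case: (_ \in _); rewrite ltry.
rewrite /= /lebesgue_tupleS /pushforward box_tcons product_measure1E//; last first.
  exact: measurable_box.
have i0 := lebesgue_measure_itvcc_lty (- B) B.
by rewrite lte_mul_pinfty// ge0_fin_numE.
Qed.

(** Fubini, after undoing the pushforward by [tcons]. Integrability of every slice, and not of
    almost every one, makes the real-valued inner integral agree with the extended one at all x. *)
Lemma Rintegral_tupleS n (G : n.+1.-tuple T -> R) :
  (lebesgue_tuple R n.+1).-integrable setT (EFin \o G) ->
  (forall x, (lebesgue_tuple R n).-integrable setT (EFin \o (fun t => G (tcons (x, t))))) ->
  mu.-integrable setT (EFin \o (fun x => \int[lebesgue_tuple R n]_t G (tcons (x, t)))) /\
  \int[lebesgue_tuple R n.+1]_t G t =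
  \int[mu]_x \int[lebesgue_tuple R n]_t G (tcons (x, t)).
Proof.
move=> Gi Gxi; have /integrableP[mG _] := Gi.
have mGc : measurable_fun setT ((EFin \o G) \o @tcons R n).
  by apply: measurableT_comp mG _; exact: measurable_tcons.
have Gci : (mu \x lebesgue_tuple R n)%E.-integrable setT ((EFin \o G) \o @tcons R n).
  apply/integrableP; split => //; have /integrableP[_] := Gi.
  rewrite /= /lebesgue_tupleS ge0_integral_pushforward//; first exact: measurable_tcons.
  by apply/measurable_EFinP; apply: measurableT_comp => //; exact/measurable_EFinP.
have FE x : fubini_F (lebesgue_tuple R n) ((EFin \o G) \o @tcons R n) x =
    (\int[lebesgue_tuple R n]_t G (tcons (x, t)))%:E.
  by rewrite /fubini_F /Rintegral fineK// integrable_fin_num//; exact: Gxi.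
split.
  have := integrable_fubini_F Gci.
  by congr (integrable _ _ _); apply/funext => x; rewrite FE.
rewrite {1}/Rintegral [X in fine X](_ : _ = \int[mu \x lebesgue_tuple R n]_z ((EFin \o G) \o @tcons R n) z)%E.
  rewrite -integral12_prod_meas1// /Rintegral; congr fine.
  by apply: eq_integral => x _; rewrite FE.
by rewrite /= /lebesgue_tupleS integral_pushforward//; exact: measurable_tcons.
Qed.

(** G is replaced by 0 outside the box of the [D j]. Boundedness and support in a cube of finite
    measure provide both integrability hypotheses of [Rintegral_tupleS]. *)
Lemma Rintegral_box_tupleS n (D : 'I_n.+1 -> set R) (G : n.+1.-tuple T -> R) M B :
  (forall j, measurable (D j : set T)) -> measurable_fun setT G ->
  (forall t, `|G t| <= M) ->
  (forall t, ~ box (fun=> `[(- B), B]%classic) t -> G t = 0) ->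
  mu.-integrable (D ord0) (EFin \o (fun x =>
    \int[lebesgue_tuple R n]_(t in box (fun j => D (lift ord0 j))) G (tcons (x, t)))) /\
  \int[lebesgue_tuple R n.+1]_(t in box D) G t = \int[mu]_(x in D ord0)
    \int[lebesgue_tuple R n]_(t in box (fun j => D (lift ord0 j))) G (tcons (x, t)).
Proof.
move=> mD mG GM GB; have M0 : 0 <= M by apply: le_trans (GM [tuple of nseq n.+1 0]).
pose G1 := G \_ (box D); have mbD := measurable_box mD.
have mG1 : measurable_fun setT G1 by apply/(measurable_restrictT _ mbD); exact: measurable_funTS.
have G1M t : `|G1 t| <= M by rewrite /G1 patchE; case: ifPn; rewrite ?normr0.
have G1B t : ~ box (fun=> `[(- B), B]%classic) t -> G1 t = 0.
  by move=> Bt; rewrite /G1 patchE GB ?if_same.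
have mB k : measurable (box (fun=> `[(- B), B]%classic) : set (k.-tuple T)).
  exact: measurable_box.
have Gi := integrable_bounded_support (mB n.+1) (lebesgue_tuple_box n.+1 B) mG1 G1M G1B.
have Gxi x : (lebesgue_tuple R n).-integrable setT (EFin \o (fun t => G1 (tcons (x, t)))).
  apply: (integrable_bounded_support (mB n) (lebesgue_tuple_box n B) (M := M)) => //.
    apply: (measurableT_comp mG1); apply: (measurableT_comp (@measurable_tcons R n)).
    exact: pair1_measurable.
  move=> t Bt; apply: G1B => Bxt; apply: Bt => j.
  by have := Bxt (lift ord0 j); rewrite tnthS.
pose inner x := \int[lebesgue_tuple R n]_(t in box (fun j => D (lift ord0 j))) G (tcons (x, t)).
have innerE : (fun x => \int[lebesgue_tuple R n]_t G1 (tcons (x, t))) = inner \_ (D ord0).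
  apply/funext => x; rewrite patchE.
  have boxE t : (tcons (x, t) \in box D) = (x \in D ord0) && (t \in box (fun j => D (lift ord0 j))).
    have := box_tcons D => /seteqP[i1 i2].
    apply/idP/andP => [|[]]; rewrite !inE; first by move=> /(i1 (x, t))[].
    by move=> ? ?; exact: (i2 (x, t)).
  case: ifPn => Dx.
    rewrite /inner [RHS]Rintegral_mkcond; apply: eq_Rintegral => t _.
    by rewrite /G1 !patchE boxE Dx.
  rewrite (_ : (fun t => _) = cst 0); first by rewrite Rintegral_cst// mul0r.
  by apply/funext => t; rewrite /G1 patchE boxE (negbTE Dx).
have [] := Rintegral_tupleS Gi Gxi; rewrite innerE => ii ie; split.
  by apply/(integrable_mkcond _ (mD ord0)); rewrite restrict_EFin.
by rewrite Rintegral_mkcond ie [RHS]Rintegral_mkcond.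
Qed.

Lemma big_ffun_ordS n K (V : nmodType) (H : {ffun 'I_n.+1 -> 'I_K} -> V) :
  \sum_al H al = \sum_(k < K) \sum_(al : {ffun 'I_n -> 'I_K})
    H [ffun j => oapp al k (unlift ord0 j)].
Proof.
rewrite pair_big/= (reindex (fun x : 'I_K * {ffun 'I_n -> 'I_K} =>
  [ffun j => oapp x.2 x.1 (unlift ord0 j)]))//=.
exists (fun al => (al ord0, [ffun j => al (lift ord0 j)])) => [[k al]|al] _ /=.
  rewrite ffunE unlift_none; congr pair; apply/ffunP => j.
  by rewrite !ffunE liftK.
by apply/ffunP => j; rewrite ffunE; case: (unliftP ord0 j) => [i|] ->; rewrite /= ?ffunE.
Qed.

Lemma Rintegral_sum d (X : measurableType d) (nu : {measure set X -> \bar R})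
    (D : set X) (I : Type) (s : seq I) (f : I -> X -> R) : measurable D ->
  (forall i, nu.-integrable D (EFin \o f i)) ->
  nu.-integrable D (EFin \o (fun x => \sum_(i <- s) f i x)) /\
  \int[nu]_(x in D) (\sum_(i <- s) f i x) = \sum_(i <- s) \int[nu]_(x in D) f i x.
Proof.
move=> mD fi; elim: s => [|i s [IHi IH]].
  rewrite big_nil; under [X in EFin \o X]eq_fun do rewrite big_nil.
  split; first exact: integrable0.
  under eq_Rintegral do rewrite big_nil.
  by rewrite Rintegral_cst// mul0r.
have E : (fun x => \sum_(i <- i :: s) f i x) = (fun x => f i x + \sum_(i <- s) f i x).
  by apply/funext => x; rewrite big_cons.
by rewrite E big_cons RintegralD// IH; split => //; exact: integrable_RD.
Qed.

End tuples.

(** * Expansion in several variables *)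

Section multidimensional_expansion.
Context {R : realType}.
Notation mu := (@lebesgue_measure R).
Notation T := (measurableTypeR R).
Implicit Types (x b lam p e M B : R) (phi : R -> R).

(* F al stands for the partial derivative d_0^(al_0) (d_1^(al_1) ...) of F 0.
   Derivation in a variable is only asked when all earlier orders vanish, so
   that the symmetry of partial derivatives is never needed. *)
Fixpoint jet n (F : seq nat -> seq R -> R) : Prop :=
  if n is m.+1 then
    (forall i al x t, size al = m -> size t = m ->
      is_derive x 1 (fun y => F (i :: al) (y :: t)) (F (i.+1 :: al) (x :: t))) /\
    forall x, jet m (fun al t => F (0%N :: al) (x :: t))
  else True.

(** All variables share the order K and the rate e, and the indices run over the full cube of side
    K; the index set of the theorem is cut out of it at the very end. F enters the bound only
    through M, and b not at all, so the estimate applies uniformly to the slices of F in the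
    induction on n. *)
Definition multi_osc_expansion n (D : 'I_n -> set R) (phi : 'I_n -> R -> R)
    (p : 'I_n -> R) e (c : 'I_n -> nat -> R[i]) :=
  forall (K : nat) B, 0 <= B -> exists2 C, 0 <= C & forall F M b lam,
  jet n F ->
  measurable_fun setT (fun t : n.-tuple T => F (nseq n 0%N) t) ->
  (forall al t, size al = n -> size t = n -> has (fun x => B < `|x|) t -> F al t = 0) ->
  (forall al t, size al = n -> size t = n -> all (leq^~ K) al -> `|F al t| <= M) ->
  1 <= lam ->
  `|\int[lebesgue_tuple R n]_(t in box D)
      (cos (b + lam * \sum_j phi j (tnth t j)) * F (nseq n 0%N) t) -
    \sum_(al : {ffun 'I_n -> 'I_K})
      complex.Re ((\prod_j c j (al j)) * expi b) *
      (F [seq (al j : nat) | j <- enum 'I_n] (nseq n 0) / (\prod_j (al j)`!)%:R) *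
      lam `^ (- \sum_j (al j).+1%:R / p j)|
  <= C * M * lam `^ (- (e * K%:R)).

Lemma measurable_phase n (phi : 'I_n -> R -> R) b lam :
  (forall j, measurable_fun setT (phi j : T -> R)) ->
  measurable_fun setT (fun t : n.-tuple T => cos (b + lam * \sum_j phi j (tnth t j))).
Proof.
move=> mphi; apply: measurableT_comp; first exact: continuous_measurable_fun (@continuous_cos R).
apply: measurable_funD => //; apply: measurable_funM => //.
apply: measurable_sum => j; apply: measurableT_comp => //.
exact: measurable_tnth.
Qed.

(** The measure on the empty tuple is a Dirac mass and there is one multi-index, so both sides equal
    [cos b * F [::] [::]] and the remainder is 0. *)
Lemma multi_osc_expansion0 (D : 'I_0 -> set R) (phi : 'I_0 -> R -> R)
  (p : 'I_0 -> R) e (c : 'I_0 -> nat -> R[i]) : multi_osc_expansion D phi p e c.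
Proof.
move=> K B B0; exists 0 => // F M b lam _ mF _ _ lam1.
have -> : box D = setT by apply/seteqP; split => // t _ [].
rewrite (big_pred1 (ffun0 (card_ord 0))) => [|al]; last first.
  by apply/esym/eqP/ffunP => -[].
rewrite !big_ord0 /Rintegral integral_dirac//=; last first.
  by apply/measurable_EFinP; apply: measurable_funM => //; apply: measurable_phase => -[].
rewrite indicE in_setT mul1r big_ord0 enum_ord0 /= mulr0 addr0 mul1r mul0r subr0 divr1 oppr0.
by rewrite powRr0 mulr1 subrr normr0 !mul0r.
Qed.

Lemma Re_mul_expi (z : R[i]) b :
  complex.Re (z * expi b) = complex.Re z * cos b - complex.Im z * cos (b - pi / 2).
Proof. by rewrite Re_mul /expi /= cosBpihalf. Qed.

(** The complex coefficient w is absorbed by two real expansions, with phases b and [b - pi / 2],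
    since that shift multiplies by -i. *)
Lemma Re_mul2_expi (z w : R[i]) b : complex.Re (z * w * expi b) =
  complex.Re w * complex.Re (z * expi b) - complex.Im w * complex.Re (z * expi (b - pi / 2)).
Proof. by rewrite !Re_mul !Im_mul /expi /= cosBpihalf sinBpihalf; ring. Qed.

(** At a fixed first coordinate x, the hypothesis in n variables applies with phase
    [b + lam * phi ord0 x]. Its main terms are again cosines times functions of x alone, to which
    the expansion in one variable applies. *)
Lemma multi_osc_expansionS n (D : 'I_n.+1 -> set R) (phi : 'I_n.+1 -> R -> R)
    (p : 'I_n.+1 -> R) e (c : 'I_n.+1 -> nat -> R[i]) :
  (forall j, measurable (D j : set T)) ->
  (forall j, measurable_fun setT (phi j : T -> R)) ->
  (forall j, 0 < p j) ->
  osc_expansion (D ord0) (phi ord0) (p ord0) e (c ord0) ->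
  multi_osc_expansion (fun j => D (lift ord0 j)) (fun j => phi (lift ord0 j))
    (fun j => p (lift ord0 j)) e (fun j => c (lift ord0 j)) ->
  multi_osc_expansion D phi p e c.
Proof.
move=> mD mphi p0 E1 En K B B0.
have [C1 C10 h1] := E1 K B B0; have [C2 C20 h2] := En K B B0.
pose w (al : {ffun 'I_n -> 'I_K}) := \prod_j c (lift ord0 j) (al j).
pose W := \sum_al (`|complex.Re (w al)| + `|complex.Im (w al)|).
have W0 : 0 <= W by apply: sumr_ge0 => al _; rewrite addr_ge0.
(* The inner error is uniform in x and is integrated over [[-B, B]], of length 2B; the outer errors
   are weighted by coefficients whose sum is at most [W]. *)
exists (C2 * (B *+ 2) + C1 * W).
  by rewrite addr_ge0 ?mulr_ge0 ?mulrn_wge0.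
move=> F M b lam [dF jF] mF FB FM lam1.
have lam0 : 0 < lam by exact: lt_le_trans lam1.
set rho := lam `^ _; have rho0 : 0 <= rho by exact: powR_ge0.
pose zs := nseq n (0 : R); pose ks (al : {ffun 'I_n -> 'I_K}) := [seq (al j : nat) | j <- enum 'I_n].
have size_ks al : size (ks al) = n by rewrite size_map size_enum_ord.
have size_zs : size zs = n by rewrite size_nseq.
have M0 : 0 <= M.
  by apply: le_trans (FM (nseq n.+1 0%N) (nseq n.+1 0) _ _ _); rewrite ?size_nseq// all_nseq orbT.
pose q (al : {ffun 'I_n -> 'I_K}) := \sum_j (al j).+1%:R / p (lift ord0 j).
pose A al := lam `^ (- q al) / (\prod_j (al j)`!)%:R.
have A0 al : 0 <= A al by rewrite divr_ge0 ?powR_ge0.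
have A1 al : A al <= 1.
  rewrite ler_pdivrMr ?mul1r; last by rewrite ltr0n prodn_gt0// => j; exact: fact_gt0.
  apply: (@le_trans _ _ 1).
    rewrite -(powRr0 lam) ler_powR// oppr_le0 sumr_ge0// => j _.
    by rewrite divr_ge0// (ltW (p0 _)).
  by rewrite ler1n prodn_gt0// => j; exact: fact_gt0.
pose G (t : n.+1.-tuple T) := cos (b + lam * \sum_j phi j (tnth t j)) * F (nseq n.+1 0%N) t.
pose f al k x := F (k :: ks al) (x :: zs).
have df al k x : is_derive x 1 (f al k) (f al k.+1 x) by exact: dF.
have fB al k x : B < `|x| -> f al k x = 0.
  by move=> Bx; apply: FB; rewrite /= ?size_ks ?size_zs// Bx.
have fM al k x : (k <= K)%N -> `|f al k x| <= M.
  move=> kK; apply: FM; rewrite /= ?size_ks ?size_zs// kK/=.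
  by apply/allP => i /mapP[j _ ->]; exact: ltnW.
pose g al b' x := cos (b' + lam * phi ord0 x) * f al 0%N x.
have gi al b' : mu.-integrable (D ord0) (EFin \o g al b').
  have mI : measurable (`[- B, B]%classic : set T) by [].
  apply: (integrableS measurableT (mD ord0) (@subsetT _ _)).
  apply: (integrable_bounded_support mI (lebesgue_measure_itvcc_lty (- B) B) (M := M)).
  - apply: measurable_funM.
      apply: measurableT_comp; first exact: continuous_measurable_fun (@continuous_cos R).
      by apply: measurable_funD => //; exact: measurable_funM.
    by apply: continuous_measurable_fun => x; exact: is_derive_continuous (df al 0%N x).
  - by move=> x; rewrite normrM -[leRHS]mul1r ler_pM ?cos_max ?fM.
  - move=> x /= Ix; rewrite /g fB ?mulr0// ltNge; apply/negP => xB; apply: Ix.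
    by rewrite in_itv/= -ler_norml.
pose inner x := \int[lebesgue_tuple R n]_(t in box (fun j => D (lift ord0 j))) G (tcons (x, t)).
pose S x := \sum_al A al * (complex.Re (w al) * g al b x - complex.Im (w al) * g al (b - pi / 2) x).
pose J al b' := \int[mu]_(x in D ord0) g al b' x.
have mG : measurable_fun setT G by apply: measurable_funM => //; exact: measurable_phase.
have GM t : `|G t| <= M.
  rewrite normrM -[leRHS]mul1r ler_pM ?cos_max// FM ?size_nseq ?size_tuple//.
  by rewrite all_nseq orbT.
have GB t : ~ box (fun=> `[- B, B]%classic) t -> G t = 0.
  move=> tB; rewrite /G FB ?mulr0 ?size_nseq ?size_tuple//.
  apply: contra_notT tB => /hasPn tB j /=.
  by rewrite in_itv/= -ler_norml leNgt; apply: tB; exact: mem_tnth.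
have [inneri innerE] := Rintegral_box_tupleS mD mG GM GB.
rewrite innerE -/inner big_ffun_ordS.
have innerS x : `|inner x - S x| <= C2 * M * rho.
  have := h2 (fun al t => F (0%N :: al) (x :: t)) M (b + lam * phi ord0 x) lam (jF x).
  have mFx : measurable_fun setT (fun t : n.-tuple T => F (nseq n.+1 0%N) (tcons (x, t))).
    apply: (measurableT_comp mF); apply: (measurableT_comp (@measurable_tcons R n)).
    exact: pair1_measurable.
  move=> /(_ mFx) H.
  have FBx al t : size al = n -> size t = n -> has (fun x => B < `|x|) t -> F (0%N :: al) (x :: t) = 0.
    by move=> sal st hB; apply: FB; rewrite /= ?sal ?st// hB orbT.
  have FMx al t : size al = n -> size t = n -> all (leq^~ K) al -> `|F (0%N :: al) (x :: t)| <= M.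
    by move=> sal st hK; apply: FM; rewrite /= ?sal ?st.
  apply: le_trans (H FBx FMx lam1); rewrite le_eqVlt; apply/orP; left; apply/eqP; congr (`|_ - _|).
    apply: eq_Rintegral => t _; rewrite /G big_ord_recl mulrDr addrA.
    congr (cos (_ + _ + lam * _) * _).
    by apply: eq_bigr => j _; rewrite tnthS.
  apply: eq_bigr => al _; rewrite Re_mul_expi /A /g /f (addrAC b) -/(ks al) -/zs -/(q al); ring.
have gRi al : mu.-integrable (D ord0) (EFin \o (fun x =>
    complex.Re (w al) * g al b x - complex.Im (w al) * g al (b - pi / 2) x)).
  have := integrable_RD (mD ord0) (integrable_RZ (complex.Re (w al)) (mD ord0) (gi al b))
    (integrable_RZ (- complex.Im (w al)) (mD ord0) (gi al (b - pi / 2))).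
  by congr (integrable _ _ _); apply/funext => x /=; rewrite mulNr.
have [SI SE] : mu.-integrable (D ord0) (EFin \o S) /\ \int[mu]_(x in D ord0) S x =
    \sum_al A al * (complex.Re (w al) * J al b - complex.Im (w al) * J al (b - pi / 2)).
  have [i1 i2] := Rintegral_sum (index_enum _) (mD ord0) (fun al => integrable_RZ (A al) (mD ord0) (gRi al)).
  split; first exact: i1.
  rewrite [LHS]i2; apply: eq_bigr => al _; rewrite RintegralZl//; congr (_ * _).
  by rewrite RintegralB ?RintegralZl//; apply: integrable_RZ.
(* The difference splits into the integrated error of the inner expansion and the errors of the
   outer ones. *)
rewrite (_ : _ - _ = \int[mu]_(x in D ord0) (inner x - S x) + (\int[mu]_(x in D ord0) S x -
    \sum_(k < K) \sum_(al : {ffun 'I_n -> 'I_K}) A al *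
    (complex.Re (w al) * (complex.Re (c ord0 k * expi b) * (f al k 0 / k`!%:R) * lam `^ (- (k.+1%:R / p ord0)))
    - complex.Im (w al) * (complex.Re (c ord0 k * expi (b - pi / 2)) * (f al k 0 / k`!%:R) * lam `^ (- (k.+1%:R / p ord0)))))); last first.
  rewrite (RintegralB (mD ord0) inneri SI) addrA subrK; congr (_ - _).
  apply: eq_bigr => k _; apply: eq_bigr => al _.
  rewrite enum_ordSl/= !big_ord_recl ffunE unlift_none/= -map_comp.
  rewrite (eq_map (g := fun j => al j : nat)); last by move=> j; rewrite /= ffunE liftK.
  rewrite (eq_bigr (fun j => c (lift ord0 j) (al j))); last by move=> j _; rewrite ffunE liftK.
  rewrite (eq_bigr (fun j => (al j)`!)); last by move=> j _; rewrite ffunE liftK.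
  rewrite (eq_bigr (fun j => (al j).+1%:R / p (lift ord0 j))); last by move=> j _; rewrite ffunE liftK.
  rewrite opprD powRD; last by rewrite (gt_eqF lam0) implybT.
  rewrite natrM invfM Re_mul2_expi -/(w al) /A /f -/(ks al) -/zs -/(q al); ring.
apply: le_trans (ler_normD _ _) _.
rewrite [X in _ <= X](_ : _ = C2 * (B *+ 2) * (M * rho) + C1 * W * (M * rho)); last by ring.
apply: lerD.
  have /(integrable_mkcond _ (mD ord0)).1 := integrable_RD (mD ord0) inneri (integrable_RZ (-1) (mD ord0) SI).
  rewrite restrict_EFin => /integrableP[/measurable_EFinP mh _].
  rewrite Rintegral_mkcond.
  have mI : measurable (`[- B, B]%classic : set T) by [].
  have -> : C2 * (B *+ 2) * (M * rho) = C2 * M * rho * fine (mu `[(- B)%R, B]).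
    rewrite lebesgue_measure_itv/= lte_fin.
    (* If [-B < B] fails then B = 0, and both sides are 0. *)
    by case: ltP => BB /=; [rewrite opprK mulr2n|have -> : B = 0 by lra]; ring.
  apply: (norm_Rintegral_support mI (lebesgue_measure_itvcc_lty (- B) B) _ _ _ measurableT).
  - by move: mh; congr measurable_fun; apply/funext => x; rewrite !patchE mulN1r.
  - move=> x; rewrite patchE; case: ifPn => // _; rewrite normr0.
    by rewrite !mulr_ge0.
  - move=> x /= Ix; rewrite patchE; case: ifPn => // _.
    have Bx : B < `|x|.
      by rewrite ltNge; apply/negP => xB; apply: Ix; rewrite in_itv/= -ler_norml.
    rewrite /inner /S big1 => [|al _]; last by rewrite /g fB// !mulr0 subrr mulr0.
    rewrite subr0 (_ : (fun t => _) = cst 0); first by rewrite Rintegral_cst ?mul0r//; exact: measurable_box.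
    by apply/funext => t; rewrite /G FB ?mulr0 ?size_nseq ?size_tuple//= Bx.
rewrite SE exchange_big -sumrB/= mulr_sumr mulr_suml.
apply: le_trans (ler_norm_sum _ _ _) _; apply: ler_sum => al _.
rewrite -mulr_sumr -mulrBr normrM ger0_norm// -[leRHS]mul1r ler_pM//.
have H b' := h1 (f al) M b' lam (df al) (fB al) (fM al) lam1.
have E (u v j1 j2 s1 s2 : R) : u * j1 - v * j2 - (u * s1 - v * s2) = u * (j1 - s1) - v * (j2 - s2).
  by ring.
rewrite sumrB -!mulr_sumr E.
apply: le_trans (ler_normB _ _) _; rewrite !normrM mulrDr mulrDl lerD//.
  by rewrite (mulrC C1) -mulrA ler_wpM2l// mulrA; exact: H.
by rewrite (mulrC C1) -mulrA ler_wpM2l// mulrA; exact: H.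
Qed.

Lemma multi_osc_expansionP n (D : 'I_n -> set R) (phi : 'I_n -> R -> R)
    (p : 'I_n -> R) e (c : 'I_n -> nat -> R[i]) :
  (forall j, measurable (D j : set T)) ->
  (forall j, measurable_fun setT (phi j : T -> R)) ->
  (forall j, 0 < p j) ->
  (forall j, osc_expansion (D j) (phi j) (p j) e (c j)) ->
  multi_osc_expansion D phi p e c.
Proof.
elim: n D phi p c => [|n IHn] D phi p c mD mphi p0 E1; first exact: multi_osc_expansion0.
by apply: multi_osc_expansionS => //; apply: IHn.
Qed.

End multidimensional_expansion.

(** * Mixed partial derivatives of the amplitude as jets *)

Section smooth_jets.
Context {R : realType} (n : nat).
Notation T := (measurableTypeR R).
Implicit Types (a : 'rV[R]_n -> R[i]) (x B M : R).

(** The sigma-algebra on tuples is the product one, whereas continuity refers to the topology of row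
    vectors. An open set is the union of those of the countably many cubes with rational centre and
    half-width [1 / (k + 1)] that it contains. *)
Lemma measurable_continuous_vec (f : 'rV[R]_n -> R) : continuous f ->
  measurable_fun setT (fun t : n.-tuple T => f (vec t)).
Proof.
move=> /continuousP cf; apply: (measurability _ (RGenOpens.measurableE R)).
move=> _ [_ [u [v ->] <-]]; rewrite setTI.
pose U := f @^-1` `]u, v[; have oU : open U by apply: cf; exact: interval_open.
pose cube (q : {ffun 'I_n -> rat} * nat) : set (n.-tuple T) :=
  box (fun j => `](ratr (q.1 j) - q.2.+1%:R^-1)%R, (ratr (q.1 j) + q.2.+1%:R^-1)%R[%classic).
have mcube q : measurable (cube q) by exact: measurable_box.
rewrite [X in measurable X](_ : _ = \bigcup_(q in [set q | cube q `<=` (fun t => U (vec t))]) cube q).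
  rewrite bigcup_mkcond; apply: countable_bigcupT_measurable => // q.
  by case: ifPn.
apply/seteqP; split => [t Ut|t [q qU] /qU]//.
have /nbhs_ballP[e /= e0 eU] : nbhs (vec t) U by apply: open_nbhs_nbhs.
(* Half of e, because t and any point of the cube are each within [1 / (k + 1)] of the centre. *)
have [k k_lt] : exists k : nat, k.+1%:R^-1 < e / 2.
  have e20 : 0 < e / 2 by rewrite divr_gt0.
  by have [N _ /(_ N (leqnn N))] := near_infty_natSinv_lt (PosNum e20); exists N.
have /choice[q tq] j : exists q : rat, `|tnth t j - ratr q| < k.+1%:R^-1.
  have /rat_in_itvoo[q] : tnth t j - k.+1%:R^-1 < tnth t j + k.+1%:R^-1.
    by rewrite ltrD2l gtrN// invr_gt0.
  by rewrite in_itv/= => hq; exists q; rewrite ltr_distlC.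
exists ([ffun j => q j], k) => [t' t'q|j] /=.
  apply: eU; split => // i j; rewrite !mxE -ball_normE /=.
  have := t'q j; rewrite /= ffunE in_itv/= -ltr_distlC => tq'.
  apply: le_lt_trans (ler_distD (ratr (q j)) _ _) _.
  by rewrite [ltRHS]splitr ltrD// (lt_trans _ k_lt).
by rewrite ffunE in_itv/= -ltr_distl.
Qed.

(** Lists rather than tuples, so that a prefix of frozen coordinates can be concatenated; missing
    entries count as 0. *)
Definition rowv (t : seq R) : 'rV[R]_n := \row_i nth 0 t i.

Lemma rowv_tuple (t : n.-tuple T) : rowv t = vec t.
Proof. by apply/rowP => j; rewrite !mxE (tnth_nth 0). Qed.

(** The difference quotients in the coordinate and in the direction [delta_mx 0 j] are the same
    function of h. *)
Lemma is_derive_coordinate (g : 'rV[R]_n -> R) (j : 'I_n) xs t x : size xs = j ->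
  derivable g (rowv (xs ++ x :: t)) (delta_mx 0 j) ->
  is_derive x 1 (fun y => g (rowv (xs ++ y :: t)))
    ('D_(delta_mx 0 j) g (rowv (xs ++ x :: t))).
Proof.
move=> sxs dg.
have rowvD h : rowv (xs ++ (h *: (1 : R) + x) :: t) = h *: delta_mx 0 j + rowv (xs ++ x :: t).
  apply/rowP => i; rewrite !mxE eqxx !nth_cat sxs /= -val_eqE /=.
  case: ltngtP => ij; rewrite ?mulr0 ?add0r//.
    by rewrite -(subnSK ij).
  by rewrite ij subnn.
have E : (fun h => h^-1 *: (((fun y => g (rowv (xs ++ y :: t))) \o shift x) (h *: (1 : R)) -
     g (rowv (xs ++ x :: t)))) =
   (fun h => h^-1 *: ((g \o shift (rowv (xs ++ x :: t))) (h *: delta_mx 0 j) - g (rowv (xs ++ x :: t)))).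
  by apply/funext => h /=; rewrite rowvD.
by apply: DeriveDef; rewrite /derivable /derive E.
Qed.

(** Orders are listed by variable, with the derivatives in the first variable outermost, as [jet]
    requires; variables beyond the end of the list are not differentiated. *)
Definition mixed_partial (al : seq nat) a : 'rV[R]_n -> R[i] :=
  foldr (fun jk b => iter jk.2 (partial jk.1) b) a (zip (enum 'I_n) al).

Lemma multi_partialE (al : {ffun 'I_n -> nat}) a :
  multi_partial al a = mixed_partial [seq al j | j <- enum 'I_n] a.
Proof.
rewrite /multi_partial /mixed_partial.
by elim: (enum 'I_n) => //= j s ->.
Qed.

Lemma foldr_iter0 (X : Type) (f : 'I_n -> X -> X) l m (b : X) :
  foldr (fun jk b => iter jk.2 (f jk.1) b) b (zip l (nseq m 0%N)) = b.
Proof. by elim: l m => [|u s IH] [|m] /=. Qed.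

(** When all earlier orders are 0, the derivatives in variable j are outermost, so that one more of
    them requires no interchange. *)
Lemma mixed_partialS (j : 'I_n) k al a :
  mixed_partial (nseq j 0%N ++ k.+1 :: al) a =
  partial j (mixed_partial (nseq j 0%N ++ k :: al) a).
Proof.
have E i : mixed_partial (nseq j 0%N ++ i :: al) a =
    iter i (partial j) (foldr (fun jk b => iter jk.2 (partial jk.1) b) a
      (zip (drop j.+1 (enum 'I_n)) al)).
  have sj : (j < size (enum 'I_n))%N by rewrite size_enum_ord.
  rewrite /mixed_partial -{1}(cat_take_drop j (enum 'I_n)) zip_cat; last first.
    by rewrite size_nseq size_take sj.
  by rewrite foldr_cat (drop_nth j)//= nth_ord_enum foldr_iter0.
by rewrite !E.
Qed.

(** Brings the derivative to the form in which [smooth] and [foldr_partial_support] are stated. *)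
Lemma mixed_partial_foldr al a : exists s, mixed_partial al a = foldr (@partial R n) a s.
Proof.
rewrite /mixed_partial; elim: (zip _ _) => [|[j k] l [s /= ->]]; first by exists [::].
by exists (nseq k j ++ s); rewrite foldr_cat; elim: k => //= k ->.
Qed.

Lemma jet_mixed_partial a (part : R[i] -> R) : smooth a ->
  part = @complex.Re R \/ part = @complex.Im R ->
  jet n (fun al t => part (mixed_partial al a (rowv t))).
Proof.
move=> sa partP.
(* The list xs holds the coordinates already frozen, all with order 0. *)
suff H m xs : (size xs + m)%N = n -> jet m (fun al t =>
    part (mixed_partial (nseq (size xs) 0%N ++ al) a (rowv (xs ++ t)))).
  exact: (H n [::]).
elim: m xs => [//|m IH] xs sxm; split => [i al x t sal st|x].
  have jn : (size xs < n)%N by rewrite -sxm addnS ltnS leq_addr.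
  pose j := Ordinal jn; have -> : size xs = j by [].
  rewrite mixed_partialS; set b := mixed_partial _ _.
  have C1b : C1 b by rewrite /b; have [s ->] := mixed_partial_foldr (nseq j 0%N ++ i :: al) a; exact: sa.
  have [_ db] := C1b part partP.
  have -> : part (partial j b (rowv (xs ++ x :: t))) =
      'D_(delta_mx 0 j) (fun y => part (b y)) (rowv (xs ++ x :: t)).
    by case: partP => ->.
  exact: (is_derive_coordinate (g := fun y => part (b y)) (j := j) erefl (db j _)).
have := IH (rcons xs x); rewrite size_rcons addSn -addnS => /(_ sxm).
congr jet; apply/funext => al; apply/funext => t.
by rewrite cat_rcons; congr (part (mixed_partial _ _ _)); elim: (size xs) => //= k ->.
Qed.

(** The complement of the closed support is open, so the function vanishes near each of its points,
    and derivatives inherit this. *)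
Lemma foldr_partial_support a s (v : 'rV[R]_n) : ~ closure [set u | a u != 0] v ->
  foldr (@partial R n) a s v = 0.
Proof.
elim: s v => [|j s IH] v Sv /=.
  by apply: contra_notP Sv => /eqP av; exact: subset_closure.
set S := closure _ in Sv IH.
have nS : \forall y \near v, foldr (@partial R n) a s y = 0.
  have oS : open (~` S) by apply: closed_openC; exact: closed_closure.
  by apply: filterS (open_nbhs_nbhs (conj oS Sv)).
have d0 (part : R[i] -> R) : part 0 = 0 ->
    'D_(delta_mx 0 j) (fun y => part (foldr (@partial R n) a s y)) v = 0.
  move=> part0; rewrite (@near_eq_derive _ _ _ _ (cst 0)); first exact: derive_cst.
  by apply: filterS nS => u ->.
by rewrite [LHS]/partial !d0.
Qed.

Lemma compact_continuous_bounded (S : set 'rV[R]_n) (f : 'rV[R]_n -> R) :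
  compact S -> continuous f -> exists2 M, 0 <= M & forall v, S v -> `|f v| <= M.
Proof.
move=> cS cf; have /compact_bounded[M [_ hM]] := continuous_compact (continuous_subspaceT cf) cS.
exists (`|M| + 1); first by rewrite addr_ge0.
by move=> x Sx; apply: hM; [rewrite ltr_pwDr// ler_norm|exists x].
Qed.

(** B comes from the support and serves all orders at once. M exists for each K because finitely
    many multi-indices have entries at most K, whence the index type ['I_K.+1]. *)
Lemma mixed_partial_bounds a : smooth a -> compactly_supported a ->
  exists2 B, 0 <= B & forall K : nat, exists M,
  forall part : R[i] -> R, part = @complex.Re R \/ part = @complex.Im R ->
  (forall al t, has (fun x => B < `|x|) t -> size t = n ->
     part (mixed_partial al a (rowv t)) = 0) /\
  (forall al t, size al = n -> all (leq^~ K) al ->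
     `|part (mixed_partial al a (rowv t))| <= M).
Proof.
move=> sa; rewrite /compactly_supported; set S := closure _ => ca.
have part0 (part : R[i] -> R) : part = @complex.Re R \/ part = @complex.Im R -> part 0 = 0.
  by case=> ->.
have /choice[b hb] j : exists b : R, 0 <= b /\ forall v, S v -> `|v 0 j| <= b.
  have [M M0 hM] := compact_continuous_bounded ca (@coord_continuous _ 1 n 0 j).
  by exists M.
exists (\sum_j b j); first by apply: sumr_ge0 => j _; case: (hb j).
move=> K.
have /choice[N hN] (al : {ffun 'I_n -> 'I_K.+1}) : exists N : R, forall part,
    part = @complex.Re R \/ part = @complex.Im R ->
    0 <= N /\ forall v, `|part (mixed_partial [seq (al j : nat) | j <- enum 'I_n] a v)| <= N.
  set D := mixed_partial _ _.
  have [s Ds] := mixed_partial_foldr [seq (al j : nat) | j <- enum 'I_n] a.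
  have cD part : part = @complex.Re R \/ part = @complex.Im R -> continuous (fun v => part (D v)).
    by move=> pP; have [] := sa s part pP; rewrite -Ds.
  have [M1 M10 h1] := compact_continuous_bounded ca (cD _ (or_introl erefl)).
  have [M2 M20 h2] := compact_continuous_bounded ca (cD _ (or_intror erefl)).
  exists (M1 + M2) => part pP; split; first exact: addr_ge0.
  move=> x; have [Sx|Sx] := pselect (S x); last first.
    by rewrite /D Ds foldr_partial_support// part0// normr0 addr_ge0.
  by case: pP => ->; [apply: (le_trans (h1 _ Sx))|apply: (le_trans (h2 _ Sx))]; rewrite ?lerDl ?lerDr.
exists (\sum_al N al) => part pP; split => [al t /hasP[x xt Bx] st|al t sal alK].
  have [s ->] := mixed_partial_foldr al a.
  rewrite foldr_partial_support ?part0// -/S => St.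
  have xn : (index x t < n)%N by rewrite -st index_mem.
  move: Bx; rewrite ltNge => /negP; apply.
  have /(_ _ St) := (hb (Ordinal xn)).2.
  rewrite mxE/= nth_index// => /le_trans; apply.
  rewrite (bigD1 (Ordinal xn))//= lerDl sumr_ge0// => j _; by case: (hb j).
pose be : {ffun 'I_n -> 'I_K.+1} := [ffun j : 'I_n => inord (nth 0%N al j)].
have beE : [seq (be j : nat) | j <- enum 'I_n] = al.
  apply: (@eq_from_nth _ 0%N); first by rewrite size_map size_enum_ord.
  move=> i; rewrite size_map size_enum_ord => i_n.
  rewrite (nth_map (Ordinal i_n)) ?size_enum_ord//.
  rewrite (_ : nth _ _ _ = Ordinal i_n); last by apply/val_inj; rewrite /= nth_enum_ord.
  by rewrite ffunE inordK//= ltnS; apply: (allP alK); rewrite mem_nth ?sal.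
have := (hN be part pP).2 (rowv t); rewrite beE => /le_trans; apply.
rewrite (bigD1 be)//= lerDl sumr_ge0// => al' _.
by case: (hN al' part pP).
Qed.

End smooth_jets.

(** * Complex amplitudes and truncation to the index set *)

Section complex_expansion.
Context {R : realType} (n : nat).
Notation T := (measurableTypeR R).
Implicit Types (p : 'I_n -> R) (a : 'rV[R]_n -> R[i]).

Definition is_part (part : R[i] -> R) :=
  part = @complex.Re R \/ part = @complex.Im R.

Lemma partB (part : R[i] -> R) z w : is_part part -> part (z - w) = part z - part w.
Proof. by case=> ->; [exact: Re_sub|exact: Im_sub]. Qed.

Lemma partN (part : R[i] -> R) z : is_part part -> part (- z) = - part z.
Proof. by case=> ->; case: z. Qed.

Lemma part_sum (part : R[i] -> R) I (s : seq I) (P : pred I) (f : I -> R[i]) :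
  is_part part -> part (\sum_(i <- s | P i) f i) = \sum_(i <- s | P i) part (f i).
Proof.
move=> pP; apply: (big_morph part) => [z w|]; last by case: pP => ->.
by case: pP => ->; [exact: Re_add|exact: Im_add].
Qed.

Lemma part_mulC (part : R[i] -> R) z (r : R) : is_part part -> part (z * r%:C) = part z * r.
Proof. by case=> ->; rewrite ?Re_mul ?Im_mul /=; ring. Qed.

(** [alpha_exp p al < omega] forces [(al j).+1 <= omega * p j <= K], so the index set lies in the
    cube of side K. *)
Lemma big_Omega (V : nmodType) p omega K (f : {ffun 'I_n -> nat} -> V) :
  (forall j, 0 < p j) -> (forall j, omega * p j <= K%:R) ->
  \sum_(al \in [set al | alpha_exp p al < omega]) f al =
  \sum_(al : {ffun 'I_n -> 'I_K} | alpha_exp p [ffun j => al j : nat] < omega)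
    f [ffun j => al j : nat].
Proof.
move=> p0 pK; pose h (al : {ffun 'I_n -> 'I_K}) : {ffun 'I_n -> nat} := [ffun j => al j : nat].
rewrite -[RHS](big_map h (fun al => alpha_exp p al < omega) f).
rewrite [RHS]bigfs//.
  rewrite map_inj_uniq ?index_enum_uniq// => al be /ffunP hab.
  by apply/ffunP => j; apply/val_inj; have := hab j; rewrite !ffunE.
move=> al alo; apply: contraNeq => _.
have alK j : (al j < K)%N.
  rewrite -(ltr_nat R); apply: (@lt_le_trans _ _ (al j).+1%:R); first by rewrite ltr_nat.
  apply: le_trans (pK j); rewrite -ler_pdivrMr//.
  apply: le_trans (ltW alo); rewrite /alpha_exp (bigD1 j)//= lerDl.
  by apply: sumr_ge0 => i _; rewrite divr_ge0// ltW.
apply/mapP; exists [ffun j => Ordinal (alK j)]; first exact: mem_index_enum.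
by apply/ffunP => j; rewrite /h !ffunE.
Qed.

(** The real and imaginary parts of the integral are combinations of four real integrals, with
    phases 0 and [- pi / 2]. The exponent omega is arbitrary, since the order K of the real
    expansions is free. *)
Lemma complex_expansion (D : 'I_n -> set R) (phi : 'I_n -> R -> R) p e omega
    (c : 'I_n -> nat -> R[i]) a :
  (forall j, measurable (D j : set T)) ->
  (forall j, measurable_fun setT (phi j : T -> R)) ->
  (forall j, 0 < p j) -> 0 < e ->
  (forall j, osc_expansion (D j) (phi j) (p j) e (c j)) ->
  smooth a -> compactly_supported a ->
  exists C : R, forall lam : R, 1 <= lam ->
  Normc.normc
    (Cintegral (lebesgue_tuple R n) (box D)
       (fun t => expi (lam * \sum_j phi j (tnth t j)) * a (vec t)) -
     \sum_(al \in [set al | alpha_exp p al < omega])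
       (\prod_j c j (al j)) * (multi_partial al a 0 / (multi_fact al)%:R) *
       (lam `^ (- alpha_exp p al))%:C)
  <= C * lam `^ (- omega).
Proof.
move=> mD mphi p0 e0 E1 sa ca.
(* The first summand gives [e * K >= omega], which makes the remainder small enough; the second
   gives [K >= omega * p j], so that the cube contains the index set. *)
pose K := (Num.truncn (`|omega| / e + \sum_j `|omega| * p j)).+1.
have sum0 : 0 <= \sum_j `|omega| * p j.
  by apply: sumr_ge0 => j _; rewrite mulr_ge0// ltW.
have K_gt : `|omega| / e + \sum_j `|omega| * p j < K%:R by exact: truncnS_gt.
have eK : omega <= e * K%:R.
  apply: le_trans (ler_norm _) _; rewrite mulrC -ler_pdivrMr//.
  by apply: le_trans (ltW K_gt); rewrite lerDl.
have pK j : omega * p j <= K%:R.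
  apply: le_trans (ltW K_gt); apply: (@le_trans _ _ (`|omega| * p j)).
    by rewrite ler_wpM2r ?ler_norm// ltW.
  rewrite (bigD1 j)//= addrCA lerDl addr_ge0 ?divr_ge0 ?(ltW e0)//.
  by apply: sumr_ge0 => i _; rewrite mulr_ge0// ltW.
have [B B0 hB] := mixed_partial_bounds sa ca.
have [M hM] := hB K.
have [C C0 hC] := multi_osc_expansionP mD mphi p0 E1 K B0.
pose h (al : {ffun 'I_n -> 'I_K}) : {ffun 'I_n -> nat} := [ffun j => al j : nat].
pose P al := multi_partial (h al) a 0.
pose w al := (\prod_j c j (h al j)) * (P al / (multi_fact (h al))%:R).
have M0 : 0 <= M.
  have [_ /(_ (nseq n 0%N) [::])] := hM _ (or_introl erefl).
  by rewrite size_nseq all_nseq orbT => /(_ erefl erefl); exact: le_trans.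
(* Each of the two parts is made of two real integrals, whence the factor 4; the sum bounds the
   terms of the cube outside the index set. *)
exists (C * M *+ 4 + \sum_al (`|complex.Re (w al)| + `|complex.Im (w al)|)) => lam lam1.
have lam0 : 0 < lam by exact: lt_le_trans lam1.
pose f (part : R[i] -> R) (t : n.-tuple T) := part (a (vec t)).
have fE part t : f part t = part (mixed_partial (nseq n 0%N) a (rowv n t)).
  by rewrite /f /mixed_partial foldr_iter0 rowv_tuple.
have mf part : is_part part -> measurable_fun setT (f part).
  move=> pP; apply: (measurable_continuous_vec (f := fun v => part (a v))).
  by have [] := sa [::] part pP.
pose X part b := \int[lebesgue_tuple R n]_(t in box D)
  (cos (b + lam * \sum_j phi j (tnth t j)) * f part t).
have mbD : measurable (box D) by exact: measurable_box.
have Xi part b : is_part part -> (lebesgue_tuple R n).-integrable (box D)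
    (EFin \o (fun t => cos (b + lam * \sum_j phi j (tnth t j)) * f part t)).
  move=> pP; have [h1 h2] := hM part pP.
  have mI : measurable (box (fun=> `[- B, B]%classic) : set (n.-tuple T)) by exact: measurable_box.
  apply: (integrableS measurableT mbD (@subsetT _ _)).
  apply: (integrable_bounded_support mI (lebesgue_tuple_box n B) (M := M)).
  - by apply: measurable_funM; [exact: measurable_phase|exact: mf].
  - move=> t; rewrite normrM -[leRHS]mul1r ler_pM ?cos_max// fE h2 ?size_nseq//.
    by rewrite all_nseq orbT.
  - move=> t tB; rewrite fE h1 ?mulr0 ?size_tuple//.
    apply: contra_notT tB => /hasPn tB j /=.
    by rewrite in_itv/= -ler_norml leNgt; apply: tB; exact: mem_tnth.
pose S part b := \sum_al complex.Re ((\prod_j c j (h al j)) * expi b) *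
  (part (P al) / (multi_fact (h al))%:R) * lam `^ (- alpha_exp p (h al)).
have XS part b : is_part part -> `|X part b - S part b| <= C * M * lam `^ (- omega).
  move=> pP; have [h1 h2] := hM part pP.
  have mF : measurable_fun setT (fun t : n.-tuple T =>
      part (mixed_partial (nseq n 0%N) a (rowv n t))).
    by rewrite (_ : (fun t => _) = f part); [exact: mf|apply/funext => t; rewrite fE].
  have := hC _ M b lam (jet_mixed_partial sa pP) mF (fun al t _ st ht => h1 al t ht st)
    (fun al t sal _ => h2 al t sal) lam1.
  have -> : \int[lebesgue_tuple R n]_(t in box D) (cos (b + lam * \sum_j phi j (tnth t j)) *
      part (mixed_partial (nseq n 0%N) a (rowv n t))) = X part b.
    by apply: eq_Rintegral => t _; rewrite fE.
  rewrite (_ : \sum_al _ = S part b); last first.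
    apply: eq_bigr => al _; congr (_ * (_ / _) * _).
    - by congr (complex.Re (_ * _)); apply: eq_bigr => j _; rewrite ffunE.
    - rewrite /P multi_partialE; congr (part (mixed_partial _ _ _)).
        by apply: eq_map => j; rewrite ffunE.
      by apply/rowP => j; rewrite !mxE nth_nseq if_same.
    - by congr (_%:R); apply: eq_bigr => j _; rewrite ffunE.
    - by congr (_ `^ (- _)); apply: eq_bigr => j _; rewrite ffunE.
  move=> /le_trans; apply; rewrite ler_wpM2l ?mulr_ge0//.
  by rewrite ler_powR// lerN2.
set I := Cintegral _ _ _.
have IE : I = (X (@complex.Re R) 0 - X (@complex.Im R) (- (pi / 2))) +i*
              (X (@complex.Im R) 0 + X (@complex.Re R) (- (pi / 2))).
  have rP : is_part (@complex.Re R) by left.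
  have iP : is_part (@complex.Im R) by right.
  rewrite /I /Cintegral /X -RintegralB ?Xi// -RintegralD ?Xi//.
  have sinE u : sin u = cos (- (pi / 2) + u) by rewrite addrC cosBpihalf.
  by congr (_ +i* _); apply: eq_Rintegral => t _; rewrite ?(Re_mul, Im_mul) /expi /= sinE add0r.
pose term al := w al * (lam `^ (- alpha_exp p (h al)))%:C.
(* The four real sums reassemble into the complex one because [Re (z e^(-i pi/2)) = Im z]. *)
have sumE : (S (@complex.Re R) 0 - S (@complex.Im R) (- (pi / 2))) +i*
            (S (@complex.Im R) 0 + S (@complex.Re R) (- (pi / 2))) = \sum_al term al.
  have natVC k : k%:R^-1 = (k%:R^-1)%:C :> R[i] by rewrite fmorphV rmorph_nat.
  have e0E : expi 0 = 1 :> R[i] by rewrite /expi cos0 sin0.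
  have ehE z : complex.Re (z * expi (- (pi / 2))) = complex.Im z.
    by rewrite Re_mul /expi /= cosN sinN cos_pihalf sin_pihalf; ring.
  apply/eqP; rewrite eq_complex /=; apply/andP; split; apply/eqP.
    rewrite (part_sum _ _ _ (or_introl erefl)) -sumrB; apply: eq_bigr => al _.
    rewrite (part_mulC _ _ (or_introl erefl)) /w natVC mulrA.
    rewrite (part_mulC _ _ (or_introl erefl)) e0E ehE mulr1 Re_mul; ring.
  rewrite (part_sum _ _ _ (or_intror erefl)) -big_split; apply: eq_bigr => al _ /=.
  rewrite (part_mulC _ _ (or_intror erefl)) /w natVC mulrA.
  rewrite (part_mulC _ _ (or_intror erefl)) e0E ehE mulr1 Im_mul; ring.
rewrite (big_Omega _ p0 pK) -/(term _).
pose Q al := alpha_exp p (h al) < omega.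
have tail_le part : is_part part ->
    `|part (\sum_al term al - \sum_(al | Q al) term al)| <=
    \sum_al `|part (w al)| * lam `^ (- omega).
  move=> pP; rewrite (bigID Q)/= addrAC subrr add0r part_sum//.
  apply: le_trans (ler_norm_sum _ _ _) _.
  rewrite [leRHS](bigID Q)/= -[leLHS]add0r lerD//.
    by apply: sumr_ge0 => al _; rewrite mulr_ge0 ?powR_ge0.
  apply: ler_sum => al; rewrite /Q -leNgt => oal.
  rewrite part_mulC// normrM ler_wpM2l// ger0_norm ?powR_ge0//.
  by rewrite ler_powR// lerN2.
apply: le_trans (normc_le _) _.
have rP : is_part (@complex.Re R) by left.
have iP : is_part (@complex.Im R) by right.
have split_le part (u : R) : is_part part -> `|part (I - \sum_al term al)| <= u ->
   `|part (I - \sum_(al | Q al) term al)| <= u + \sum_al `|part (w al)| * lam `^ (- omega).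
  move=> pP hu; rewrite -(subrKA (\sum_al term al)) -[X in part (_ + X)]opprK partB//.
  apply: le_trans (ler_normB _ _) _; rewrite lerD//.
  by apply: le_trans (tail_le part pP); rewrite partN// normrN.
set u := C * M * lam `^ (- omega) in XS.
have Re_le : `|complex.Re (I - \sum_al term al)| <= u + u.
  have E (x y s t : R) : x - y - (s - t) = (x - s) - (y - t) by ring.
  by rewrite -sumE IE Re_sub /= E (le_trans (ler_normB _ _))// lerD// XS.
have Im_le : `|complex.Im (I - \sum_al term al)| <= u + u.
  by rewrite -sumE IE Im_sub /= opprD addrACA (le_trans (ler_normD _ _))// lerD// XS.
apply: le_trans (lerD (split_le _ _ rP Re_le) (split_le _ _ iP Im_le)) _.
rewrite addrACA -big_split/= mulrDl mulr_suml lerD//.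
  by rewrite /u -mulrnAl; lra.
by apply: ler_sum => al _; rewrite mulrDl.
Qed.

End complex_expansion.

(** * The common rate and the exponent of the remainder *)

Section rate.
Context {R : realType} (n : nat).

(** Each quotient is [min 1 (1 / p j)], positive and at most 1, so starting the minimum at 1 costs
    nothing. *)
Lemma exists_growth_rate (p : 'I_n -> R) : (forall j, 0 < p j) ->
  exists2 e : R, 0 < e & forall j, e <= (1 - growth (p j)) / p j.
Proof.
move=> p0; exists (\big[Num.min/1]_j ((1 - growth (p j)) / p j)).
  by apply: lt_bigmin => // j _; rewrite divr_gt0// subr_gt0 growth_lt1.
by move=> j; exact: bigmin_le_cond.
Qed.

(** Integer exponents have no fractional part, which reduces [order_exp] to [(N + 1) / max m]. *)
Lemma max_frac_nat (m : 'I_n -> nat) : max_frac (fun j => (m j)%:R : R) = 0.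
Proof.
rewrite /max_frac; elim/big_rec: _ => // j x _ ->.
by rewrite (_ : Num.floor _ = m j) ?subrr ?maxxx//; exact: (@intrKfloor R (Posz (m j))).
Qed.

End rate.

(** Both parts are instances of [complex_expansion] with omega equal to [order_exp], and the
    estimates hold from lam = 1 on. The coefficients there are closed forms, identified with the
    oscillatory integrals [Itilde] by [ItildeE]. *)
Theorem theorem6p5 (R : realType) (n : nat) (a : 'rV[R]_n.+1 -> R[i])
    (sg : 'I_n.+1 -> R)
    (a_smooth : smooth a) (a_cs : compactly_supported a)
    (sg_pm : forall j, sg j = 1 \/ sg j = -1) :
  (forall p : 'I_n.+1 -> R, (forall j, 0 < p j) ->
    (forall (j : 'I_n.+1) (k : nat),
      is_Os_integral (sg j) (p j) k.+1%:R (Itilde (sg j) (p j) k.+1%:R) /\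
      Itilde (sg j) (p j) k.+1%:R =
        Itilde_closed_form (sg j) (p j) k.+1%:R) /\
    forall N : nat, (0 < N)%N ->
      exists C : R, \forall lam \near +oo,
      Normc.normc
        (Cintegral (lebesgue_tuple R n.+1) (@pos_orthant R n.+1)
           (fun t => expi (lam * \sum_j sg j * tnth t j `^ p j) * a (vec t))
         - \sum_(alpha \in Omega p N)
             (\prod_j Itilde (sg j) (p j) (alpha j).+1%:R)
             * (multi_partial alpha a 0 / (multi_fact alpha)%:R)
             * (lam `^ (- alpha_exp p alpha))%:C)
      <= C * lam `^ (- order_exp p N))
  /\
  (forall m : 'I_n.+1 -> nat, (forall j, (0 < m j)%N) ->
    (forall (j : 'I_n.+1) (k : nat),
      let sgm := sg j * (-1) ^+ m j in
      is_Os_integral sgm (m j)%:R k.+1%:R (Itilde sgm (m j)%:R k.+1%:R) /\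
      Itilde sgm (m j)%:R k.+1%:R =
        Itilde_closed_form sgm (m j)%:R k.+1%:R) /\
    forall N : nat, (0 < N)%N ->
      exists C : R, \forall lam \near +oo,
      Normc.normc
        (Cintegral (lebesgue_tuple R n.+1) setT
           (fun t => expi (lam * \sum_j sg j * tnth t j ^+ m j) * a (vec t))
         - \sum_(alpha \in Omega (fun j => (m j)%:R : R) N)
             (\prod_j
                (Itilde (sg j) (m j)%:R (alpha j).+1%:R
                 + (-1) ^+ alpha j
                   * Itilde (sg j * (-1) ^+ m j) (m j)%:R (alpha j).+1%:R))
             * (multi_partial alpha a 0 / (multi_fact alpha)%:R)
             * (lam `^ (- alpha_exp (fun j => (m j)%:R : R) alpha))%:C)
      <= C * lam `^ (- (N.+1%:R / maxp (fun j => (m j)%:R : R)))).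
Proof.
have Os (s q : R) k : 0 < q -> s = 1 \/ s = -1 ->
    is_Os_integral s q k.+1%:R (Itilde s q k.+1%:R) /\
    Itilde s q k.+1%:R = Itilde_closed_form s q k.+1%:R.
  by move=> q0 s1; rewrite ItildeE//; split => //; exact: is_Os_integral_closed_form.
split=> [p p0|m m0].
  split=> [j k|N _]; first exact: Os.
  have [e e0 ep] := exists_growth_rate p0.
  have mD (j : 'I_n.+1) : measurable (`]0, +oo[%classic : set (measurableTypeR R)) by [].
  have mphi j : measurable_fun setT (fun x : measurableTypeR R => sg j * x `^ p j).
    by apply: measurable_funM => //; exact: measurable_powR.
  have [C hC] := complex_expansion (order_exp p N) mD mphi p0 e0
    (fun j => half_line_expansion (p0 j) (sg_pm j) (ep j)) a_smooth a_cs.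
  exists C; near=> lam.
  have lam1 : 1 <= lam by near: lam; exact: nbhs_pinfty_ge.
  apply: le_trans (hC lam lam1); rewrite le_eqVlt; apply/orP; left; apply/eqP.
  congr (Normc.normc (Cintegral _ _ _ - _)).
    by apply/seteqP; split => t /= ht j; have := ht j; rewrite /= in_itv/= andbT.
  apply: eq_fsbigr => al _; congr (_ * _ * _).
  by apply: eq_bigr => j _; exact: (Os _ _ _ _ _).2.
have p0 j : 0 < (m j)%:R :> R by rewrite ltr0n.
have sgm j : sg j * (-1) ^+ m j = 1 \/ sg j * (-1) ^+ m j = -1.
  rewrite -signr_odd; case: (odd (m j)); rewrite ?expr1 ?expr0 ?mulr1 ?mulrN1//.
  by case: (sg_pm j) => ->; [right|left; rewrite opprK].
split=> [j k|N _]; first exact: Os.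
have [e e0 ep] := exists_growth_rate p0.
have mphi j : measurable_fun setT (fun x : measurableTypeR R => sg j * x ^+ m j).
  by apply: measurable_funM => //; exact: measurable_funX.
have [C hC] := complex_expansion (order_exp (fun j => (m j)%:R : R) N) (fun=> measurableT) mphi p0 e0
  (fun j => line_expansion (m0 j) (sg_pm j) (ep j)) a_smooth a_cs.
exists C; near=> lam.
have lam1 : 1 <= lam by near: lam; exact: nbhs_pinfty_ge.
have := hC lam lam1; rewrite {2}/order_exp max_frac_nat subr0.
apply: le_trans; rewrite le_eqVlt; apply/orP; left; apply/eqP.
congr (Normc.normc (Cintegral _ _ _ - _)); first by apply/seteqP; split.
apply: eq_fsbigr => al _; congr (_ * _ * _).
by apply: eq_bigr => j _; congr (_ + _ * _); exact: (Os _ _ _ _ _).2.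
Unshelve. all: by end_near. Qed.
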